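(* Let $m$ be a non-negative integer. The function $\tilde{\varphi}^{[m]}(\tau,u,v,t)$ defined in the context has the following properties ($\tau,u,v,t\in\mathbb{C}$, $\operatorname{Im}\tau>0$): (a) $\tilde{\varphi}^{[m]}\left(-\frac1\tau,\frac u\tau,\frac v\tau,t-\frac{u^2-v^2}{\tau}\right)=\tau\,\tilde{\varphi}^{[m]}(\tau,u,v,t)$. (b) $\tilde{\varphi}^{[m]}(\tau,u+a,v+b,t)=\tilde{\varphi}^{[m]}(\tau,u,v,t)$ if $a,b\in\frac12\mathbb{Z}$ are such that $a+b\in\mathbb{Z}$. (c) $\tilde{\varphi}^{[m]}(\tau,u,-v,t)=\tilde{\varphi}^{[m]}(\tau,u,v,t)$ and $\tilde{\varphi}^{[m]}(\tau,-u,v,t)=-\tilde{\varphi}^{[m]}(\tau,u,v,t)$. (d) $\tilde{\varphi}^{[m]}(\tau+1,u,v,t)=\tilde{\varphi}^{[m]}(\tau,u,v,t)$. (e) $\tilde{\varphi}^{[m]}(\tau,u+a\tau,v+b\tau,t)=q^{(m+1)(b^2-a^2)}e^{4\pi i(m+1)(-au+bv)}\,\tilde{\varphi}^{[m]}(\tau,u,v,t)$ if $a,b\in\frac12\mathbb{Z}$ are such that $a+b\in\mathbb{Z}$.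
   Context: Notation: $q=e^{2\pi i\tau}$, $q^s=e^{2\pi i s\tau}$. For a positive integer $k$ and $j\in\mathbb{Z}/2k\mathbb{Z}$, $\Theta_{j,k}(\tau,z)=\sum_{n\in\mathbb{Z}+\frac{j}{2k}}q^{kn^2}e^{2\pi i knz}$. For an integer $m\ge0$ let $$\Phi^{[m]}(\tau,z_1,z_2,t)=e^{2\pi i(m+1)t}\sum_{j\in\mathbb{Z}}\left(\frac{e^{2\pi ij(m+1)(z_1+z_2)}q^{j^2(m+1)}}{1-e^{2\pi iz_1}q^j}-\frac{e^{-2\pi ij(m+1)(z_1+z_2)}q^{j^2(m+1)}}{1-e^{-2\pi iz_2}q^j}\right)$$ and $\varphi^{[m]}(\tau,u,v,t)=\Phi^{[m]}(\tau,v-u,-v-u,t)$ (i.e. $u=-\frac12(z_1+z_2)$, $v=\frac12(z_1-z_2)$). Let $E(x)=2\int_0^xe^{-\pi w^2}dw$ and, for a positive integer $k$ and $j\in\mathbb{Z}$, let $$R_{k;j}(\tau,v)=\sum_{n\in\mathbb{Z},\,n\equiv j\bmod 2k}\left(\operatorname{sign}\left(n+\tfrac12\right)-E\left(\left(n+2k\frac{\operatorname{Im}v}{\operatorname{Im}\tau}\right)\left(\frac{\operatorname{Im}\tau}{k}\right)^{1/2}\right)\right)e^{-\frac{\pi in^2}{2k}\tau-2\pi inv}$$ (it depends only on $j\bmod 2k$). Put $$\varphi^{[m]}_{\rm add}(\tau,u,v,t)=\tfrac12e^{2\pi i(m+1)t}\sum_{j\in\mathbb{Z}/(2m+2)\mathbb{Z}}R_{m+1;j}(\tau,v)\,(\Theta_{j,m+1}-\Theta_{-j,m+1})(\tau,2u),$$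 $$\tilde{\varphi}^{[m]}=\varphi^{[m]}+\varphi^{[m]}_{\rm add}.$$ Identities are understood at points where both sides are defined (away from the poles of $\varphi^{[m]}$). *)

(* Defs.v *)
From Stdlib Require Export Reals ZArith.
From Coquelicot Require Export Coquelicot.

Open Scope C_scope.

Definition Cexp (z : C) : C := (exp (Re z) * cos (Im z), exp (Re z) * sin (Im z))%R.

(* e^{2 pi i z} *)
Definition e2pi (z : C) : C := Cexp (2 * PI * Ci * z).

(* q^s = e^{2 pi i s tau} *)
Definition qpow (tau : C) (s : R) : C := e2pi (s * tau).

Definition CSeries (a : nat -> C) : C :=
  (Series (fun n => Re (a n)), Series (fun n => Im (a n))).

(* Sum over all integers.  Every sum formed below converges absolutely when
   Im tau > 0 (away from the poles, for Phi), so neither this way of splitting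
   the sum nor the choice of an affine bijection from Z onto the index set
   matters. *)
Definition ZSeries (f : Z -> C) : C :=
  CSeries (fun n => f (Z.of_nat n)) + CSeries (fun n => f (- Z.of_nat (S n))%Z).

(* The index n in Z + j/(2k) is written N + j/(2k) with N in Z. *)
Definition Theta (j : Z) (k : nat) (tau z : C) : C :=
  ZSeries (fun N =>
    let n := (IZR N + IZR j / (2 * INR k))%R in
    qpow tau (INR k * n ^ 2) * e2pi (INR k * n * z)).

Definition Phi (m : nat) (tau z1 z2 t : C) : C :=
  e2pi (INR (m + 1) * t) *
  ZSeries (fun j =>
    e2pi (IZR j * INR (m + 1) * (z1 + z2)) * qpow tau (IZR j ^ 2 * INR (m + 1))
      / (1 - e2pi z1 * qpow tau (IZR j))
    - e2pi (- (IZR j * INR (m + 1) * (z1 + z2))) * qpow tau (IZR j ^ 2 * INR (m + 1))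
      / (1 - e2pi (- z2) * qpow tau (IZR j))).

Definition Phi_defined (tau z1 z2 : C) : Prop :=
  forall j : Z,
    1 - e2pi z1 * qpow tau (IZR j) <> 0 /\ 1 - e2pi (- z2) * qpow tau (IZR j) <> 0.

Definition phi (m : nat) (tau u v t : C) : C := Phi m tau (v - u) (- v - u) t.

(* (u, v) is not a pole of phi^{[m]}(tau, ., ., t); the polar set does not depend
   on m and t. *)
Definition phi_defined (tau u v : C) : Prop := Phi_defined tau (v - u) (- v - u).

Definition E (x : R) : R := (2 * RInt (fun w => exp (- PI * w ^ 2)) 0 x)%R.

(* The index n congruent to j mod 2k is written j + 2kN with N in Z. *)
Definition Rfun (k : nat) (j : Z) (tau v : C) : C :=
  ZSeries (fun N =>
    let n := IZR (j + 2 * Z.of_nat k * N) in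
    (sign (n + 1 / 2)
     - E ((n + 2 * INR k * (Im v / Im tau)) * sqrt (Im tau / INR k)))%R
    * Cexp (- (PI * Ci * n ^ 2 / (2 * INR k)) * tau - 2 * PI * Ci * n * v)).

(* Z/(2m+2)Z is represented by 0, ..., 2m+1. *)
Definition phi_add (m : nat) (tau u v t : C) : C :=
  1 / 2 * e2pi (INR (m + 1) * t) *
  sum_n (fun i : nat =>
    let j := Z.of_nat i in
    Rfun (m + 1) j tau v
    * (Theta j (m + 1) tau (2 * u) - Theta (- j) (m + 1) tau (2 * u)))
    (2 * m + 1).

Definition phi_tilde (m : nat) (tau u v t : C) : C :=
  phi m tau u v t + phi_add m tau u v t.

Definition integer (x : R) : Prop := exists n : Z, x = IZR n.

Definition half_integer (x : R) : Prop := exists n : Z, x = (IZR n / 2)%R.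

(* Main.v *)
(** Write k = m + 1, y = Im tau and X = exp (2 pi i x).  The key identity is

      1/(1 - X) - 1 + 1/2 sum_r (sign (r + 1/2) - E ((r + c) s)) exp (-2 pi i r x)
        = i/(2 pi) sum_n exp (2 pi i c (x + n) - pi (x + n)^2 / s^2) / (x + n),

    for real c, s > 0 and x not an integer.  Both sides are multiplied by X when c becomes
    c + 1, and their derivatives in c agree by the inversion formula for theta functions;
    hence their difference is constant in c and fixed by multiplication by X <> 1, so it is zero.

    The product of R and Theta in the correction term is a sum over pairs (r, s) with
    r = s mod 2k.  Writing s = r - 2kj, the sum over r completes the j-th summand of phi to the
    left side of the identity at x = v - u + j tau.  So, up to the elementary prefactor,
    phi_tilde is the odd part in u of an absolutely convergent sum over the lattice Z tau + Z

      sum_(j, n) exp (2 pi i k tau j^2 - 4 pi i k j u + 4 pi i k (Im v / y) z - pi k z^2 / y) / z,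

    z = v - u + j tau + n, and each of the transformations (a)-(e) merely permutes this lattice.

    Theta inversion is Poisson summation for Gaussians, proved with the Fejer kernel.  It also
    yields the value of the Gaussian integral, that is, E tends to 1. *)

Require Import Defs.
From Stdlib Require Import Lra Lia Psatz.

(** * Sums over the integers *)

(** The shape of the key identity comes from the formal value X/(X - 1) of 1/2 sum_r sign (r + 1/2)
    X^(-r), whose two halves converge for |X| > 1 and |X| < 1 respectively. It cancels 1/(1 - X) -
    1, so the left side is a regularised -1/2 sum_r E ((r + c) s) X^(-r), smooth in c. The -1 leaves
    the sum of the Gaussian weights of phi, which is even in u and disappears in the odd part.

    [ZSeries] is built from [Series], which has a default value on divergent input, so every
    manipulation needs a convergence proof. All summands are dominated by Gaussians, hence one crude
    notion serves throughout: a bound K exp (-|n|), giving the partial sums over -M <= n < M the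
    error rate exp (-M). Reindexing, Fubini and identification of limits follow from finite sums and
    this rate. No series is differentiated: the derivative in c is taken in partial sums, and the
    mean value theorem transfers its exp (-M) bound to the increment. *)

Lemma Re_plus (x y : C) : Re (x + y) = (Re x + Re y)%R. Proof. reflexivity. Qed.
Lemma Im_plus (x y : C) : Im (x + y) = (Im x + Im y)%R. Proof. reflexivity. Qed.
Lemma Re_opp (x : C) : Re (- x) = (- Re x)%R. Proof. reflexivity. Qed.
Lemma Im_opp (x : C) : Im (- x) = (- Im x)%R. Proof. reflexivity. Qed.
Lemma Re_mult (x y : C) : Re (x * y) = (Re x * Re y - Im x * Im y)%R.
Proof. reflexivity. Qed.
Lemma Im_mult (x y : C) : Im (x * y) = (Re x * Im y + Im x * Re y)%R.
Proof. reflexivity. Qed.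

Lemma C_ext (x y : C) : Re x = Re y -> Im x = Im y -> x = y.
Proof. destruct x, y; simpl; congruence. Qed.

Lemma Cexp_plus (x y : C) : Cexp (x + y) = Cexp x * Cexp y.
Proof.
  unfold Cexp; apply C_ext; rewrite ?Re_mult, ?Im_mult, ?Re_plus, ?Im_plus; simpl;
    rewrite exp_plus, ?cos_plus, ?sin_plus; ring.
Qed.

Lemma Cexp_0 : Cexp 0 = 1.
Proof. unfold Cexp; simpl. rewrite exp_0, cos_0, sin_0. apply C_ext; simpl; ring. Qed.

Lemma Cmod_Cexp (z : C) : Cmod (Cexp z) = exp (Re z).
Proof.
  unfold Cmod, Cexp; simpl fst; simpl snd.
  replace ((exp (Re z) * cos (Im z)) ^ 2 + (exp (Re z) * sin (Im z)) ^ 2)%R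
    with (Rsqr (exp (Re z)))%R.
  - apply sqrt_Rsqr, Rlt_le, exp_pos.
  - pose proof (sin2_cos2 (Im z)) as H; unfold Rsqr in *.
    transitivity (exp (Re z) * exp (Re z) * (sin (Im z) * sin (Im z) + cos (Im z) * cos (Im z)))%R.
    + rewrite H; ring.
    + ring.
Qed.

Lemma sin_PI_IZR (n : Z) : sin (PI * IZR n) = 0%R.
Proof. apply sin_eq_0_1. exists n; ring. Qed.

Lemma cos_2PI_IZR (n : Z) : cos (2 * PI * IZR n) = 1%R.
Proof.
  replace (2 * PI * IZR n)%R with (2 * (PI * IZR n))%R by ring.
  rewrite cos_2a_sin, sin_PI_IZR. ring.
Qed.

Lemma sin_2PI_IZR (n : Z) : sin (2 * PI * IZR n) = 0%R.
Proof.
  replace (2 * PI * IZR n)%R with (2 * (PI * IZR n))%R by ring.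
  rewrite sin_2a, sin_PI_IZR. ring.
Qed.

Lemma Cexp_Ci (x : R) : Cexp (Ci * x) = (cos x, sin x).
Proof.
  unfold Cexp. rewrite Re_mult, Im_mult; simpl.
  replace (0 * x - 1 * 0)%R with 0%R by ring.
  replace (0 * 0 + 1 * x)%R with x by ring.
  rewrite exp_0, !Rmult_1_l. reflexivity.
Qed.

Lemma Cexp_IZR (n : Z) : Cexp (2 * PI * Ci * IZR n) = 1.
Proof.
  replace (2 * PI * Ci * IZR n) with (Ci * (2 * PI * IZR n)%R)
    by (rewrite !RtoC_mult; ring).
  rewrite Cexp_Ci, cos_2PI_IZR, sin_2PI_IZR. reflexivity.
Qed.

Lemma Cexp_period (z : C) (n : Z) : Cexp (z + 2 * PI * Ci * IZR n) = Cexp z.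
Proof. rewrite Cexp_plus, Cexp_IZR; ring. Qed.

Lemma Cmod_le_Re_Im (z : C) : (Cmod z <= Rabs (Re z) + Rabs (Im z))%R.
Proof.
  unfold Cmod. apply Rsqr_incr_0_var.
  - rewrite Rsqr_sqrt by (apply Rplus_le_le_0_compat; apply pow2_ge_0).
    unfold Rsqr. pose proof (Rabs_pos (Re z)); pose proof (Rabs_pos (Im z)).
    rewrite <- (pow2_abs (fst z)), <- (pow2_abs (snd z)).
    change (fst z) with (Re z); change (snd z) with (Im z). nra.
  - pose proof (Rabs_pos (Re z)); pose proof (Rabs_pos (Im z)); lra.
Qed.

Lemma im_le_Cmod (z : C) : (Rabs (Im z) <= Cmod z)%R.
Proof.
  eapply Rle_trans; [|apply Rmax_Cmod]. apply Rmax_r.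
Qed.

Lemma exp_le (x y : R) : (x <= y)%R -> (exp x <= exp y)%R.
Proof. intros [H|H]; [left; apply exp_increasing, H|right; congruence]. Qed.

Lemma exp_le_1 (x : R) : (x <= 0)%R -> (exp x <= 1)%R.
Proof. rewrite <- exp_0. apply exp_le. Qed.

Definition expn (n : Z) : R := exp (- Rabs (IZR n)).

Lemma expn_pos n : (0 < expn n)%R. Proof. apply exp_pos. Qed.
Lemma expn_nat n : expn (Z.of_nat n) = exp (- INR n).
Proof. unfold expn. rewrite <- INR_IZR_INZ, Rabs_pos_eq by apply pos_INR; reflexivity. Qed.
Lemma expn_opp n : expn (- n) = expn n.
Proof. unfold expn. rewrite opp_IZR, Rabs_Ropp; reflexivity. Qed.
Lemma expn_add m n : (expn (m + n) <= / expn m * expn n)%R.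
Proof.
  unfold expn. rewrite <- exp_Ropp, <- exp_plus, plus_IZR. apply exp_le.
  pose proof (Rabs_triang (IZR m + IZR n) (- IZR m)) as H.
  replace (IZR m + IZR n + - IZR m)%R with (IZR n) in H by ring.
  rewrite Rabs_Ropp in H. lra.
Qed.
Lemma expn_neg_S n : (expn (- Z.of_nat (S n)) <= exp (- INR n))%R.
Proof. rewrite expn_opp, expn_nat, S_INR. apply exp_le; lra. Qed.

Lemma exp_m1_half : (exp (- (1)) <= / 2)%R.
Proof.
  rewrite exp_Ropp. apply Rinv_le_contravar; [lra|].
  pose proof (exp_ineq1 1 ltac:(lra)); lra.
Qed.

Lemma exp_mINR_pow n : exp (- INR n) = (exp (- (1)) ^ n)%R.
Proof.
  induction n as [|n IH].
  - simpl; rewrite Ropp_0; apply exp_0.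
  - rewrite S_INR; simpl. rewrite <- IH, <- exp_plus. f_equal; ring.
Qed.

Fixpoint psum (a : nat -> R) (M : nat) : R :=
  match M with O => 0%R | S p => (psum a p + a p)%R end.

Lemma psum_S_l a M : psum a (S M) = (a O + psum (fun n => a (S n)) M)%R.
Proof. induction M as [|M IH]; simpl in *; [ring|rewrite IH; ring]. Qed.

Lemma ex_series_exp_dom (a : nat -> R) K :
  (forall n, Rabs (a n) <= K * exp (- INR n))%R -> ex_series a.
Proof.
  intros H.
  apply (ex_series_le a (fun n => K * exp (- (1)) ^ n)%R).
  - intros n. rewrite <- exp_mINR_pow. apply H.
  - apply (ex_series_scal_l (V := R_NormedModule) K (fun n => (exp (- (1)) ^ n)%R)), ex_series_geom.
    pose proof exp_m1_half; pose proof (exp_pos (-(1))). rewrite Rabs_pos_eq; lra.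
Qed.

(** The tail from M on is dominated by a geometric series of ratio exp (-1) <= 1/2, whence the
    factor 2. The induction moves the first term across, and shifting the sequence replaces K by K
    exp (-1). *)
Lemma Series_exp_dom (a : nat -> R) K M :
  (forall n, Rabs (a n) <= K * exp (- INR n))%R ->
  (Rabs (Series a - psum a M) <= 2 * K * exp (- INR M))%R.
Proof.
  revert a K; induction M as [|M IH]; intros a K H.
  - simpl psum. rewrite Rminus_0_r. simpl INR. rewrite Ropp_0, exp_0, Rmult_1_r.
    assert (Hs : ex_series (fun n => Rabs (a n))).
    { apply ex_series_exp_dom with K. intros n; rewrite Rabs_Rabsolu; apply H. }
    eapply Rle_trans; [apply Series_Rabs; exact Hs|].
    pose proof exp_m1_half; pose proof (exp_pos (-(1))).
    assert (Hq : (Rabs (exp (- (1))) < 1)%R) by (rewrite Rabs_pos_eq; lra).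
    eapply Rle_trans.
    + apply Series_le with (b := fun n => (K * exp (- (1)) ^ n)%R).
      * intros n; split; [apply Rabs_pos|]. rewrite <- exp_mINR_pow; apply H.
      * apply (ex_series_scal_l (V := R_NormedModule) K (fun n => (exp (- (1)) ^ n)%R)), ex_series_geom, Hq.
    + rewrite (Series_scal_l K), Series_geom by exact Hq.
      assert (0 <= K)%R.
      { specialize (H O); simpl in H; rewrite Ropp_0, exp_0 in H.
        pose proof (Rabs_pos (a O)); lra. }
      rewrite (Rmult_comm 2). apply Rmult_le_compat_l; [assumption|].
      replace 2%R with (/ (/ 2))%R by lra. apply Rinv_le_contravar; lra.
  - rewrite psum_S_l, Series_incr_1 by (eapply ex_series_exp_dom; exact H).
    replace (_ - _)%R with (Series (fun n => a (S n)) - psum (fun n => a (S n)) M)%R by ring.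
    eapply Rle_trans.
    + apply (IH _ (K * exp (- (1)))%R).
      intros n. eapply Rle_trans; [apply H|]. right.
      rewrite S_INR, Rmult_assoc, <- exp_plus. do 2 f_equal; ring.
    + right. rewrite S_INR, !Rmult_assoc, <- exp_plus. do 3 f_equal; ring.
Qed.

(* The sum over -M <= n < M. *)
Fixpoint zsum (f : Z -> C) (M : nat) : C :=
  match M with
  | O => 0
  | S p => zsum f p + (f (Z.of_nat p) + f (- Z.of_nat (S p))%Z)
  end.

Definition exp_decay (f : Z -> C) : Prop := exists K, forall n, (Cmod (f n) <= K * expn n)%R.

Definition is_zsum (f : Z -> C) (l : C) : Prop :=
  exists K, forall M, (Cmod (zsum f M - l) <= K * exp (- INR M))%R.

(** The factor 8 is 2 for each of four real series: real and imaginary parts of the two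
    half-sums. *)
Lemma ZSeries_dom f K :
  (forall n, Cmod (f n) <= K * expn n)%R ->
  forall M, (Cmod (zsum f M - ZSeries f) <= 8 * K * exp (- INR M))%R.
Proof.
  intros H M.
  assert (HK : (0 <= K)%R).
  { specialize (H 0%Z). unfold expn in H. rewrite Rabs_R0, Ropp_0, exp_0 in H.
    pose proof (Cmod_ge_0 (f 0%Z)); lra. }
  assert (Hp : forall n, (Cmod (f (Z.of_nat n)) <= K * exp (- INR n))%R).
  { intros n. rewrite <- expn_nat; apply H. }
  assert (Hm : forall n, (Cmod (f (- Z.of_nat (S n))%Z) <= K * exp (- INR n))%R).
  { intros n. eapply Rle_trans; [apply H|].
    apply Rmult_le_compat_l; [exact HK|apply expn_neg_S]. }
  assert (E : zsum f M
    = ((psum (fun n => Re (f (Z.of_nat n))) M, psum (fun n => Im (f (Z.of_nat n))) M) : C)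
    + (psum (fun n => Re (f (- Z.of_nat (S n))%Z)) M, psum (fun n => Im (f (- Z.of_nat (S n))%Z)) M)).
  { clear; induction M as [|M IH].
    - apply C_ext; simpl; ring.
    - cbn [zsum psum]. rewrite IH. apply C_ext; rewrite !Re_plus || rewrite !Im_plus; simpl; ring. }
  rewrite E. unfold ZSeries, CSeries.
  eapply Rle_trans; [apply Cmod_le_Re_Im|].
  assert (B1 := Series_exp_dom (fun n => Re (f (Z.of_nat n))) K M
    (fun n => Rle_trans _ _ _ (re_le_Cmod _) (Hp n))).
  assert (B2 := Series_exp_dom (fun n => Im (f (Z.of_nat n))) K M
    (fun n => Rle_trans _ _ _ (im_le_Cmod _) (Hp n))).
  assert (B3 := Series_exp_dom (fun n => Re (f (- Z.of_nat (S n))%Z)) K M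
    (fun n => Rle_trans _ _ _ (re_le_Cmod _) (Hm n))).
  assert (B4 := Series_exp_dom (fun n => Im (f (- Z.of_nat (S n))%Z)) K M
    (fun n => Rle_trans _ _ _ (im_le_Cmod _) (Hm n))).
  cbn [Re Im fst snd Cplus Cminus Copp].
  revert B1 B2 B3 B4.
  generalize (Series (fun n => Re (f (Z.of_nat n)))) (Series (fun n => Im (f (Z.of_nat n))))
    (Series (fun n => Re (f (- Z.of_nat (S n))%Z))) (Series (fun n => Im (f (- Z.of_nat (S n))%Z)))
    (psum (fun n => Re (f (Z.of_nat n))) M) (psum (fun n => Im (f (Z.of_nat n))) M)
    (psum (fun n => Re (f (- Z.of_nat (S n))%Z)) M) (psum (fun n => Im (f (- Z.of_nat (S n))%Z)) M).
  intros s1 s2 s3 s4 p1 p2 p3 p4 B1 B2 B3 B4.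
  unfold Re, Im, Cminus, Copp, Cplus; cbn [fst snd].
  replace (p1 + p3 + - (s1 + s3))%R with (- (s1 - p1) + - (s3 - p3))%R by ring.
  replace (p2 + p4 + - (s2 + s4))%R with (- (s2 - p2) + - (s4 - p4))%R by ring.
  eapply Rle_trans; [apply Rplus_le_compat; apply Rabs_triang|].
  rewrite !Rabs_Ropp. lra.
Qed.

Lemma ZSeries_correct f : exp_decay f -> is_zsum f (ZSeries f).
Proof. intros [K H]. exists (8 * K)%R. apply ZSeries_dom, H. Qed.

Lemma exp_mINR_small (d : R) : (0 < d)%R -> exists M, (exp (- INR M) < d)%R.
Proof.
  intros Hd.
  destruct (INR_unbounded (/ d)) as [M HM].
  exists M. rewrite exp_Ropp.
  rewrite <- (Rinv_inv d).
  assert (0 < / d)%R by (apply Rinv_0_lt_compat; exact Hd).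
  apply Rinv_lt_contravar.
  - apply Rmult_lt_0_compat; [assumption|apply exp_pos].
  - pose proof (exp_ineq1_le (INR M)); lra.
Qed.

Lemma C_eq_of_exp_bound (x y : C) (K : R) :
  (forall M, Cmod (x - y) <= K * exp (- INR M))%R -> x = y.
Proof.
  intros H. apply Ceq_minus, Cmod_eq_0.
  destruct (Req_dec (Cmod (x - y)) 0) as [|Hn]; [assumption|exfalso].
  pose proof (Cmod_ge_0 (x - y)) as Hp.
  assert (HK : (0 < K)%R).
  { specialize (H O); simpl in H; rewrite Ropp_0, exp_0 in H; lra. }
  destruct (exp_mINR_small (Cmod (x - y) / K)) as [M HM].
  { apply Rdiv_lt_0_compat; lra. }
  specialize (H M).
  apply (Rmult_lt_compat_l K) in HM; [|exact HK].
  replace (K * (Cmod (x - y) / K))%R with (Cmod (x - y)) in HM by (field; lra). lra.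
Qed.

Lemma Cmod_minus_le (s a b : C) (x y : R) :
  (Cmod (s - a) <= x -> Cmod (s - b) <= y -> Cmod (a - b) <= x + y)%R.
Proof.
  intros Ha Hb. replace (a - b) with ((s - b) + - (s - a)) by ring.
  eapply Rle_trans; [apply Cmod_triangle|]. rewrite Cmod_opp. lra.
Qed.

Lemma is_zsum_unique f l l' : is_zsum f l -> is_zsum f l' -> l = l'.
Proof.
  intros [K H] [K' H']. apply (C_eq_of_exp_bound _ _ (K + K')). intros M.
  rewrite Rmult_plus_distr_r. apply (Cmod_minus_le (zsum f M)); [apply H|apply H'].
Qed.

Lemma ZSeries_unique f l : exp_decay f -> is_zsum f l -> ZSeries f = l.
Proof. intros Hf H; eapply is_zsum_unique; [apply ZSeries_correct, Hf|exact H]. Qed.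

Lemma ZSeries_ext f g : (forall n, f n = g n) -> ZSeries f = ZSeries g.
Proof.
  intros H. unfold ZSeries, CSeries.
  f_equal; f_equal; apply Series_ext; intros n; rewrite H; reflexivity.
Qed.

Lemma exp_decay_ext f g : (forall n, f n = g n) -> exp_decay f -> exp_decay g.
Proof. intros H [K HK]. exists K. intros n; rewrite <- H; apply HK. Qed.

Lemma exp_decay_plus f g : exp_decay f -> exp_decay g -> exp_decay (fun n => f n + g n).
Proof.
  intros [K H] [K' H']. exists (K + K')%R. intros n.
  eapply Rle_trans; [apply Cmod_triangle|]. specialize (H n); specialize (H' n); lra.
Qed.

Lemma exp_decay_scal c f : exp_decay f -> exp_decay (fun n => c * f n).
Proof.
  intros [K H]. exists (Cmod c * K)%R. intros n. rewrite Cmod_mult, Rmult_assoc.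
  apply Rmult_le_compat_l; [apply Cmod_ge_0|apply H].
Qed.

Lemma exp_decay_pos f K : (forall n, Cmod (f n) <= K * expn n)%R -> (0 <= K)%R.
Proof.
  intros H. specialize (H 0%Z). pose proof (Cmod_ge_0 (f 0%Z)). pose proof (expn_pos 0). nra.
Qed.

Lemma exp_decay_shift d f : exp_decay f -> exp_decay (fun n => f (n + d)%Z).
Proof.
  intros [K H]. exists (K * / expn d)%R. intros n.
  eapply Rle_trans; [apply H|]. rewrite Rmult_assoc.
  apply Rmult_le_compat_l; [exact (exp_decay_pos _ _ H)|].
  rewrite Z.add_comm. apply expn_add.
Qed.

Lemma exp_decay_flip f : exp_decay f -> exp_decay (fun n => f (- n)%Z).
Proof. intros [K H]. exists K. intros n. rewrite <- (expn_opp n); apply H. Qed.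

Lemma exp_decay_dilate (k l : Z) f : (0 < k)%Z -> exp_decay f -> exp_decay (fun n => f (l + k * n)%Z).
Proof.
  intros Hk [K H]. exists (K * / expn l)%R. intros n.
  eapply Rle_trans; [apply H|]. rewrite Rmult_assoc.
  pose proof (exp_decay_pos _ _ H). apply Rmult_le_compat_l; [assumption|].
  eapply Rle_trans; [apply expn_add|].
  apply Rmult_le_compat_l; [left; apply Rinv_0_lt_compat, expn_pos|].
  unfold expn. apply exp_le, Ropp_le_contravar. rewrite mult_IZR, Rabs_mult.
  rewrite (Rabs_pos_eq (IZR k)) by (apply (IZR_le 0); lia).
  pose proof (Rabs_pos (IZR n)). assert (1 <= IZR k)%R by (apply (IZR_le 1); lia). nra.
Qed.

Lemma zsum_plus f g M : zsum (fun n => f n + g n) M = zsum f M + zsum g M.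
Proof. induction M as [|M IH]; simpl; [ring|rewrite IH; ring]. Qed.
Lemma zsum_scal c f M : zsum (fun n => c * f n) M = c * zsum f M.
Proof. induction M as [|M IH]; simpl; [ring|rewrite IH; ring]. Qed.
Lemma zsum_ext f g M : (forall n, f n = g n) -> zsum f M = zsum g M.
Proof. intros H; induction M as [|M IH]; simpl; [ring|rewrite IH, !H; ring]. Qed.

Lemma ZSeries_plus f g : exp_decay f -> exp_decay g ->
  ZSeries (fun n => f n + g n) = ZSeries f + ZSeries g.
Proof.
  intros Hf Hg. apply ZSeries_unique; [apply exp_decay_plus; assumption|].
  destruct (ZSeries_correct f Hf) as [K H]; destruct (ZSeries_correct g Hg) as [K' H'].
  exists (K + K')%R. intros M. rewrite zsum_plus.
  replace (_ - _) with ((zsum f M - ZSeries f) + (zsum g M - ZSeries g)) by ring.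
  eapply Rle_trans; [apply Cmod_triangle|]. specialize (H M); specialize (H' M); lra.
Qed.

Lemma ZSeries_scal c f : exp_decay f -> ZSeries (fun n => c * f n) = c * ZSeries f.
Proof.
  intros Hf. apply ZSeries_unique; [apply exp_decay_scal; assumption|].
  destruct (ZSeries_correct f Hf) as [K H].
  exists (Cmod c * K)%R. intros M. rewrite zsum_scal.
  replace (_ - _) with (c * (zsum f M - ZSeries f)) by ring.
  rewrite Cmod_mult, Rmult_assoc. apply Rmult_le_compat_l; [apply Cmod_ge_0|apply H].
Qed.

Lemma ZSeries_minus f g : exp_decay f -> exp_decay g ->
  ZSeries (fun n => f n - g n) = ZSeries f - ZSeries g.
Proof.
  intros Hf Hg.
  rewrite (ZSeries_ext _ (fun n => f n + (- (1)) * g n)) by (intros; ring).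
  rewrite ZSeries_plus, ZSeries_scal; [ring|assumption|assumption|apply exp_decay_scal; assumption].
Qed.

Lemma zsum_succ f M : zsum (fun n => f (n + 1)%Z) M = zsum f M + f (Z.of_nat M) - f (- Z.of_nat M)%Z.
Proof.
  induction M as [|M IH]; cbn [zsum]; [simpl; ring|].
  rewrite IH.
  replace (Z.of_nat M + 1)%Z with (Z.of_nat (S M)) by lia.
  replace (- Z.of_nat (S M) + 1)%Z with (- Z.of_nat M)%Z by lia. ring.
Qed.

Lemma zsum_flip f M : zsum (fun n => f (- n)%Z) M = zsum f M + f (Z.of_nat M) - f (- Z.of_nat M)%Z.
Proof.
  induction M as [|M IH]; cbn [zsum]; [simpl; ring|].
  rewrite IH, Z.opp_involutive. ring.
Qed.

(** Shifting by 1 and reflecting both turn the window -M <= n < M into -M < n <= M; the two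
    exchanged boundary terms decay, so the limit is unchanged. *)
Lemma is_zsum_boundary f g l : exp_decay f -> is_zsum f l ->
  (forall M, zsum g M = zsum f M + f (Z.of_nat M) - f (- Z.of_nat M)%Z) -> is_zsum g l.
Proof.
  intros [K H] [K' H'] E. exists (K' + (K + K))%R. intros M. rewrite E.
  replace (_ - l) with ((zsum f M - l) + (f (Z.of_nat M) + - f (- Z.of_nat M)%Z)) by ring.
  eapply Rle_trans; [apply Cmod_triangle|].
  assert (B := Cmod_triangle (f (Z.of_nat M)) (- f (- Z.of_nat M)%Z)).
  rewrite Cmod_opp in B.
  assert (H1 := H (Z.of_nat M)); assert (H2 := H (- Z.of_nat M)%Z).
  rewrite expn_opp in H2. rewrite expn_nat in H1, H2. specialize (H' M). lra.
Qed.

Lemma ZSeries_flip f : exp_decay f -> ZSeries (fun n => f (- n)%Z) = ZSeries f.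
Proof.
  intros Hf. apply ZSeries_unique; [apply exp_decay_flip, Hf|].
  apply (is_zsum_boundary f); [exact Hf|apply ZSeries_correct, Hf|apply zsum_flip].
Qed.

Lemma ZSeries_succ f : exp_decay f -> ZSeries (fun n => f (n + 1)%Z) = ZSeries f.
Proof.
  intros Hf. apply ZSeries_unique; [apply exp_decay_shift, Hf|].
  apply (is_zsum_boundary f); [exact Hf|apply ZSeries_correct, Hf|apply zsum_succ].
Qed.

Lemma ZSeries_shift_nat p f : exp_decay f -> ZSeries (fun n => f (n + Z.of_nat p)%Z) = ZSeries f.
Proof.
  intros Hf. induction p as [|p IH].
  - apply ZSeries_ext; intros; f_equal; lia.
  - rewrite <- IH, <- (ZSeries_succ (fun n => f (n + Z.of_nat p)%Z)) by (apply exp_decay_shift, Hf).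
    apply ZSeries_ext; intros; f_equal; lia.
Qed.

Lemma ZSeries_shift d f : exp_decay f -> ZSeries (fun n => f (n + d)%Z) = ZSeries f.
Proof.
  intros Hf. destruct (Z_le_gt_dec 0 d) as [Hd|Hd].
  - rewrite <- (Z2Nat.id d Hd). apply ZSeries_shift_nat, Hf.
  - rewrite <- (ZSeries_shift_nat (Z.to_nat (- d)) (fun n => f (n + d)%Z)) by (apply exp_decay_shift, Hf).
    apply ZSeries_ext; intros; f_equal; lia.
Qed.

(** * Double series *)

Definition exp_decay2 (f : Z -> Z -> C) : Prop :=
  exists K, forall j n, (Cmod (f j n) <= K * expn j * expn n)%R.

Lemma exp_decay2_swap f : exp_decay2 f -> exp_decay2 (fun j n => f n j).
Proof. intros [K H]; exists K; intros j n. specialize (H n j); lra. Qed.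

Lemma exp_decay2_row f j : exp_decay2 f -> exp_decay (f j).
Proof. intros [K H]; exists (K * expn j)%R; apply H. Qed.

Lemma exp_decay2_ZSeries f : exp_decay2 f -> exp_decay (fun j => ZSeries (f j)).
Proof.
  intros [K H]. exists (8 * K)%R. intros j.
  assert (B := ZSeries_dom (f j) (K * expn j) (H j) O).
  cbn [zsum] in B. replace (0 - ZSeries (f j)) with (- ZSeries (f j)) in B by ring.
  rewrite Cmod_opp in B. simpl in B. rewrite Ropp_0, exp_0 in B. lra.
Qed.

Lemma zsum_swap f M N :
  zsum (fun j => zsum (f j) N) M = zsum (fun n => zsum (fun j => f j n) M) N.
Proof.
  induction N as [|N IH]; cbn [zsum].
  - induction M as [|M IH]; cbn [zsum]; [reflexivity|rewrite IH; ring].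
  - rewrite <- IH. rewrite (zsum_plus (fun j => zsum (f j) N)), zsum_plus. reflexivity.
Qed.

Lemma zsum_expn_bound f K M : (forall n, Cmod (f n) <= K * expn n)%R -> (Cmod (zsum f M) <= 16 * K)%R.
Proof.
  intros H. pose proof (exp_decay_pos _ _ H) as HK.
  assert (B := ZSeries_dom f K H O). assert (B' := ZSeries_dom f K H M).
  cbn [zsum] in B. simpl in B. rewrite Ropp_0, exp_0 in B.
  replace (zsum f M) with ((zsum f M - ZSeries f) + - (0 - ZSeries f)) by ring.
  eapply Rle_trans; [apply Cmod_triangle|]. rewrite Cmod_opp.
  assert (exp (- INR M) <= 1)%R.
  { rewrite <- exp_0. apply exp_le. pose proof (pos_INR M); lra. }
  nra.
Qed.

(** Square partial sums suffice: the remainder of row j is at most 8 K expn j exp (-M), and summing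
    over j costs a factor 16. Fubini then reduces to swapping two finite sums. *)
Lemma is_zsum_iterated f :
  exp_decay2 f -> exists K, forall M,
    (Cmod (zsum (fun j => zsum (f j) M) M - ZSeries (fun j => ZSeries (f j))) <= K * exp (- INR M))%R.
Proof.
  intros H2. destruct (ZSeries_correct _ (exp_decay2_ZSeries f H2)) as [K0 H0].
  destruct H2 as [K H]. exists (16 * (8 * K) + K0)%R. intros M.
  replace (_ - _) with
    (zsum (fun j => zsum (f j) M + (- (1)) * ZSeries (f j)) M
     + (zsum (fun j => ZSeries (f j)) M - ZSeries (fun j => ZSeries (f j))))
    by (rewrite zsum_plus, zsum_scal; ring).
  eapply Rle_trans; [apply Cmod_triangle|].
  rewrite Rmult_plus_distr_r. apply Rplus_le_compat; [|apply H0].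
  rewrite Rmult_assoc. apply zsum_expn_bound. intros j.
  replace (_ + _) with (zsum (f j) M - ZSeries (f j)) by ring.
  eapply Rle_trans; [apply (ZSeries_dom (f j) (K * expn j) (H j) M)|]. right; ring.
Qed.

Lemma ZSeries_Fubini f : exp_decay2 f ->
  ZSeries (fun j => ZSeries (f j)) = ZSeries (fun n => ZSeries (fun j => f j n)).
Proof.
  intros H. destruct (is_zsum_iterated f H) as [K1 H1].
  destruct (is_zsum_iterated _ (exp_decay2_swap f H)) as [K2 H2].
  apply (C_eq_of_exp_bound _ _ (K1 + K2)). intros M.
  specialize (H1 M); specialize (H2 M). rewrite zsum_swap in H1.
  rewrite Rmult_plus_distr_r. exact (Cmod_minus_le _ _ _ _ _ H1 H2).
Qed.

(** * Sums over residue classes *)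

Fixpoint csum (a : nat -> C) (M : nat) : C :=
  match M with O => 0 | S p => csum a p + a p end.

Lemma csum_ext a b M : (forall n, (n < M)%nat -> a n = b n) -> csum a M = csum b M.
Proof. intros H; induction M as [|M IH]; cbn [csum]; [reflexivity|]. rewrite IH by (intros; apply H; lia). rewrite H by lia. reflexivity. Qed.

Lemma csum_plus a b M : csum (fun n => a n + b n) M = csum a M + csum b M.
Proof. induction M as [|M IH]; simpl; [ring|rewrite IH; ring]. Qed.

Lemma csum_S_l a M : csum a (S M) = a O + csum (fun n => a (S n)) M.
Proof. induction M as [|M IH]; [simpl; ring|]. cbn [csum] in *. rewrite IH; ring. Qed.

Lemma csum_rev a M : csum (fun n => a (M - 1 - n)%nat) M = csum a M.
Proof.
  revert a; induction M as [|M IH]; intros a; [reflexivity|].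
  rewrite (csum_S_l a). cbn [csum]. rewrite <- (IH (fun n => a (S n))).
  replace (S M - 1 - M)%nat with O by lia. rewrite Cplus_comm. f_equal.
  apply csum_ext. intros n Hn. f_equal. lia.
Qed.

Lemma zsum_add f M p :
  zsum f (M + p) = zsum f M + csum (fun i => f (Z.of_nat (M + i))) p
    + csum (fun i => f (- Z.of_nat (S (M + i)))%Z) p.
Proof.
  induction p as [|p IH]; [rewrite Nat.add_0_r; simpl; ring|].
  rewrite Nat.add_succ_r. cbn [zsum csum]. rewrite IH. ring.
Qed.

Lemma zsum_csum (g : nat -> Z -> C) K M :
  zsum (fun n => csum (fun l => g l n) K) M = csum (fun l => zsum (g l) M) K.
Proof.
  induction K as [|K IH]; cbn [csum].
  - induction M as [|M IH]; cbn [zsum]; [reflexivity|rewrite IH; ring].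
  - rewrite zsum_plus, IH. reflexivity.
Qed.

(** The window -MK <= n < MK is exactly the union of the windows -M <= n < M of the K residue
    classes, so no boundary terms occur. *)
Lemma zsum_regroup f K M :
  zsum f (M * K) = csum (fun l => zsum (fun n => f (Z.of_nat l + Z.of_nat K * n)%Z) M) K.
Proof.
  rewrite <- zsum_csum.
  induction M as [|M IH]; [reflexivity|].
  cbn [zsum]. rewrite <- IH.
  replace (S M * K)%nat with (M * K + K)%nat by lia. rewrite zsum_add.
  (* The new negative indices -(MK + 1 + i) run downwards in i, while l - (M + 1)K runs upwards in
     l. *)
  rewrite <- (csum_rev (fun i => f (- Z.of_nat (S (M * K + i)))%Z)).
  rewrite <- Cplus_assoc. f_equal. f_equal; apply csum_ext; intros i Hi; f_equal; nia.
Qed.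

Lemma ZSeries_regroup f K : (0 < K)%nat -> exp_decay f ->
  csum (fun l => ZSeries (fun n => f (Z.of_nat l + Z.of_nat K * n)%Z)) K = ZSeries f.
Proof.
  intros HK Hf.
  assert (B1 : exists C1, forall M, (Cmod (zsum f (M * K) - ZSeries f) <= C1 * exp (- INR M))%R).
  { destruct (ZSeries_correct f Hf) as [C1 H1]. exists C1. intros M.
    eapply Rle_trans; [apply H1|].
    assert (0 <= C1)%R.
    { specialize (H1 O). pose proof (Cmod_ge_0 (zsum f 0 - ZSeries f)). simpl in H1.
      rewrite Ropp_0, exp_0 in H1; simpl in *; lra. }
    apply Rmult_le_compat_l; [assumption|]. apply exp_le, Ropp_le_contravar, le_INR. nia. }
  assert (B2 : forall p, exists C2, forall M, (Cmod (csum (fun l => zsum (fun n => f (Z.of_nat l + Z.of_nat K * n)%Z) M) p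
     - csum (fun l => ZSeries (fun n => f (Z.of_nat l + Z.of_nat K * n)%Z)) p) <= C2 * exp (- INR M))%R).
  { induction p as [|p [C2 IH]].
    - exists 0%R. intros M. cbn [csum]. replace (0 - 0) with (RtoC 0) by ring. rewrite Cmod_0; lra.
    - destruct (ZSeries_correct (fun n => f (Z.of_nat p + Z.of_nat K * n)%Z)) as [C3 H3].
      { apply exp_decay_dilate; [lia|exact Hf]. }
      exists (C2 + C3)%R. intros M. cbn [csum].
      specialize (IH M); specialize (H3 M).
      match type of IH with (Cmod (?a - ?b) <= _)%R =>
        match type of H3 with (Cmod (?c - ?d) <= _)%R =>
        replace (a + c - (b + d)) with ((a - b) + (c - d)) by ring end end.
      eapply Rle_trans; [apply Cmod_triangle|]. lra. }
  destruct B1 as [C1 B1]; destruct (B2 K) as [C2 B2'].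
  apply (C_eq_of_exp_bound _ _ (C1 + C2)). intros M.
  specialize (B1 M); specialize (B2' M). rewrite <- zsum_regroup in B2'.
  rewrite Rplus_comm, Rmult_plus_distr_r. exact (Cmod_minus_le _ _ _ _ _ B2' B1).
Qed.

(** * The error function and Fourier transforms of Gaussians *)

Open Scope R_scope.

(** Completing the square in |x|: a Gaussian beats every exponential rate [be], and [be] is chosen
    later to absorb competing growth. *)
Lemma gauss_dom (al be x : R) : 0 < al ->
  exp (- (al * x ^ 2)) <= exp (be ^ 2 / (4 * al)) * exp (- (be * Rabs x)).
Proof.
  intros Ha. rewrite <- exp_plus. apply exp_le.
  rewrite <- (pow2_abs x). set (y := Rabs x).
  assert (0 <= (2 * al * y - be) ^ 2 / (4 * al)).
  { apply Rmult_le_pos; [apply pow2_ge_0|left; apply Rinv_0_lt_compat; lra]. }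
  replace ((2 * al * y - be) ^ 2 / (4 * al)) with (al * y ^ 2 - be * y + be ^ 2 / (4 * al)) in H by (field; lra).
  lra.
Qed.

Lemma MVT_abs (f df : R -> R) (a b B : R) : a <= b ->
  (forall x, a <= x <= b -> is_derive f x (df x)) ->
  (forall x, a <= x <= b -> Rabs (df x) <= B) -> Rabs (f b - f a) <= B * (b - a).
Proof.
  intros Hab Hd HB.
  destruct (MVT_gen f a b df) as [c [Hc E]].
  - rewrite Rmin_left, Rmax_right by lra. intros x Hx. apply Hd; lra.
  - rewrite Rmin_left, Rmax_right by lra. intros x Hx.
    apply continuity_pt_filterlim, (ex_derive_continuous (K := R_AbsRing) (V := R_NormedModule)).
    exists (df x). apply Hd; lra.
  - rewrite Rmin_left, Rmax_right in Hc by lra.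
    rewrite E, Rabs_mult, (Rabs_pos_eq (b - a)) by lra.
    apply Rmult_le_compat_r; [lra|apply HB, Hc].
Qed.

Lemma ex_RInt_diff (f : R -> R) (a b : R) : (forall x, ex_derive f x) -> ex_RInt f a b.
Proof.
  intros H. apply (ex_RInt_continuous (V := R_CompleteNormedModule)). intros x _.
  apply (ex_derive_continuous (K := R_AbsRing) (V := R_NormedModule)), H.
Qed.

Lemma continuous_diff (f : R -> R) x : ex_derive f x -> continuous f x.
Proof. apply (ex_derive_continuous (K := R_AbsRing) (V := R_NormedModule)). Qed.

Lemma E_derive x : is_derive E x (2 * exp (- PI * x ^ 2)).
Proof.
  unfold E.
  apply (is_derive_scal (fun y => RInt (fun w => exp (- PI * w ^ 2)) 0 y) x 2).
  apply (is_derive_RInt (fun w => exp (- PI * w ^ 2)) _ 0).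
  - exists (mkposreal 1 Rlt_0_1). intros y _. apply (RInt_correct (V := R_CompleteNormedModule)).
    apply (ex_RInt_diff (fun w => exp (- PI * w ^ 2))). intros; auto_derive; auto.
  - apply (continuous_diff (fun w => exp (- PI * w ^ 2))). auto_derive; auto.
Qed.

Lemma E_0 : E 0 = 0.
Proof. unfold E. rewrite RInt_point. apply Rmult_0_r. Qed.

Lemma E_odd x : E (- x) = - E x.
Proof.
  destruct (MVT_gen (fun y => E y + E (- y)) 0 x (fun _ => 0)) as [c [_ H]].
  - intros y _.
    replace 0 with (2 * exp (- PI * y ^ 2) + (-1) * (2 * exp (- PI * (- y) ^ 2))).
    + apply (is_derive_plus (K := R_AbsRing) (V := R_NormedModule) E); [apply E_derive|].
      apply (is_derive_comp (K := R_AbsRing) (V := R_NormedModule) E (fun y => - y)); [apply E_derive|].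
      auto_derive; [auto|simpl; ring].
    + replace ((- y) ^ 2) with (y ^ 2) by ring. ring.
  - intros y _. apply continuity_pt_filterlim.
    apply (continuous_diff (fun y => E y + E (- y))).
    apply (ex_derive_plus (K := R_AbsRing) (V := R_NormedModule) E).
    + eexists; apply E_derive.
    + apply (ex_derive_comp (K := R_AbsRing) (V := R_NormedModule) E (fun y => - y)).
      * eexists; apply E_derive.
      * auto_derive; auto.
  - rewrite E_0, Ropp_0, E_0 in H. lra.
Qed.

Lemma E_Lip x y : Rabs (E y - E x) <= 2 * Rabs (y - x).
Proof.
  assert (P : forall x y, x <= y -> Rabs (E y - E x) <= 2 * Rabs (y - x)).
  { clear. intros x y H. rewrite (Rabs_pos_eq (y - x)) by lra.
    apply (MVT_abs E (fun x => 2 * exp (- PI * x ^ 2))); [exact H|intros; apply E_derive|].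
    intros z _. pose proof (exp_pos (- PI * z ^ 2)). rewrite Rabs_pos_eq by lra.
    assert (exp (- PI * z ^ 2) <= exp 0).
    { apply exp_le. pose proof PI_RGT_0. pose proof (pow2_ge_0 z). nra. }
    rewrite exp_0 in *. lra. }
  destruct (Rle_dec x y) as [H|H]; [apply P, H|].
  rewrite (Rabs_minus_sym (E y)), (Rabs_minus_sym y). apply P. lra.
Qed.

Lemma E_incr x y : x <= y -> E x <= E y.
Proof.
  intros H. destruct (MVT_gen E x y (fun x => 2 * exp (- PI * x ^ 2))) as [c [_ Hc]].
  - intros; apply E_derive.
  - intros z _. apply continuity_pt_filterlim, (continuous_diff E). eexists; apply E_derive.
  - pose proof (exp_pos (- PI * c ^ 2)). nra.
Qed.

(** On z >= 1 the function E z + exp (-PI z^2) decreases, its derivative being (2 - 2 PI z) exp (-PI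
    z^2). *)
Lemma E_tail x y : 1 <= x -> x <= y -> E y - E x <= exp (- PI * x ^ 2).
Proof.
  intros Hx H.
  destruct (MVT_gen (fun z => E z + exp (- PI * z ^ 2)) x y
     (fun z => 2 * exp (- PI * z ^ 2) + (- PI * (2 * z)) * exp (- PI * z ^ 2))) as [c [Hc E1]].
  - intros z _. apply (is_derive_plus (K := R_AbsRing) (V := R_NormedModule) E); [apply E_derive|].
    auto_derive; [auto|simpl; ring].
  - intros z _. apply continuity_pt_filterlim.
    apply (continuous_diff (fun z => E z + exp (- PI * z ^ 2))).
    apply (ex_derive_plus (K := R_AbsRing) (V := R_NormedModule) E).
    + eexists; apply E_derive.
    + auto_derive; auto.
  - rewrite Rmin_left, Rmax_right in Hc by lra.
    pose proof (exp_pos (- PI * c ^ 2)). pose proof (exp_pos (- PI * y ^ 2)).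
    pose proof PI2_1.
    assert (0 <= (2 * PI * c - 2) * exp (- PI * c ^ 2) * (y - x)).
    { apply Rmult_le_pos; [apply Rmult_le_pos|]; nra. }
    nra.
Qed.

(** The limit stays an unknown L until theta inversion, proved with L as a factor, forces L = 1. *)
Definition E_limit (L : R) : Prop := forall x, 1 <= x -> Rabs (E x - L) <= exp (- PI * x ^ 2).

Lemma E_limit_ex : exists L, E_limit L.
Proof.
  assert (Hex : ex_finite_lim_seq (fun n => E (INR n))).
  { apply (ex_finite_lim_seq_incr _ (E 1 + 1)).
    - intros n. apply E_incr. rewrite S_INR; lra.
    - intros n. assert (exp (- PI * 1 ^ 2) <= 1).
      { apply exp_le_1. pose proof PI_RGT_0; lra. }
      destruct (Rle_dec 1 (INR n)) as [Hn|Hn].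
      + pose proof (E_tail 1 (INR n) ltac:(lra) Hn). lra.
      + pose proof (E_incr (INR n) 1 ltac:(lra)). lra. }
  destruct Hex as [L HL]. exists L. intros x Hx.
  assert (H1 : E x <= L).
  { apply (is_lim_seq_le_loc (fun _ => E x) (fun n => E (INR n)) (E x) L).
    - destruct (INR_unbounded x) as [N HN]. exists N. intros n Hn. apply E_incr.
      apply le_INR in Hn; lra.
    - apply is_lim_seq_const.
    - exact HL. }
  assert (H2 : L <= E x + exp (- PI * x ^ 2)).
  { apply (is_lim_seq_le_loc (fun n => E (INR n)) (fun _ => E x + exp (- PI * x ^ 2)) L (E x + exp (- PI * x ^ 2))).
    - destruct (INR_unbounded x) as [N HN]. exists N. intros n Hn.
      apply le_INR in Hn. pose proof (E_tail x (INR n) Hx ltac:(lra)). lra.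
    - exact HL.
    - apply is_lim_seq_const. }
  rewrite Rabs_left1 by lra. lra.
Qed.

Lemma E_limit_bound L : E_limit L ->
  exists K, forall x, 0 <= x -> Rabs (E x - L) <= K * exp (- PI * x ^ 2).
Proof.
  (* On [0, 1] the Lipschitz bound gives |E x - L| <= 2 + 1, and exp PI makes up for exp (-PI x^2)
     >= exp (-PI). *)
  intros H. exists (3 * exp PI). intros x Hx.
  pose proof (exp_pos (- PI * x ^ 2)) as Hp. pose proof PI_RGT_0.
  assert (1 <= exp PI) by (rewrite <- exp_0; apply exp_le; lra).
  destruct (Rle_dec 1 x) as [Hx1|Hx1].
  - specialize (H x Hx1). nra.
  - specialize (H 1 (Rle_refl 1)). pose proof (E_Lip 1 x) as HL.
    assert (exp (- PI * 1 ^ 2) <= 1) by (apply exp_le_1; lra).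
    replace (E x - L) with ((E x - E 1) + (E 1 - L)) by ring.
    eapply Rle_trans; [apply Rabs_triang|].
    rewrite (Rabs_left1 (x - 1)) in HL by lra.
    apply Rle_trans with 3; [lra|].
    rewrite Rmult_assoc, <- exp_plus.
    assert (1 <= exp (PI + - PI * x ^ 2)).
    { rewrite <- exp_0; apply exp_le. assert (x ^ 2 <= 1) by nra. nra. }
    lra.
Qed.

(** A truncated Fourier integral with a phase: th = 0 and th = -PI/2 give the cosine and the sine,
    so that complex exponentials are handled by real integrals. *)
Definition gauss_FT (s th a b xi : R) : R :=
  RInt (fun t => exp (- (PI * s * t ^ 2)) * cos (2 * PI * xi * t + th)) a b.

Lemma gauss_FT_0 s th a b : 0 < s ->
  gauss_FT s th a b 0 = cos th * ((E (sqrt s * b) - E (sqrt s * a)) / (2 * sqrt s)).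
Proof.
  intros Hs. pose proof (sqrt_lt_R0 s Hs) as Hq. unfold gauss_FT.
  apply is_RInt_unique.
  replace (cos th * ((E (sqrt s * b) - E (sqrt s * a)) / (2 * sqrt s)))
    with (minus (cos th / (2 * sqrt s) * E (sqrt s * b)) (cos th / (2 * sqrt s) * E (sqrt s * a)))
    by (unfold minus, plus, opp; simpl; field; lra).
  apply (is_RInt_derive (V := R_CompleteNormedModule) (fun t => cos th / (2 * sqrt s) * E (sqrt s * t))).
  - intros t _.
    replace (exp (- (PI * s * t ^ 2)) * cos (2 * PI * 0 * t + th))
      with (cos th / (2 * sqrt s) * (sqrt s * (2 * exp (- PI * (sqrt s * t) ^ 2)))).
    + apply (is_derive_scal (fun t => E (sqrt s * t)) t).
      apply (is_derive_comp (K := R_AbsRing) (V := R_NormedModule) E (fun t => sqrt s * t)); [apply E_derive|].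
      auto_derive; [auto|simpl; ring].
    + replace (- PI * (sqrt s * t) ^ 2) with (- (PI * (sqrt s * sqrt s) * t ^ 2)) by ring.
      rewrite sqrt_sqrt by lra. replace (2 * PI * 0 * t + th) with th by ring. field. lra.
  - intros t _. apply (continuous_diff (fun t => exp (- (PI * s * t ^ 2)) * cos (2 * PI * 0 * t + th))).
    auto_derive; auto.
Qed.

(* Integration by parts: gauss_FT satisfies a first-order linear equation in xi, up to boundary terms. *)
Lemma gauss_FT_derive s th a b xi : 0 < s ->
  is_derive (gauss_FT s th a b) xi
    (- (2 * PI * xi / s) * gauss_FT s th a b xi
     + (exp (- (PI * s * b ^ 2)) * sin (2 * PI * xi * b + th)
        - exp (- (PI * s * a ^ 2)) * sin (2 * PI * xi * a + th)) / s).
Proof.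
  intros Hs.
  pose (f := fun x t => exp (- (PI * s * t ^ 2)) * cos (2 * PI * x * t + th)).
  pose (df := fun x t => - (2 * PI * t) * exp (- (PI * s * t ^ 2)) * sin (2 * PI * x * t + th)).
  assert (Hdf : forall x t, is_derive (fun x => f x t) x (df x t)).
  { intros x t. unfold f, df. auto_derive; [auto|simpl; ring]. }
  assert (HDf : forall x t, Derive (fun x => f x t) x = df x t).
  { intros; apply is_derive_unique, Hdf. }
  assert (H : is_derive (gauss_FT s th a b) xi (RInt (fun t => Derive (fun x => f x t) xi) a b)).
  { apply (is_derive_RInt_param f).
    - exists (mkposreal 1 Rlt_0_1). intros x _ t _. eexists; apply Hdf.
    - intros t _.
      apply (continuity_2d_pt_ext df); [intros; symmetry; apply HDf|].
      unfold df.
      apply continuity_2d_pt_mult.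
      + apply (continuity_1d_2d_pt_comp (fun t => - (2 * PI * t) * exp (- (PI * s * t ^ 2))) (fun _ t => t)).
        * apply continuity_pt_filterlim.
          apply (continuous_diff (fun t => - (2 * PI * t) * exp (- (PI * s * t ^ 2)))). auto_derive; auto.
        * apply continuity_2d_pt_id2.
      + apply (continuity_1d_2d_pt_comp sin (fun x t => 2 * PI * x * t + th)).
        * apply continuity_sin.
        * apply continuity_2d_pt_plus; [|apply continuity_2d_pt_const].
          apply continuity_2d_pt_mult; [|apply continuity_2d_pt_id2].
          apply continuity_2d_pt_mult; [apply continuity_2d_pt_const|apply continuity_2d_pt_id1].
    - exists (mkposreal 1 Rlt_0_1). intros x _. apply (ex_RInt_diff (f x)).
      intros t. unfold f. auto_derive; auto. }
  replace (_ + _) with (RInt (fun t => Derive (fun x => f x t) xi) a b); [exact H|].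
  rewrite (RInt_ext _ (df xi)) by (intros; apply HDf).
  pose (g := fun t => exp (- (PI * s * t ^ 2)) * sin (2 * PI * xi * t + th) / s).
  assert (Hg : is_RInt (fun t => plus (df xi t) (scal (2 * PI * xi / s) (f xi t))) a b (minus (g b) (g a))).
  { apply (is_RInt_derive (V := R_CompleteNormedModule) g).
    - intros t _. unfold g, df, f, plus, scal; simpl; unfold mult; simpl. auto_derive; [auto|simpl; field; lra].
    - intros t _.
      apply (continuous_diff (fun t => df xi t + (2 * PI * xi / s) * (f xi t))).
      unfold df, f. auto_derive; auto. }
  assert (Hf : is_RInt (f xi) a b (gauss_FT s th a b xi)).
  { apply (RInt_correct (V := R_CompleteNormedModule)), (ex_RInt_diff (f xi)). intros t; unfold f; auto_derive; auto. }
  apply is_RInt_unique.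
  apply (is_RInt_ext (fun t => plus (plus (df xi t) (scal (2 * PI * xi / s) (f xi t))) (scal (- (2 * PI * xi / s)) (f xi t)))).
  { intros t _. unfold plus, scal; simpl; unfold mult; simpl. ring. }
  replace (_ + _) with (plus (minus (g b) (g a)) (scal (- (2 * PI * xi / s)) (gauss_FT s th a b xi))).
  - apply (is_RInt_plus (V := R_NormedModule)); [exact Hg|].
    apply (is_RInt_scal (V := R_NormedModule)). exact Hf.
  - unfold g, minus, plus, opp, scal; simpl; unfold mult; simpl. field. lra.
Qed.

(** The differential equation in xi is solved by the integrating factor exp (PI xi^2 / s): the
    product changes only through the boundary terms, which vanish as the interval exhausts the line.
    This gives the Fourier transform of a Gaussian, its value at xi = 0 being expressed by E. *)
Lemma gauss_FT_bound s th a b xi : 0 < s ->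
  Rabs (gauss_FT s th a b xi
        - exp (- (PI * xi ^ 2 / s)) * (cos th * ((E (sqrt s * b) - E (sqrt s * a)) / (2 * sqrt s))))
  <= Rabs xi / s * (exp (- (PI * s * b ^ 2)) + exp (- (PI * s * a ^ 2))).
Proof.
  intros Hs. rewrite <- (gauss_FT_0 s th a b Hs).
  set (Bd := exp (- (PI * s * b ^ 2)) + exp (- (PI * s * a ^ 2))).
  pose (h := fun x => exp (PI * x ^ 2 / s) * gauss_FT s th a b x).
  pose (bd := fun x => exp (- (PI * s * b ^ 2)) * sin (2 * PI * x * b + th)
        - exp (- (PI * s * a ^ 2)) * sin (2 * PI * x * a + th)).
  assert (Hh : forall x, is_derive h x (exp (PI * x ^ 2 / s) * (bd x / s))).
  { intros x. unfold h.
    replace (exp (PI * x ^ 2 / s) * (bd x / s)) with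
      (plus (scal ((2 * PI * x / s) * exp (PI * x ^ 2 / s)) (gauss_FT s th a b x))
         (scal (exp (PI * x ^ 2 / s)) (- (2 * PI * x / s) * gauss_FT s th a b x + bd x / s))).
    - apply (is_derive_mult (fun x => exp (PI * x ^ 2 / s)) (gauss_FT s th a b) x
        ((2 * PI * x / s) * exp (PI * x ^ 2 / s)) (- (2 * PI * x / s) * gauss_FT s th a b x + bd x / s)).
      + auto_derive; [auto|unfold Rdiv; simpl; ring].
      + apply gauss_FT_derive, Hs.
      + intros; apply Rmult_comm.
    - unfold plus, scal; simpl; unfold mult; simpl. ring. }
  assert (Hbd : forall x, Rabs (bd x) <= Bd).
  { intros x. unfold bd, Bd. eapply Rle_trans; [apply Rabs_triang|].
    rewrite Rabs_Ropp, !Rabs_mult, !(Rabs_pos_eq (exp _)) by (left; apply exp_pos).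
    assert (S : forall y, Rabs (sin y) <= 1) by (intros; apply Rabs_le, SIN_bound).
    pose proof (exp_pos (- (PI * s * b ^ 2))). pose proof (exp_pos (- (PI * s * a ^ 2))).
    apply Rplus_le_compat; rewrite <- (Rmult_1_r (exp _)) at 2; apply Rmult_le_compat_l; try lra; apply S. }
  destruct (MVT_gen h 0 xi (fun x => exp (PI * x ^ 2 / s) * (bd x / s))) as [c [Hc E1]].
  { intros; apply Hh. }
  { intros x _. apply continuity_pt_filterlim, (continuous_diff h). eexists; apply Hh. }
  (* The intermediate point satisfies |c| <= |xi|, so the ratio of the integrating factors is at
     most 1. *)
  assert (Hc2 : c ^ 2 <= xi ^ 2).
  { unfold Rmin, Rmax in Hc. destruct (Rle_dec 0 xi); nra. }
  replace (gauss_FT s th a b xi - _) with (exp (- (PI * xi ^ 2 / s)) * (h xi - h 0)).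
  - rewrite E1, !Rabs_mult, Rminus_0_r, !(Rabs_pos_eq (exp _)) by (left; apply exp_pos).
    unfold Rdiv at 3. rewrite Rabs_mult, (Rabs_pos_eq (/ s)) by (left; apply Rinv_0_lt_compat; lra).
    specialize (Hbd c).
    assert (exp (- (PI * xi ^ 2 / s)) * exp (PI * c ^ 2 / s) <= 1).
    { rewrite <- exp_plus, <- exp_0. apply exp_le.
      replace (_ + _) with (PI / s * (c ^ 2 - xi ^ 2)) by (field; lra).
      assert (0 < PI / s) by (apply Rdiv_lt_0_compat; [apply PI_RGT_0|lra]). nra. }
    assert (0 < / s) by (apply Rinv_0_lt_compat; lra).
    pose proof (Rabs_pos xi). pose proof (Rabs_pos (bd c)).
    pose proof (exp_pos (- (PI * xi ^ 2 / s))). pose proof (exp_pos (PI * c ^ 2 / s)).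
    replace (exp (- (PI * xi ^ 2 / s)) * (exp (PI * c ^ 2 / s) * (Rabs (bd c) * / s) * Rabs xi))
      with ((exp (- (PI * xi ^ 2 / s)) * exp (PI * c ^ 2 / s)) * (Rabs (bd c) * (/ s * Rabs xi))) by ring.
    replace (Rabs xi / s * Bd) with (1 * (Bd * (/ s * Rabs xi))) by (unfold Rdiv; ring).
    apply Rmult_le_compat; try nra.
    + apply Rmult_le_pos; [lra|apply Rmult_le_pos; lra].
    + apply Rmult_le_compat_r; [apply Rmult_le_pos; lra|exact Hbd].
  - unfold h. replace (PI * 0 ^ 2 / s) with 0 by (field; lra). rewrite exp_0.
    rewrite Rmult_minus_distr_l, <- Rmult_assoc, <- exp_plus.
    replace (- (PI * xi ^ 2 / s) + PI * xi ^ 2 / s) with 0 by ring. rewrite exp_0. ring.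
Qed.

(** * The Fejer kernel *)

Open Scope R_scope.

Lemma is_RInt_shift (f : R -> R) (a b v l : R) :
  is_RInt f (a + v) (b + v) l -> is_RInt (fun y => f (y + v)) a b l.
Proof.
  intros H. apply (is_RInt_ext (fun y => scal 1 (f (1 * y + v)))).
  - intros y _. unfold scal; simpl; unfold mult; simpl. rewrite !Rmult_1_l; reflexivity.
  - apply (is_RInt_comp_lin f 1 v). rewrite !Rmult_1_l. exact H.
Qed.

Lemma psum_ext a b M : (forall i, a i = b i) -> psum a M = psum b M.
Proof. intros H; induction M as [|M IH]; simpl; [reflexivity|rewrite IH, H; reflexivity]. Qed.

Lemma psum_plus a b M : psum (fun i => a i + b i) M = psum a M + psum b M.
Proof. induction M as [|M IH]; simpl; [ring|rewrite IH; ring]. Qed.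

Lemma psum_scal c a M : psum (fun i => c * a i) M = c * psum a M.
Proof. induction M as [|M IH]; simpl; [ring|rewrite IH; ring]. Qed.

Lemma psum_const c M : psum (fun _ => c) M = INR M * c.
Proof. induction M as [|M IH]; [simpl; ring|rewrite S_INR; simpl psum; rewrite IH; ring]. Qed.

Lemma is_RInt_psum (f : nat -> R -> R) (l : nat -> R) a b M :
  (forall i, is_RInt (f i) a b (l i)) -> is_RInt (fun x => psum (fun i => f i x) M) a b (psum l M).
Proof.
  intros H. induction M as [|M IH]; simpl.
  - replace 0 with (scal (b - a) 0) at 1 by (unfold scal; simpl; unfold mult; simpl; ring).
    apply (is_RInt_const (V := R_NormedModule)).
  - apply (is_RInt_plus (V := R_NormedModule)); [exact IH|apply H].
Qed.

Definition dirichlet (m : nat) (x : R) : R :=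
  1 + psum (fun i => 2 * cos (2 * PI * INR (S i) * x)) m.

(* N times the usual Fejer kernel. *)
Definition fejer (N : nat) (x : R) : R := psum (fun m => dirichlet m x) N.

(** Multiplied by sin^2 instead of divided, so that integers x need no exception; the right side
    telescopes over m. *)
Lemma dirichlet_sin m x :
  dirichlet m x * sin (PI * x) ^ 2 = (cos (2 * PI * INR m * x) - cos (2 * PI * INR (S m) * x)) / 2.
Proof.
  assert (E1 : sin (PI * x) ^ 2 = (1 - cos (2 * PI * x)) / 2).
  { replace (2 * PI * x) with (2 * (PI * x)) by ring. rewrite cos_2a_sin. field. }
  induction m as [|m IH].
  - unfold dirichlet; simpl psum. rewrite E1. simpl INR.
    replace (2 * PI * 0 * x) with 0 by ring. rewrite cos_0. rewrite Rmult_1_r. field.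
  - replace (dirichlet (S m) x) with (dirichlet m x + 2 * cos (2 * PI * INR (S m) * x))
      by (unfold dirichlet; cbn [psum]; ring).
    rewrite Rmult_plus_distr_r, IH, E1.
    replace (2 * PI * INR m * x) with (2 * PI * INR (S m) * x - 2 * PI * x) by (rewrite !S_INR; ring).
    replace (2 * PI * INR (S (S m)) * x) with (2 * PI * INR (S m) * x + 2 * PI * x) by (rewrite !S_INR; ring).
    rewrite cos_plus, cos_minus. field.
Qed.

Lemma fejer_sin N x : fejer N x * sin (PI * x) ^ 2 = (1 - cos (2 * PI * INR N * x)) / 2.
Proof.
  induction N as [|N IH].
  - unfold fejer; simpl. replace (2 * PI * 0 * x) with 0 by ring. rewrite cos_0. field.
  - replace (fejer (S N) x) with (fejer N x + dirichlet N x) by reflexivity.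
    rewrite Rmult_plus_distr_r, IH, dirichlet_sin. field.
Qed.

(** With y = PI x / 2: sin 2y = 2 sin y cos y >= 2 y cos^2 y >= y >= x, from sin y >= y cos y and 2
    cos^2 y - 1 = cos 2y >= 0. *)
Lemma sin_PI_lower x : 0 <= x <= 1 / 2 -> x <= sin (PI * x).
Proof.
  intros Hx. pose proof PI2_1. pose proof PI_RGT_0.
  pose (y := PI * x / 2).
  assert (Hy : 0 <= y <= PI / 4) by (unfold y; nra).
  assert (S : y * cos y <= sin y).
  { destruct (MVT_gen sin 0 y cos) as [c [Hc E1]].
    - intros; apply is_derive_sin.
    - intros; apply continuity_sin.
    - rewrite Rmin_left, Rmax_right in Hc by lra. rewrite sin_0 in E1.
      assert (cos y <= cos c) by (apply cos_decr_1; lra). nra. }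
  assert (Hc : 0 <= cos (PI * x)) by (apply cos_ge_0; nra).
  replace (PI * x) with (2 * y) in * by (unfold y; field).
  rewrite cos_2a_cos in Hc. rewrite sin_2a.
  assert (0 <= cos y) by (apply cos_ge_0; lra).
  assert (2 * (y * cos y) * cos y <= 2 * sin y * cos y) by nra.
  assert (y <= 2 * (y * cos y) * cos y) by nra.
  assert (x <= y) by (unfold y; nra). lra.
Qed.

Lemma fejer_bound N x : 0 <= x <= 1 / 2 -> x ^ 2 * Rabs (fejer N x) <= 1.
Proof.
  intros Hx. pose proof (sin_PI_lower x Hx) as Hs.
  assert (x ^ 2 <= sin (PI * x) ^ 2) by nra.
  apply Rle_trans with (sin (PI * x) ^ 2 * Rabs (fejer N x)).
  - apply Rmult_le_compat_r; [apply Rabs_pos|assumption].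
  - rewrite <- (Rabs_pos_eq (sin (PI * x) ^ 2)) by apply pow2_ge_0.
    rewrite <- Rabs_mult, Rmult_comm, fejer_sin.
    pose proof (COS_bound (2 * PI * INR N * x)). apply Rabs_le. lra.
Qed.

Definition cos_coef (g : R -> R) (r : nat) : R :=
  RInt (fun x => g x * cos (2 * PI * INR r * x)) (- (1 / 2)) (1 / 2).

(* Cesaro means of a cosine series, without the factor 1/N. *)
Definition cesaro (c : nat -> R) (N : nat) : R :=
  psum (fun m => c O + psum (fun i => 2 * c (S i)) m) N.

Lemma is_RInt_diff (f : R -> R) a b : (forall x, ex_derive f x) -> is_RInt f a b (RInt f a b).
Proof. intros H. apply (RInt_correct (V := R_CompleteNormedModule)), ex_RInt_diff, H. Qed.

Lemma ex_derive_cos_mult (g : R -> R) w x :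
  (forall x, ex_derive g x) -> ex_derive (fun x => g x * cos (w * x)) x.
Proof. intros H. apply (ex_derive_mult g); [apply H|auto_derive; auto]. Qed.

Lemma is_RInt_fejer (g : R -> R) N : (forall x, ex_derive g x) ->
  is_RInt (fun x => g x * fejer N x) (- (1 / 2)) (1 / 2) (cesaro (cos_coef g) N).
Proof.
  intros Hg. unfold fejer, cesaro.
  assert (Hc : forall r, is_RInt (fun x => g x * cos (2 * PI * INR r * x)) (- (1 / 2)) (1 / 2) (cos_coef g r)).
  { intros r. apply (is_RInt_diff (fun x => g x * cos (2 * PI * INR r * x))).
    intros; apply ex_derive_cos_mult, Hg. }
  apply (is_RInt_ext (fun x => psum (fun m => g x * dirichlet m x) N)).
  { intros x _. apply psum_scal. }
  apply is_RInt_psum. intros m.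
  apply (is_RInt_ext (fun x => plus (g x * cos (2 * PI * INR 0 * x))
     (psum (fun i => scal 2 (g x * cos (2 * PI * INR (S i) * x))) m))).
  { intros x _.
    change (g x * cos (2 * PI * 0 * x) + psum (fun i => 2 * (g x * cos (2 * PI * INR (S i) * x))) m
      = g x * dirichlet m x).
    unfold dirichlet.
    replace (2 * PI * 0 * x) with 0 by ring. rewrite cos_0.
    rewrite (psum_ext _ (fun i => g x * (2 * cos (2 * PI * INR (S i) * x)))) by (intros; ring).
    rewrite psum_scal. ring. }
  apply (is_RInt_plus (V := R_NormedModule)); [apply Hc|].
  apply (is_RInt_psum (fun i x => scal 2 (g x * cos (2 * PI * INR (S i) * x)))). intros i.
  apply (is_RInt_scal (V := R_NormedModule)), Hc.
Qed.

Lemma cos_coef_1 : cos_coef (fun _ => 1) 0 = 1 /\ forall r, cos_coef (fun _ => 1) (S r) = 0.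
Proof.
  split; [|intros r]; apply is_RInt_unique.
  - apply (is_RInt_ext (fun _ => 1)).
    { intros x _. change (1 = 1 * cos (2 * PI * 0 * x)).
      replace (2 * PI * 0 * x) with 0 by ring. rewrite cos_0; ring. }
    replace 1 with (scal (1 / 2 - - (1 / 2)) 1) at 3 by (unfold scal; simpl; unfold mult; simpl; field).
    apply (is_RInt_const (V := R_NormedModule)).
  - pose proof (lt_0_INR (S r) ltac:(lia)). pose proof PI_RGT_0.
    assert (Hw : 2 * PI * INR (S r) <> 0) by (apply Rgt_not_eq; nra).
    pose (F := fun x => sin (2 * PI * INR (S r) * x) / (2 * PI * INR (S r))).
    replace 0 with (minus (F (1 / 2)) (F (- (1 / 2)))).
    + apply (is_RInt_derive (V := R_CompleteNormedModule) F).
      * intros x _. unfold F. revert Hw. generalize (2 * PI * INR (S r)). intros w Hw.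
        auto_derive; [auto|field; exact Hw].
      * intros x _. apply (continuous_diff (fun x => 1 * cos (2 * PI * INR (S r) * x))). auto_derive; auto.
    + change (F (1 / 2) - F (- (1 / 2)) = 0). unfold F.
      replace (2 * PI * INR (S r) * (1 / 2)) with (PI * IZR (Z.of_nat (S r))) by (rewrite <- INR_IZR_INZ; field).
      replace (2 * PI * INR (S r) * (- (1 / 2))) with (PI * IZR (- Z.of_nat (S r))) by (rewrite opp_IZR, <- INR_IZR_INZ; field).
      rewrite !sin_PI_IZR. unfold Rdiv. ring.
Qed.

Lemma cesaro_1 N : cesaro (cos_coef (fun _ => 1)) N = INR N.
Proof.
  destruct cos_coef_1 as [H0 HS]. unfold cesaro.
  rewrite (psum_ext _ (fun _ => 1)); [rewrite psum_const; ring|].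
  intros m. rewrite H0, (psum_ext _ (fun _ => 0)), psum_const; [ring|].
  intros; rewrite HS; ring.
Qed.

Lemma fejer_even N x : fejer N (- x) = fejer N x.
Proof.
  unfold fejer, dirichlet. apply psum_ext; intros m. f_equal. apply psum_ext; intros i.
  replace (2 * PI * INR (S i) * - x) with (- (2 * PI * INR (S i) * x)) by ring.
  rewrite cos_neg; reflexivity.
Qed.

Lemma is_RInt_even_part (f : R -> R) b l : is_RInt f (- b) b l -> is_RInt (fun x => (f x + f (- x)) / 2) (- b) b l.
Proof.
  intros H.
  assert (H' : is_RInt (fun x => f (- x)) (- b) b l).
  { apply (is_RInt_ext (fun x => opp (opp (f (- x))))).
    { intros; apply opp_opp. }
    rewrite <- (opp_opp l). apply (is_RInt_opp (V := R_NormedModule)).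
    apply (is_RInt_comp_opp (V := R_NormedModule)). rewrite Ropp_involutive.
    apply (is_RInt_swap (V := R_NormedModule)). exact H. }
  apply (is_RInt_ext (fun x => scal (1 / 2) (plus (f x) (f (- x))))).
  { intros x _. unfold scal, plus; simpl; unfold mult; simpl. field. }
  replace l with (scal (1 / 2) (plus l l)) by (unfold scal, plus; simpl; unfold mult; simpl; field).
  apply (is_RInt_scal (V := R_NormedModule)), (is_RInt_plus (V := R_NormedModule)); assumption.
Qed.

(* The second difference of g absorbs the double pole of the Fejer kernel. *)
Lemma fejer_approx (g : R -> R) (K : R) N : (forall x, ex_derive g x) ->
  (forall x, 0 <= x <= 1 / 2 -> Rabs (g x + g (- x) - 2 * g 0) <= K * x ^ 2) ->
  Rabs (cesaro (cos_coef g) N - INR N * g 0) <= K.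
Proof.
  intros Hg HK.
  assert (H0 : 0 <= K).
  { specialize (HK (1 / 2) ltac:(lra)). pose proof (Rabs_pos (g (1 / 2) + g (- (1 / 2)) - 2 * g 0)). lra. }
  assert (H1 := is_RInt_fejer g N Hg).
  (* The constant function 1 has Cesaro sum exactly N; subtracting g 0 times this case leaves g - g
     0 against the kernel. *)
  assert (H2 := is_RInt_fejer (fun _ => 1) N ltac:(intros; auto_derive; auto)).
  rewrite cesaro_1 in H2.
  assert (H3 := is_RInt_minus (V := R_NormedModule) _ _ _ _ _ _ H1 (is_RInt_scal (V := R_NormedModule) _ _ _ (g 0) _ H2)).
  (* The kernel is even, so averaging over x and -x turns g - g 0 into half a second difference. *)
  apply is_RInt_even_part in H3.
  replace (cesaro (cos_coef g) N - INR N * g 0) with (minus (cesaro (cos_coef g) N) (scal (g 0) (INR N)))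
    by (change (cesaro (cos_coef g) N - g 0 * INR N = cesaro (cos_coef g) N - INR N * g 0); ring).
  replace K with ((1 / 2 - - (1 / 2)) * K) by field.
  refine (norm_RInt_le_const (V := R_NormedModule) _ _ _ _ K _ _ H3); [lra|].
  assert (P : forall x, 0 <= x <= 1 / 2 ->
    Rabs ((g x + g (- x) - 2 * g 0) * fejer N x / 2) <= K).
  { intros x Hx. unfold Rdiv. rewrite !Rabs_mult, (Rabs_pos_eq (/ 2)) by lra.
    specialize (HK x Hx). pose proof (fejer_bound N x Hx).
    pose proof (Rabs_pos (fejer N x)).
    assert (Rabs (g x + g (- x) - 2 * g 0) * Rabs (fejer N x) <= K * x ^ 2 * Rabs (fejer N x))
      by (apply Rmult_le_compat_r; assumption). nra. }
  intros x Hx.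
  change (Rabs ((g x * fejer N x - g 0 * (1 * fejer N x)
     + (g (- x) * fejer N (- x) - g 0 * (1 * fejer N (- x)))) / 2) <= K).
  rewrite fejer_even.
  destruct (Rle_dec 0 x) as [Hp|Hn].
  - specialize (P x ltac:(lra)).
    match goal with |- Rabs ?e <= _ => replace e with ((g x + g (- x) - 2 * g 0) * fejer N x / 2) by field end.
    exact P.
  - specialize (P (- x) ltac:(lra)). rewrite fejer_even, Ropp_involutive in P.
    match goal with |- Rabs ?e <= _ => replace e with ((g (- x) + g x - 2 * g 0) * fejer N x / 2) by field end.
    exact P.
Qed.

(** * Gaussian waves *)

Open Scope R_scope.

Lemma expn_near (n : Z) (x0 : R) : exp (- Rabs (IZR n + x0)) <= exp (Rabs x0) * expn n.
Proof.
  unfold expn. rewrite <- exp_plus. apply exp_le.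
  pose proof (Rabs_triang (IZR n + x0) (- x0)) as H.
  replace (IZR n + x0 + - x0) with (IZR n) in H by ring. rewrite Rabs_Ropp in H. lra.
Qed.

Lemma gauss_expn (al x0 : R) : 0 < al ->
  exists K, forall n : Z, exp (- (al * (IZR n + x0) ^ 2)) <= K * expn n.
Proof.
  intros Ha. exists (exp (1 ^ 2 / (4 * al)) * exp (Rabs x0)). intros n.
  eapply Rle_trans; [apply (gauss_dom al 1 _ Ha)|]. rewrite Rmult_assoc.
  apply Rmult_le_compat_l; [left; apply exp_pos|]. rewrite Rmult_1_l. apply expn_near.
Qed.

Definition gwave (s c th p : R) : R := exp (- (PI * s * p ^ 2)) * cos (2 * PI * c * p + th).

Definition gwave1 (s c th p : R) : R :=
  exp (- (PI * s * p ^ 2)) *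
  (- (2 * PI * s * p) * cos (2 * PI * c * p + th) - 2 * PI * c * sin (2 * PI * c * p + th)).

Definition gwave2 (s c th p : R) : R :=
  exp (- (PI * s * p ^ 2)) *
  ((4 * PI ^ 2 * s ^ 2 * p ^ 2 - 2 * PI * s - 4 * PI ^ 2 * c ^ 2) * cos (2 * PI * c * p + th)
   + 8 * PI ^ 2 * s * c * p * sin (2 * PI * c * p + th)).

Lemma gwave_derive s c th p : is_derive (gwave s c th) p (gwave1 s c th p).
Proof. unfold gwave, gwave1. auto_derive; [auto|simpl; ring]. Qed.

Lemma gwave1_derive s c th p : is_derive (gwave1 s c th) p (gwave2 s c th p).
Proof. unfold gwave1, gwave2. auto_derive; [auto|simpl; ring]. Qed.

(** Half of the Gaussian exponent, [al], absorbs the quadratic polynomial in p; the other half still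
    dominates exp (-|p|). *)
Lemma gwave2_bound s c th : 0 < s ->
  exists K, 0 <= K /\ forall p, Rabs (gwave2 s c th p) <= K * exp (- Rabs p).
Proof.
  intros Hs. pose proof PI_RGT_0 as HPI.
  set (al := PI * s / 2). assert (Hal : 0 < al) by (unfold al; nra).
  (* The coefficients left after the mixed term s c p is split by 2 |a b| <= a^2 + b^2. *)
  set (A0 := 8 * PI ^ 2 * s ^ 2 + 2 * PI * s + 8 * PI ^ 2 * c ^ 2).
  assert (HA0 : 0 <= A0).
  { unfold A0. pose proof (pow2_ge_0 (PI * s)); pose proof (pow2_ge_0 (PI * c)). nra. }
  assert (Hial : 0 < / al) by (apply Rinv_0_lt_compat, Hal).
  exists (A0 * (1 + / al) * exp (1 ^ 2 / (4 * al))). split.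
  { apply Rmult_le_pos; [apply Rmult_le_pos; lra|left; apply exp_pos]. }
  intros p.
  assert (B1 : Rabs ((4 * PI ^ 2 * s ^ 2 * p ^ 2 - 2 * PI * s - 4 * PI ^ 2 * c ^ 2) * cos (2 * PI * c * p + th)
   + 8 * PI ^ 2 * s * c * p * sin (2 * PI * c * p + th)) <= A0 * (1 + p ^ 2)).
  { eapply Rle_trans; [apply Rabs_triang|]. rewrite !Rabs_mult.
    assert (Hc1 : Rabs (cos (2 * PI * c * p + th)) <= 1) by (apply Rabs_le, COS_bound).
    assert (Hs1 : Rabs (sin (2 * PI * c * p + th)) <= 1) by (apply Rabs_le, SIN_bound).
    set (u := PI * s) in *. set (w := PI * c) in *.
    assert (Hu : 0 < u) by (unfold u; nra).
    rewrite <- (Rabs_mult 8), <- !(Rabs_mult _ s), <- !(Rabs_mult _ c), <- !(Rabs_mult _ p).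
    replace (4 * PI ^ 2 * s ^ 2 * p ^ 2 - 2 * PI * s - 4 * PI ^ 2 * c ^ 2)
      with (4 * u ^ 2 * p ^ 2 - 2 * u - 4 * w ^ 2) by (unfold u, w; ring).
    replace (8 * PI ^ 2 * s * c * p) with (8 * (u * p) * w) by (unfold u, w; ring).
    replace A0 with (8 * u ^ 2 + 2 * u + 8 * w ^ 2) by (unfold A0, u, w; ring).
    assert (Rabs (4 * u ^ 2 * p ^ 2 - 2 * u - 4 * w ^ 2) <= 4 * u ^ 2 * p ^ 2 + 2 * u + 4 * w ^ 2).
    { pose proof (pow2_ge_0 (u * p)); pose proof (pow2_ge_0 w). apply Rabs_le. nra. }
    assert (Rabs (8 * (u * p) * w) <= 4 * u ^ 2 * p ^ 2 + 4 * w ^ 2).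
    { pose proof (pow2_ge_0 (u * p - w)); pose proof (pow2_ge_0 (u * p + w)). apply Rabs_le. nra. }
    pose proof (Rabs_pos (4 * u ^ 2 * p ^ 2 - 2 * u - 4 * w ^ 2)).
    pose proof (Rabs_pos (8 * (u * p) * w)).
    pose proof (Rabs_pos (cos (2 * PI * c * p + th))). pose proof (Rabs_pos (sin (2 * PI * c * p + th))).
    apply Rle_trans with (4 * u ^ 2 * p ^ 2 + 2 * u + 4 * w ^ 2 + (4 * u ^ 2 * p ^ 2 + 4 * w ^ 2)); [nra|].
    pose proof (pow2_ge_0 p). pose proof (pow2_ge_0 w). pose proof (pow2_ge_0 u). nra. }
  assert (B2 : 1 + p ^ 2 <= (1 + / al) * exp (al * p ^ 2)).
  { pose proof (exp_ineq1_le (al * p ^ 2)) as He.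
    assert (0 <= al * p ^ 2) by (pose proof (pow2_ge_0 p); nra).
    assert (p ^ 2 <= / al * exp (al * p ^ 2)).
    { replace (p ^ 2) with (/ al * (al * p ^ 2)) at 1 by (field; lra).
      apply Rmult_le_compat_l; lra. }
    lra. }
  unfold gwave2. rewrite Rabs_mult, Rabs_pos_eq by (left; apply exp_pos).
  assert (B3 := gauss_dom al 1 p Hal). rewrite Rmult_1_l in B3.
  apply Rle_trans with (exp (- (PI * s * p ^ 2)) * (A0 * ((1 + / al) * exp (al * p ^ 2)))).
  { apply Rmult_le_compat_l; [left; apply exp_pos|].
    eapply Rle_trans; [exact B1|]. apply Rmult_le_compat_l; assumption. }
  replace (exp (- (PI * s * p ^ 2)) * (A0 * ((1 + / al) * exp (al * p ^ 2))))
    with (A0 * (1 + / al) * (exp (- (PI * s * p ^ 2)) * exp (al * p ^ 2))) by ring.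
  rewrite <- exp_plus.
  replace (- (PI * s * p ^ 2) + al * p ^ 2) with (- (al * p ^ 2)) by (unfold al; field).
  apply Rle_trans with (A0 * (1 + / al) * (exp (1 ^ 2 / (4 * al)) * exp (- Rabs p))).
  - apply Rmult_le_compat_l; [apply Rmult_le_pos; lra|exact B3].
  - right; ring.
Qed.

(** The mean value theorem applied twice, with a constant proportional to expn n so that the Fejer
    errors of all integer translates can be summed. *)
Lemma gwave_second_diff s c th x0 : 0 < s ->
  exists K, 0 <= K /\ forall (n : Z) x, 0 <= x <= 1 / 2 ->
    Rabs (gwave s c th (x + (IZR n + x0)) + gwave s c th (- x + (IZR n + x0))
          - 2 * gwave s c th (0 + (IZR n + x0))) <= K * expn n * x ^ 2.
Proof.
  intros Hs. destruct (gwave2_bound s c th Hs) as [K [HK0 HK]].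
  exists (2 * (K * (exp (1 / 2) * exp (Rabs x0)))). split.
  { pose proof (exp_pos (1 / 2)); pose proof (exp_pos (Rabs x0)).
    assert (0 <= exp (1 / 2) * exp (Rabs x0)) by nra. nra. }
  intros n x Hx. set (a := IZR n + x0).
  set (B := K * (exp (1 / 2) * exp (Rabs x0)) * expn n).
  assert (HB : forall y, - (1 / 2) <= y <= 1 / 2 -> Rabs (gwave2 s c th (y + a)) <= B).
  { intros y Hy. eapply Rle_trans; [apply HK|]. unfold B. rewrite Rmult_assoc.
    apply Rmult_le_compat_l; [exact HK0|].
    apply Rle_trans with (exp (1 / 2) * exp (- Rabs a)).
    - rewrite <- exp_plus. apply exp_le.
      pose proof (Rabs_triang (y + a) (- y)) as H. replace (y + a + - y) with a in H by ring.
      assert (Rabs (- y) <= 1 / 2) by (apply Rabs_le; lra). lra.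
    - rewrite Rmult_assoc. apply Rmult_le_compat_l; [left; apply exp_pos|apply expn_near]. }
  assert (H1 : forall y, 0 <= y <= x ->
     Rabs (gwave1 s c th (y + a) - gwave1 s c th (- y + a)) <= B * (2 * x)).
  { intros y Hy.
    apply Rle_trans with (B * ((y + a) - (- y + a))).
    - apply (MVT_abs (gwave1 s c th) (gwave2 s c th)); [lra|intros; apply gwave1_derive|].
      intros z Hz. replace z with ((z - a) + a) by ring. apply HB. lra.
    - assert (0 <= B). { specialize (HB 0 ltac:(lra)). pose proof (Rabs_pos (gwave2 s c th (0 + a))); lra. }
      apply Rmult_le_compat_l; lra. }
  assert (H2 := MVT_abs (fun y => gwave s c th (y + a) + gwave s c th (- y + a))
    (fun y => gwave1 s c th (y + a) - gwave1 s c th (- y + a)) 0 x (B * (2 * x)) ltac:(lra)).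
  cbv beta in H2. rewrite Ropp_0 in H2.
  replace (gwave s c th (x + a) + gwave s c th (- x + a) - 2 * gwave s c th (0 + a))
    with (gwave s c th (x + a) + gwave s c th (- x + a) - (gwave s c th (0 + a) + gwave s c th (0 + a))) by ring.
  replace (2 * (K * (exp (1 / 2) * exp (Rabs x0))) * expn n * x ^ 2) with (B * (2 * x) * (x - 0)) by (unfold B; ring).
  apply H2; [|exact H1].
  intros y _.
  replace (gwave1 s c th (y + a) - gwave1 s c th (- y + a))
    with (plus (1 * gwave1 s c th (y + a)) ((-1) * gwave1 s c th (- y + a)))
    by (change (1 * gwave1 s c th (y + a) + (-1) * gwave1 s c th (- y + a) = gwave1 s c th (y + a) - gwave1 s c th (- y + a)); ring).
  apply (is_derive_plus (K := R_AbsRing) (V := R_NormedModule)).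
  - apply (is_derive_comp (K := R_AbsRing) (V := R_NormedModule) (gwave s c th) (fun y => y + a)); [apply gwave_derive|].
    auto_derive; [auto|simpl; ring].
  - apply (is_derive_comp (K := R_AbsRing) (V := R_NormedModule) (gwave s c th) (fun y => - y + a)); [apply gwave_derive|].
    auto_derive; [auto|simpl; ring].
Qed.

Fixpoint rsum (f : Z -> R) (M : nat) : R :=
  match M with
  | O => 0
  | S p => rsum f p + (f (Z.of_nat p) + f (- Z.of_nat (S p))%Z)
  end.

Lemma zsum_RtoC f M : zsum (fun n => RtoC (f n)) M = RtoC (rsum f M).
Proof. induction M as [|M IH]; cbn [zsum rsum]; [reflexivity|]. rewrite IH, !RtoC_plus. reflexivity. Qed.

Lemma rsum_ext f g M : (forall n, f n = g n) -> rsum f M = rsum g M.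
Proof. intros H; induction M as [|M IH]; cbn [rsum]; [reflexivity|rewrite IH, !H; reflexivity]. Qed.
Lemma rsum_plus f g M : rsum (fun n => f n + g n) M = rsum f M + rsum g M.
Proof. induction M as [|M IH]; cbn [rsum]; [ring|rewrite IH; ring]. Qed.
Lemma rsum_scal c f M : rsum (fun n => c * f n) M = c * rsum f M.
Proof. induction M as [|M IH]; cbn [rsum]; [ring|rewrite IH; ring]. Qed.
Lemma rsum_abs f M : Rabs (rsum f M) <= rsum (fun n => Rabs (f n)) M.
Proof.
  induction M as [|M IH]; cbn [rsum]; [rewrite Rabs_R0; lra|].
  eapply Rle_trans; [apply Rabs_triang|]. apply Rplus_le_compat; [exact IH|apply Rabs_triang].
Qed.
Lemma rsum_le f g M : (forall n, f n <= g n) -> rsum f M <= rsum g M.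
Proof.
  intros H; induction M as [|M IH]; cbn [rsum]; [lra|].
  pose proof (H (Z.of_nat M)). pose proof (H (- Z.of_nat (S M))%Z). lra.
Qed.

Lemma rsum_expn M : rsum expn M <= 16.
Proof.
  assert (H := zsum_expn_bound (fun n => RtoC (expn n)) 1 M).
  rewrite zsum_RtoC, Cmod_R in H.
  eapply Rle_trans; [apply Rle_abs|]. replace 16 with (16 * 1) by ring. apply H.
  intros n. rewrite Cmod_R, Rabs_pos_eq by (left; apply expn_pos). lra.
Qed.

Lemma rsum_psum (g : nat -> Z -> R) N M :
  rsum (fun n => psum (fun i => g i n) N) M = psum (fun i => rsum (g i) M) N.
Proof.
  induction N as [|N IH]; cbn [psum].
  - induction M as [|M IH]; cbn [rsum]; [reflexivity|rewrite IH; ring].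
  - rewrite rsum_plus, IH. reflexivity.
Qed.

Lemma rsum_cesaro (c : Z -> nat -> R) N M :
  rsum (fun n => cesaro (c n) N) M = cesaro (fun r => rsum (fun n => c n r) M) N.
Proof.
  unfold cesaro. rewrite rsum_psum. apply psum_ext. intros m.
  rewrite rsum_plus, rsum_psum. f_equal. apply psum_ext. intros i. apply rsum_scal.
Qed.

Lemma is_lim_seq_psum (u : nat -> nat -> R) (l : nat -> R) N :
  (forall i, is_lim_seq (u i) (l i)) -> is_lim_seq (fun M => psum (fun i => u i M) N) (psum l N).
Proof.
  intros H. induction N as [|N IH]; simpl.
  - apply is_lim_seq_const.
  - apply (is_lim_seq_plus' _ _ _ _ IH (H N)).
Qed.

Lemma is_lim_seq_cesaro (u : nat -> nat -> R) (l : nat -> R) N :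
  (forall i, is_lim_seq (u i) (l i)) -> is_lim_seq (fun M => cesaro (fun r => u r M) N) (cesaro l N).
Proof.
  intros H. unfold cesaro.
  apply (is_lim_seq_psum (fun m M => u 0%nat M + psum (fun i => 2 * u (S i) M) m)
    (fun m => l 0%nat + psum (fun i => 2 * l (S i)) m)). intros m.
  apply is_lim_seq_plus'; [apply H|].
  apply (is_lim_seq_psum (fun i M => 2 * u (S i) M) (fun i => 2 * l (S i))). intros i.
  apply (is_lim_seq_scal_l (u (S i)) 2 (l (S i))), H.
Qed.

Lemma is_lim_seq_affine (a d : R) : 0 < a -> is_lim_seq (fun M => a * (INR M + d)) p_infty.
Proof.
  intros Ha. apply is_lim_seq_spec. intros B.
  destruct (INR_unbounded (B / a - d)) as [N HN]. exists N. intros n Hn.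
  apply le_INR in Hn.
  replace B with (a * (B / a)) at 1 by (field; lra). apply Rmult_lt_compat_l; lra.
Qed.

Lemma gauss_le_inv x : 1 <= x -> exp (- PI * x ^ 2) <= / x.
Proof.
  intros Hx. pose proof PI2_1. replace (- PI * x ^ 2) with (- (PI * x ^ 2)) by ring.
  rewrite exp_Ropp. apply Rinv_le_contravar; [lra|].
  pose proof (exp_ineq1_le (PI * x ^ 2)). nra.
Qed.

Lemma is_lim_seq_of_inv (u v : nat -> R) (l : R) : is_lim_seq u p_infty ->
  (forall n, 1 <= u n -> Rabs (v n - l) <= / u n) -> is_lim_seq v l.
Proof.
  intros Hu H.
  assert (Hi : is_lim_seq (fun n => / u n) 0).
  { replace (Finite 0) with (Rbar_inv p_infty) by reflexivity. apply is_lim_seq_inv; [exact Hu|discriminate]. }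
  apply is_lim_seq_ext with (fun n => l + (v n - l)); [intros; ring|].
  replace (Finite l) with (Finite (l + 0)) by (f_equal; ring).
  apply is_lim_seq_plus'; [apply is_lim_seq_const|].
  apply is_lim_seq_abs_0.
  apply (is_lim_seq_le_le_loc (fun _ => 0) _ (fun n => / u n)); [|apply is_lim_seq_const|exact Hi].
  apply is_lim_seq_spec in Hu. destruct (Hu 1) as [N HN]. exists N. intros n Hn.
  split; [apply Rabs_pos|]. apply H. specialize (HN n Hn). lra.
Qed.

(** The interval is the union of the unit intervals centred at n + d for -M <= n < M. It need not be
    symmetric: both ends tend to infinity, and E contributes L from each. *)
Lemma gauss_FT_lim s th xi d L : 0 < s -> E_limit L ->
  is_lim_seq (fun M => gauss_FT s th (- INR M - 1 / 2 + d) (INR M - 1 / 2 + d) xi)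
    (L / sqrt s * (exp (- (PI * xi ^ 2 / s)) * cos th)).
Proof.
  intros Hs HL. pose proof (sqrt_lt_R0 s Hs) as Hq.
  pose (u := fun M => sqrt s * (INR M + (- (1 / 2) + d))).
  pose (w := fun M => sqrt s * (INR M + (1 / 2 - d))).
  assert (Hu : is_lim_seq u p_infty) by (apply is_lim_seq_affine, Hq).
  assert (Hw : is_lim_seq w p_infty) by (apply is_lim_seq_affine, Hq).
  assert (Lim1 : forall v, is_lim_seq v p_infty -> is_lim_seq (fun M => E (v M)) L).
  { intros v Hv. apply (is_lim_seq_of_inv v); [exact Hv|]. intros n Hn.
    eapply Rle_trans; [apply HL, Hn|apply gauss_le_inv, Hn]. }
  assert (Lim0 : forall v, is_lim_seq v p_infty -> is_lim_seq (fun M => exp (- PI * v M ^ 2)) 0).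
  { intros v Hv. apply (is_lim_seq_of_inv v); [exact Hv|]. intros n Hn.
    rewrite Rminus_0_r, Rabs_pos_eq by (left; apply exp_pos). apply gauss_le_inv, Hn. }
  pose (main := fun M => exp (- (PI * xi ^ 2 / s)) * (cos th * ((E (u M) + E (w M)) / (2 * sqrt s)))).
  assert (Hmain : is_lim_seq main (L / sqrt s * (exp (- (PI * xi ^ 2 / s)) * cos th))).
  { replace (L / sqrt s * (exp (- (PI * xi ^ 2 / s)) * cos th))
      with (exp (- (PI * xi ^ 2 / s)) * cos th / (2 * sqrt s) * (L + L)) by (field; lra).
    apply (is_lim_seq_ext (fun M => exp (- (PI * xi ^ 2 / s)) * cos th / (2 * sqrt s) * (E (u M) + E (w M)))).
    { intros M; unfold main; field; lra. }
    apply (is_lim_seq_scal_l _ _ (L + L)). apply is_lim_seq_plus'; apply Lim1; assumption. }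
  assert (Herr : is_lim_seq (fun M => Rabs xi / s * (exp (- PI * u M ^ 2) + exp (- PI * w M ^ 2))) 0).
  { replace (Finite 0) with (Finite (Rabs xi / s * (0 + 0))) by (f_equal; ring).
    apply (is_lim_seq_scal_l _ _ (0 + 0)). apply is_lim_seq_plus'; apply Lim0; assumption. }
  apply (is_lim_seq_ext (fun M => main M + (gauss_FT s th (- INR M - 1 / 2 + d) (INR M - 1 / 2 + d) xi - main M))).
  { intros; ring. }
  match goal with |- is_lim_seq _ (Finite ?l) => replace (Finite l) with (Finite (l + 0)) by (f_equal; ring) end.
  apply is_lim_seq_plus'; [exact Hmain|].
  apply is_lim_seq_abs_0.
  apply (is_lim_seq_le_le (fun _ => 0) _ (fun M => Rabs xi / s * (exp (- PI * u M ^ 2) + exp (- PI * w M ^ 2))));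
    [|apply is_lim_seq_const|exact Herr].
  intros M. split; [apply Rabs_pos|].
  assert (B := gauss_FT_bound s th (- INR M - 1 / 2 + d) (INR M - 1 / 2 + d) xi Hs).
  replace (sqrt s * (INR M - 1 / 2 + d)) with (u M) in B by (unfold u; ring).
  replace (sqrt s * (- INR M - 1 / 2 + d)) with (- w M) in B by (unfold w; ring).
  rewrite E_odd in B. unfold main.
  replace (E (u M) + E (w M)) with (E (u M) - - E (w M)) by ring.
  replace (- PI * u M ^ 2) with (- (PI * s * (INR M - 1 / 2 + d) ^ 2)).
  - replace (- PI * w M ^ 2) with (- (PI * s * (- INR M - 1 / 2 + d) ^ 2)); [exact B|].
    unfold w. rewrite <- (sqrt_sqrt s) at 1 by lra. ring.
  - unfold u. rewrite <- (sqrt_sqrt s) at 1 by lra. ring.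
Qed.

Lemma gauss_FT_Chasles s th a b c xi : gauss_FT s th a b xi + gauss_FT s th b c xi = gauss_FT s th a c xi.
Proof.
  apply (RInt_Chasles (V := R_CompleteNormedModule));
    apply (ex_RInt_diff (fun t => exp (- (PI * s * t ^ 2)) * cos (2 * PI * xi * t + th)));
    intros; auto_derive; auto.
Qed.

Lemma gauss_FT_rsum s th xi d M :
  rsum (fun n => gauss_FT s th (IZR n - 1 / 2 + d) (IZR n + 1 / 2 + d) xi) M
  = gauss_FT s th (- INR M - 1 / 2 + d) (INR M - 1 / 2 + d) xi.
Proof.
  induction M as [|M IH]; cbn [rsum].
  - simpl INR. rewrite Ropp_0. unfold gauss_FT. rewrite RInt_point. reflexivity.
  - rewrite IH. rewrite opp_IZR, <- !INR_IZR_INZ.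
    replace (INR M + 1 / 2 + d) with (INR (S M) - 1 / 2 + d) by (rewrite S_INR; field).
    replace (- INR (S M) + 1 / 2 + d) with (- INR M - 1 / 2 + d) by (rewrite S_INR; field).
    rewrite <- (gauss_FT_Chasles s th (- INR (S M) - 1 / 2 + d) (- INR M - 1 / 2 + d) (INR (S M) - 1 / 2 + d)).
    rewrite <- (gauss_FT_Chasles s th (- INR M - 1 / 2 + d) (INR M - 1 / 2 + d) (INR (S M) - 1 / 2 + d)).
    ring.
Qed.

(** Unfolding: translation by n does not affect cos (2 PI r x), so the coefficient is an integral
    over the unit interval centred at n + x0, and summing over n assembles an integral over the
    line. The product of cosines yields the frequencies c + r and c - r. *)
Lemma gwave_cos_coef s c th x0 (n : Z) (r : nat) :
  cos_coef (fun x => gwave s c th (x + (IZR n + x0))) r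
  = 1 / 2 * (gauss_FT s (th - 2 * PI * INR r * x0) (IZR n - 1 / 2 + x0) (IZR n + 1 / 2 + x0) (c + INR r)
           + gauss_FT s (th + 2 * PI * INR r * x0) (IZR n - 1 / 2 + x0) (IZR n + 1 / 2 + x0) (c - INR r)).
Proof.
  unfold cos_coef. apply is_RInt_unique.
  pose (h := fun t => gwave s c th t * cos (2 * PI * INR r * (t - x0))).
  apply (is_RInt_ext (fun x => h (x + (IZR n + x0)))).
  { intros x _. unfold h. f_equal.
    replace (2 * PI * INR r * (x + (IZR n + x0) - x0))
      with (2 * PI * INR r * x + 2 * PI * IZR (Z.of_nat r * n)) by (rewrite mult_IZR, <- INR_IZR_INZ; ring).
    rewrite cos_plus, cos_2PI_IZR, sin_2PI_IZR. ring. }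
  apply (is_RInt_shift h).
  replace (- (1 / 2) + (IZR n + x0)) with (IZR n - 1 / 2 + x0) by ring.
  replace (1 / 2 + (IZR n + x0)) with (IZR n + 1 / 2 + x0) by ring.
  apply (is_RInt_ext (fun t => scal (1 / 2) (plus
     (exp (- (PI * s * t ^ 2)) * cos (2 * PI * (c + INR r) * t + (th - 2 * PI * INR r * x0)))
     (exp (- (PI * s * t ^ 2)) * cos (2 * PI * (c - INR r) * t + (th + 2 * PI * INR r * x0)))))).
  { intros t _. unfold h, gwave.
    match goal with |- scal _ (plus (?e * cos ?A) (_ * cos ?B)) = ?e * cos ?P * cos ?Q =>
      change (1 / 2 * (e * cos A + e * cos B) = e * cos P * cos Q);
      replace A with (P + Q) by ring; replace B with (P - Q) by ring; rewrite cos_plus, cos_minus; field end. }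
  apply (is_RInt_scal (V := R_NormedModule)), (is_RInt_plus (V := R_NormedModule)).
  - apply (is_RInt_diff (fun t => exp (- (PI * s * t ^ 2)) * cos (2 * PI * (c + INR r) * t + (th - 2 * PI * INR r * x0)))).
    intros; auto_derive; auto.
  - apply (is_RInt_diff (fun t => exp (- (PI * s * t ^ 2)) * cos (2 * PI * (c - INR r) * t + (th + 2 * PI * INR r * x0)))).
    intros; auto_derive; auto.
Qed.

(** * Poisson summation and theta inversion *)

Open Scope R_scope.

Lemma psum_exp_bound N : psum (fun m => exp (- INR m)) N <= 2.
Proof.
  assert (H : psum (fun m => exp (- INR m)) N <= 2 * (1 - exp (- INR N))).
  { induction N as [|N IH].
    - simpl. rewrite Ropp_0, exp_0; lra.
    - cbn [psum]. rewrite S_INR. replace (- (INR N + 1)) with (- INR N + - (1)) by ring.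
      rewrite exp_plus. pose proof exp_m1_half. pose proof (exp_pos (- INR N)). nra. }
  pose proof (exp_pos (- INR N)). lra.
Qed.

Lemma psum_abs a M : Rabs (psum a M) <= psum (fun i => Rabs (a i)) M.
Proof.
  induction M as [|M IH]; simpl; [rewrite Rabs_R0; lra|].
  eapply Rle_trans; [apply Rabs_triang|]. lra.
Qed.

Lemma psum_le a b M : (forall i, a i <= b i) -> psum a M <= psum b M.
Proof. intros H; induction M as [|M IH]; simpl; [lra|]. pose proof (H M); lra. Qed.

Lemma Series_zero : Series (fun _ => 0) = 0.
Proof. rewrite (Series_ext _ (fun n => 0 * 0)), Series_scal_l by (intros; ring). ring. Qed.

Lemma RtoC_ZSeries_rsum (f : Z -> R) : exp_decay (fun n => RtoC (f n)) ->
  exists l K, ZSeries (fun n => RtoC (f n)) = RtoC l /\ 0 <= K /\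
    forall M, Rabs (rsum f M - l) <= K * exp (- INR M).
Proof.
  intros Hf. destruct (ZSeries_correct _ Hf) as [K HK].
  assert (Him : Im (ZSeries (fun n => RtoC (f n))) = 0).
  { unfold ZSeries, CSeries. rewrite Im_plus. cbn [Im snd RtoC].
    rewrite Series_zero. ring. }
  exists (Re (ZSeries (fun n => RtoC (f n)))), K.
  assert (E1 : ZSeries (fun n => RtoC (f n)) = RtoC (Re (ZSeries (fun n => RtoC (f n))))).
  { apply C_ext; [reflexivity|exact Him]. }
  split; [exact E1|]. split.
  - specialize (HK O). simpl INR in HK. rewrite Ropp_0, exp_0, Rmult_1_r in HK.
    eapply Rle_trans; [apply Cmod_ge_0|exact HK].
  - intros M. specialize (HK M). rewrite E1, zsum_RtoC, <- RtoC_minus, Cmod_R in HK. exact HK.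
Qed.

Lemma is_lim_seq_exp_bound (u : nat -> R) l K : (forall M, Rabs (u M - l) <= K * exp (- INR M)) -> is_lim_seq u l.
Proof.
  intros H.
  apply (is_lim_seq_ext (fun n => l + (u n - l))); [intros; ring|].
  replace (Finite l) with (Finite (l + 0)) by (f_equal; ring).
  apply is_lim_seq_plus'; [apply is_lim_seq_const|]. apply is_lim_seq_abs_0.
  apply (is_lim_seq_le_le (fun _ => 0) _ (fun n => K * exp (- (1)) ^ n)).
  - intros n. split; [apply Rabs_pos|]. rewrite <- exp_mINR_pow. apply H.
  - apply is_lim_seq_const.
  - replace (Finite 0) with (Finite (K * 0)) by (f_equal; ring).
    apply (is_lim_seq_scal_l _ K 0). apply is_lim_seq_geom.
    pose proof exp_m1_half. pose proof (exp_pos (-(1))). rewrite Rabs_pos_eq; lra.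
Qed.

(* [rsum b m] omits the index m, hence the extra term. *)
Lemma cesaro_rsum (b : Z -> R) N :
  cesaro (fun r => 1 / 2 * (b (Z.of_nat r) + b (- Z.of_nat r)%Z)) N
  = psum (fun m => rsum b m + b (Z.of_nat m)) N.
Proof.
  unfold cesaro. apply psum_ext. intros m.
  induction m as [|m IH]; cbn [psum rsum].
  - simpl Z.of_nat. simpl Z.opp. field.
  - rewrite <- Rplus_assoc, IH. field.
Qed.

(** Partial sums approach l at an exponential rate, so their errors have a bounded total and the
    N-th Cesaro sum stays within a constant of N l. The factor 2 bounds the sum of exp (-m). *)
Lemma cesaro_approx (b : Z -> R) l K K' :
  (forall M, Rabs (rsum b M - l) <= K * exp (- INR M)) -> (forall n, Rabs (b n) <= K' * expn n) ->
  forall N, Rabs (cesaro (fun r => 1 / 2 * (b (Z.of_nat r) + b (- Z.of_nat r)%Z)) N - INR N * l) <= 2 * (K + K').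
Proof.
  intros H H' N. rewrite cesaro_rsum, <- psum_const.
  replace (psum (fun m => rsum b m + b (Z.of_nat m)) N - psum (fun _ => l) N)
    with (psum (fun m => (rsum b m - l) + b (Z.of_nat m)) N).
  - eapply Rle_trans; [apply psum_abs|].
    assert (0 <= K + K').
    { specialize (H O); specialize (H' 0%Z). unfold expn in H'. rewrite Rabs_R0 in H'.
      simpl INR in H. rewrite Ropp_0, exp_0 in *.
      pose proof (Rabs_pos (rsum b 0 - l)); pose proof (Rabs_pos (b 0%Z)). lra. }
    apply Rle_trans with (psum (fun m => (K + K') * exp (- INR m)) N).
    + apply psum_le. intros m. eapply Rle_trans; [apply Rabs_triang|].
      specialize (H m); specialize (H' (Z.of_nat m)). rewrite expn_nat in H'. lra.
    + rewrite psum_scal. pose proof (psum_exp_bound N). nra.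
  - rewrite (psum_ext _ (fun m => (rsum b m + b (Z.of_nat m)) + (-1) * l)) by (intros; ring).
    rewrite psum_plus, psum_scal with (a := fun _ => l). ring.
Qed.

Lemma bounded_multiples_0 (d K : R) : (forall N, INR N * Rabs d <= K) -> d = 0.
Proof.
  intros H. destruct (Req_dec d 0) as [|Hd]; [assumption|exfalso].
  pose proof (Rabs_pos_lt d Hd).
  destruct (INR_unbounded (K / Rabs d)) as [N HN].
  specialize (H N). apply (Rmult_lt_compat_r (Rabs d)) in HN; [|assumption].
  unfold Rdiv in HN. rewrite Rmult_assoc, Rinv_l, Rmult_1_r in HN by lra. lra.
Qed.

Lemma Rabs_cos_le (e y : R) : 0 <= e -> Rabs (e * cos y) <= e.
Proof.
  intros He. rewrite Rabs_mult, (Rabs_pos_eq e) by exact He.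
  assert (Rabs (cos y) <= 1) by (apply Rabs_le, COS_bound). nra.
Qed.

(** The periodised Gaussian is never formed. Each translate obeys the Fejer estimate with a summable
    constant, so the Cesaro sum of the Fourier coefficients is within a constant of N P; by absolute
    convergence it is also within a constant of N S. Hence N |P - S| is bounded in N. *)
Lemma poisson_real L s c th x0 : 0 < s -> E_limit L ->
  ZSeries (fun n => RtoC (gwave s c th (IZR n + x0)))
  = ZSeries (fun r => RtoC (L / sqrt s * (exp (- (PI * (c + IZR r) ^ 2 / s)) * cos (th - 2 * PI * IZR r * x0)))).
Proof.
  intros Hs HL. pose proof PI_RGT_0 as HPI.
  set (b := fun r : Z => L / sqrt s * (exp (- (PI * (c + IZR r) ^ 2 / s)) * cos (th - 2 * PI * IZR r * x0))).
  destruct (gauss_expn (PI * s) x0) as [K1 H1]; [nra|].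
  destruct (gauss_expn (PI / s) c) as [K2 H2]; [apply Rdiv_lt_0_compat; lra|].
  destruct (gwave_second_diff s c th x0 Hs) as [K3 [HK3 H3]].
  assert (Hb : forall r, Rabs (b r) <= Rabs (L / sqrt s) * K2 * expn r).
  { intros r. unfold b. rewrite Rabs_mult, (Rmult_assoc _ K2). apply Rmult_le_compat_l; [apply Rabs_pos|].
    eapply Rle_trans; [apply Rabs_cos_le; left; apply exp_pos|].
    eapply Rle_trans; [|apply (H2 r)]. right. f_equal. unfold Rdiv. ring. }
  destruct (RtoC_ZSeries_rsum (fun n => gwave s c th (IZR n + x0))) as (P & K4 & EP & _ & HP).
  { exists K1. intros n. rewrite Cmod_R. eapply Rle_trans; [apply Rabs_cos_le; left; apply exp_pos|apply H1]. }
  destruct (RtoC_ZSeries_rsum b) as (S & K5 & ES & _ & HS).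
  { exists (Rabs (L / sqrt s) * K2). intros n. rewrite Cmod_R. apply Hb. }
  rewrite EP. etransitivity; [|symmetry; exact ES]. f_equal. apply Rminus_diag_uniq.
  apply (bounded_multiples_0 _ (16 * K3 + 2 * (K5 + Rabs (L / sqrt s) * K2))). intros N.
  pose (a := fun r : nat => 1 / 2 * (b (Z.of_nat r) + b (- Z.of_nat r)%Z)).
  pose (g := fun (n : Z) x => gwave s c th (x + (IZR n + x0))).
  assert (B1 : Rabs (cesaro a N - INR N * P) <= 16 * K3).
  (* N is fixed and the number of translates tends to infinity: the coefficients of the finite sum
     converge to full Fourier integrals. *)
  { assert (Lim : is_lim_seq (fun M => Rabs (cesaro (fun r => rsum (fun n => cos_coef (g n) r) M) N
        - INR N * rsum (fun n => gwave s c th (IZR n + x0)) M)) (Rabs (cesaro a N - INR N * P))).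
    { apply (is_lim_seq_abs _ (cesaro a N - INR N * P)). apply is_lim_seq_minus'.
      - apply (is_lim_seq_cesaro (fun r M => rsum (fun n => cos_coef (g n) r) M)). intros r.
        apply (is_lim_seq_ext (fun M => 1 / 2 *
          (gauss_FT s (th - 2 * PI * INR r * x0) (- INR M - 1 / 2 + x0) (INR M - 1 / 2 + x0) (c + INR r)
           + gauss_FT s (th + 2 * PI * INR r * x0) (- INR M - 1 / 2 + x0) (INR M - 1 / 2 + x0) (c - INR r)))).
        { intros M. rewrite <- !gauss_FT_rsum, <- rsum_plus, <- rsum_scal. apply rsum_ext. intros n.
          symmetry; apply gwave_cos_coef. }
        unfold a. apply (is_lim_seq_scal_l _ (1 / 2) (b (Z.of_nat r) + b (- Z.of_nat r)%Z)).
        apply is_lim_seq_plus'; unfold b; rewrite ?opp_IZR, <- !INR_IZR_INZ.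
        + apply gauss_FT_lim; assumption.
        + replace (th - 2 * PI * - INR r * x0) with (th + 2 * PI * INR r * x0) by ring.
          replace (c + - INR r) with (c - INR r) by ring. apply gauss_FT_lim; assumption.
      - apply (is_lim_seq_scal_l _ (INR N) P). exact (is_lim_seq_exp_bound _ _ _ HP). }
    refine (is_lim_seq_le _ (fun _ => 16 * K3) _ (16 * K3) _ Lim (is_lim_seq_const _)).
    intros M. rewrite <- (rsum_cesaro (fun n => cos_coef (g n))).
    match goal with |- Rabs (?A - ?B) <= _ => replace (A - B) with
      (rsum (fun n => cesaro (cos_coef (g n)) N + - INR N * gwave s c th (IZR n + x0)) M)
      by (rewrite rsum_plus, (rsum_scal (- INR N)); ring) end.
    eapply Rle_trans; [apply rsum_abs|].
    apply Rle_trans with (rsum (fun n => K3 * expn n) M).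
    - apply rsum_le. intros n.
      match goal with |- Rabs ?A <= _ => replace A with
        (cesaro (cos_coef (g n)) N - INR N * g n 0) by (unfold g; rewrite Rplus_0_l; ring) end.
      apply fejer_approx.
      + intros x. unfold g, gwave. auto_derive; auto.
      + intros x Hx. apply H3, Hx.
    - rewrite rsum_scal. pose proof (rsum_expn M). nra. }
  assert (B2 := cesaro_approx b S K5 _ HS Hb N). fold a in B2.
  rewrite <- (Rabs_pos_eq (INR N)) by apply pos_INR. rewrite <- Rabs_mult.
  replace (INR N * (P - S)) with (- (cesaro a N - INR N * P) + (cesaro a N - INR N * S)) by ring.
  eapply Rle_trans; [apply Rabs_triang|]. rewrite Rabs_Ropp. lra.
Qed.

Open Scope C_scope.

Lemma Cexp_RtoC (x : R) : Cexp (RtoC x) = RtoC (exp x).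
Proof. unfold Cexp; simpl. rewrite cos_0, sin_0. apply C_ext; simpl; ring. Qed.

Lemma Cexp_Ci_cos (x : R) : Cexp (Ci * x) = RtoC (cos x) + Ci * RtoC (cos (x - PI / 2)).
Proof.
  rewrite Cexp_Ci, cos_minus, cos_PI2, sin_PI2. apply C_ext; simpl; ring.
Qed.

Lemma theta_inversion_real L (s c x0 : R) : (0 < s)%R -> E_limit L ->
  ZSeries (fun n => RtoC (exp (- (PI * s * (IZR n + x0) ^ 2))) * Cexp (Ci * RtoC (2 * PI * c * (IZR n + x0))))
  = RtoC (L / sqrt s) *
    ZSeries (fun r => RtoC (exp (- (PI * (c + IZR r) ^ 2 / s))) * Cexp (Ci * RtoC (- (2 * PI * IZR r * x0)))).
Proof.
  intros Hs HL. pose proof PI_RGT_0 as HPI.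
  destruct (gauss_expn (PI * s) x0) as [K1 H1]; [nra|].
  destruct (gauss_expn (PI / s) c) as [K2 H2]; [apply Rdiv_lt_0_compat; lra|].
  assert (G1 : forall th, exp_decay (fun n => RtoC (gwave s c th (IZR n + x0)))).
  { intros th. exists K1. intros n. rewrite Cmod_R. eapply Rle_trans; [apply Rabs_cos_le; left; apply exp_pos|apply H1]. }
  assert (G2 : forall th, exp_decay (fun r => RtoC (exp (- (PI * (c + IZR r) ^ 2 / s)) * cos (th - 2 * PI * IZR r * x0)))).
  { intros th. exists K2. intros n. rewrite Cmod_R. eapply Rle_trans; [apply Rabs_cos_le; left; apply exp_pos|].
    eapply Rle_trans; [|apply (H2 n)]. right. f_equal. unfold Rdiv. ring. }
  (* The phases 0 and -PI/2 yield the real and the imaginary part of the complex exponential. *)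
  rewrite (ZSeries_ext _ (fun n => RtoC (gwave s c 0 (IZR n + x0)) + Ci * RtoC (gwave s c (- (PI / 2)) (IZR n + x0)))).
  2:{ intros n. rewrite Cexp_Ci_cos. unfold gwave. rewrite !RtoC_mult.
      replace (2 * PI * c * (IZR n + x0) + 0)%R with (2 * PI * c * (IZR n + x0))%R by ring.
      replace (2 * PI * c * (IZR n + x0) + - (PI / 2))%R with (2 * PI * c * (IZR n + x0) - PI / 2)%R by ring. ring. }
  rewrite (ZSeries_ext (fun r => RtoC (exp _) * Cexp _)
    (fun r => RtoC (exp (- (PI * (c + IZR r) ^ 2 / s)) * cos (0 - 2 * PI * IZR r * x0))
      + Ci * RtoC (exp (- (PI * (c + IZR r) ^ 2 / s)) * cos (- (PI / 2) - 2 * PI * IZR r * x0)))).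
  2:{ intros n. rewrite Cexp_Ci_cos. rewrite !RtoC_mult.
      replace (0 - 2 * PI * IZR n * x0)%R with (- (2 * PI * IZR n * x0))%R by ring.
      replace (- (PI / 2) - 2 * PI * IZR n * x0)%R with (- (2 * PI * IZR n * x0) - PI / 2)%R by ring. ring. }
  rewrite !ZSeries_plus, !ZSeries_scal by (repeat apply exp_decay_scal; auto).
  rewrite !(poisson_real L s c _ x0 Hs HL).
  assert (Ex : forall th, ZSeries (fun r => RtoC (L / sqrt s * (exp (- (PI * (c + IZR r) ^ 2 / s)) * cos (th - 2 * PI * IZR r * x0))))
     = RtoC (L / sqrt s) * ZSeries (fun r => RtoC (exp (- (PI * (c + IZR r) ^ 2 / s)) * cos (th - 2 * PI * IZR r * x0)))).
  { intros th. rewrite <- ZSeries_scal by apply G2. apply ZSeries_ext; intros; apply RtoC_mult. }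
  rewrite !Ex. ring.
Qed.

(* Theta inversion at a point where the theta value is nonzero forces E to tend to 1:
   this is the Gaussian integral. *)
Lemma E_limit_1 : E_limit 1.
Proof.
  destruct E_limit_ex as [L HL]. replace 1%R with L; [exact HL|].
  (* At this self-dual point both series are the same, with value P, so [H] will read P = L P. *)
  assert (H := theta_inversion_real L 1 0 0 Rlt_0_1 HL).
  rewrite sqrt_1 in H. unfold Rdiv in H. rewrite Rinv_1 in H.
  rewrite (ZSeries_ext _ (fun n => RtoC (exp (- (PI * 1 * (IZR n + 0) ^ 2))))) in H.
  2:{ intros n. replace (2 * PI * 0 * (IZR n + 0))%R with 0%R by ring.
      replace (Ci * 0) with (RtoC 0) by ring. rewrite Cexp_0; ring. }
  rewrite (ZSeries_ext (fun r => RtoC (exp _) * Cexp _) (fun n => RtoC (exp (- (PI * 1 * (IZR n + 0) ^ 2))))) in H.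
  2:{ intros n. replace (- (2 * PI * IZR n * 0))%R with 0%R by ring.
      replace (Ci * 0) with (RtoC 0) by ring. rewrite Cexp_0, Cmult_1_r. do 3 f_equal. ring. }
  destruct (gauss_expn (PI * 1) 0) as [K1 H1]; [pose proof PI_RGT_0; lra|].
  destruct (RtoC_ZSeries_rsum (fun n => exp (- (PI * 1 * (IZR n + 0) ^ 2)))) as (P & K & EP & HK0 & HP).
  { exists K1. intros n. rewrite Cmod_R, Rabs_pos_eq by (left; apply exp_pos). apply H1. }
  rewrite EP, <- RtoC_mult in H. apply RtoC_inj in H.
  assert (1 <= P)%R.
  { assert (Hlow : forall M, (1 <= rsum (fun n => exp (- (PI * 1 * (IZR n + 0) ^ 2))) (S M))%R).
    { intros M. induction M as [|M IH].
      - cbn [rsum]. replace (- (PI * 1 * (IZR (Z.of_nat 0) + 0) ^ 2))%R with 0%R by (simpl; ring).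
        rewrite exp_0. pose proof (exp_pos (- (PI * 1 * (IZR (- Z.of_nat 1) + 0) ^ 2))). lra.
      - remember (S M) as N. cbn [rsum].
        pose proof (exp_pos (- (PI * 1 * (IZR (Z.of_nat N) + 0) ^ 2))).
        pose proof (exp_pos (- (PI * 1 * (IZR (- Z.of_nat (S N)) + 0) ^ 2))). lra. }
    assert (HL' := proj1 (is_lim_seq_incr_1 _ P) (is_lim_seq_exp_bound _ _ _ HP)).
    exact (is_lim_seq_le (fun _ => 1%R) _ 1 P Hlow (is_lim_seq_const _) HL'). }
  rewrite Rmult_1_r in H. nra.
Qed.

(** [theta_freq] and [theta_pos] come from differentiating the key identity in c: the first is half
    the derivative of E ((r + c) sg) times the wave, the second is the derivative of [theta_pos] /
    (x + n) divided by 2 PI i. *)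
Definition theta_freq (sg c : R) (x : C) (r : Z) : C :=
  RtoC (sg * exp (- (PI * ((IZR r + c) * sg) ^ 2))) * Cexp (- (2 * PI * Ci * IZR r * x)).

Definition theta_pos (sg c : R) (x : C) (n : Z) : C :=
  Cexp (2 * PI * Ci * c * (x + IZR n) - RtoC (PI / sg ^ 2) * ((x + IZR n) * (x + IZR n))).

(** For real x this is the previous inversion with s = 1 / sg^2. The imaginary part of x is removed
    by completing the square, which shifts c by a real amount and produces a factor exp [ka] common
    to both sides. *)
Lemma theta_inversion (sg c : R) (x : C) : (0 < sg)%R ->
  ZSeries (theta_freq sg c x) = ZSeries (theta_pos sg c x).
Proof.
  intros Hs. pose proof PI_RGT_0 as HPI.
  assert (Hs2 : (0 < / sg ^ 2)%R) by (apply Rinv_0_lt_compat; nra).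
  set (xi := Re x). set (eta := Im x).
  set (c' := (c - eta / sg ^ 2)%R).
  set (ka := (- 2 * PI * c * eta + PI * eta ^ 2 / sg ^ 2)%R).
  assert (H := theta_inversion_real 1 (/ sg ^ 2) c' xi Hs2 E_limit_1).
  rewrite sqrt_inv, sqrt_pow2 in H by lra.
  unfold Rdiv in H. rewrite Rmult_1_l, Rinv_inv in H.
  destruct (gauss_expn (PI * / sg ^ 2) xi) as [K1 H1]; [nra|].
  destruct (gauss_expn (PI * sg ^ 2) c') as [K2 H2]; [apply Rmult_lt_0_compat; [lra|apply pow_lt; lra]|].
  rewrite (ZSeries_ext (theta_pos sg c x) (fun n => RtoC (exp ka) *
     (RtoC (exp (- (PI * / sg ^ 2 * (IZR n + xi) ^ 2))) * Cexp (Ci * RtoC (2 * PI * c' * (IZR n + xi)))))).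
  2:{ intros n. unfold theta_pos. rewrite <- !Cexp_RtoC, <- !Cexp_plus. f_equal.
      apply C_ext; unfold ka, c', xi, eta; destruct x as [x1 x2]; simpl; field; lra. }
  rewrite (ZSeries_ext (theta_freq sg c x) (fun r => RtoC (exp ka) * (RtoC sg *
     (RtoC (exp (- (PI * (c' + IZR r) ^ 2 * / / sg ^ 2))) * Cexp (Ci * RtoC (- (2 * PI * IZR r * xi))))))).
  2:{ intros n. unfold theta_freq. rewrite RtoC_mult.
      rewrite <- !Cexp_RtoC, <- !Cmult_assoc, <- !Cexp_plus.
      rewrite (Cmult_assoc (Cexp ka)), (Cmult_comm (Cexp ka)), <- Cmult_assoc, <- Cexp_plus. do 2 f_equal.
      apply C_ext; unfold ka, c', xi, eta; destruct x as [x1 x2]; simpl; field; lra. }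
  assert (G1 : exp_decay (fun n => RtoC (exp (- (PI * / sg ^ 2 * (IZR n + xi) ^ 2))) * Cexp (Ci * RtoC (2 * PI * c' * (IZR n + xi))))).
  { exists K1. intros n. rewrite Cmod_mult, Cmod_R, Cmod_Cexp, Rabs_pos_eq by (left; apply exp_pos).
    rewrite Re_mult; simpl Re; simpl Im. rewrite Rmult_0_l, Rmult_0_r, Rminus_0_r, exp_0, Rmult_1_r. apply H1. }
  assert (G2 : exp_decay (fun r => RtoC (exp (- (PI * (c' + IZR r) ^ 2 * / / sg ^ 2))) * Cexp (Ci * RtoC (- (2 * PI * IZR r * xi))))).
  { exists K2. intros n. rewrite Cmod_mult, Cmod_R, Cmod_Cexp, Rabs_pos_eq by (left; apply exp_pos).
    rewrite Re_mult; simpl Re; simpl Im. rewrite Rmult_0_l, Rmult_0_r, Rminus_0_r, exp_0, Rmult_1_r.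
    eapply Rle_trans; [|apply (H2 n)]. right. f_equal. rewrite Rinv_inv; ring. }
  rewrite !ZSeries_scal by (repeat apply exp_decay_scal; assumption).
  rewrite H. reflexivity.
Qed.

(** * The completed Appell kernel *)

Open Scope R_scope.

(** Uniform in bounded x0 and with any rate [be], which is later chosen to outweigh the growth of
    exp (-2 PI i r x) for nonreal x. *)
Lemma gauss_lin_dom (al be B : R) : 0 < al -> 0 <= be ->
  exists K, 0 <= K /\ forall x0, Rabs x0 <= B -> forall n : Z,
    exp (- (al * (IZR n + x0) ^ 2)) <= K * exp (- (be * Rabs (IZR n))).
Proof.
  intros Ha Hb. exists (exp (be ^ 2 / (4 * al)) * exp (be * B)). split.
  { left; apply Rmult_lt_0_compat; apply exp_pos. }
  intros x0 Hx n. eapply Rle_trans; [apply (gauss_dom al be _ Ha)|]. rewrite Rmult_assoc.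
  apply Rmult_le_compat_l; [left; apply exp_pos|]. rewrite <- exp_plus. apply exp_le.
  pose proof (Rabs_triang (IZR n + x0) (- x0)) as H.
  replace (IZR n + x0 + - x0) with (IZR n) in H by ring. rewrite Rabs_Ropp in H. nra.
Qed.

Lemma finite_bound (f : Z -> R) (N : nat) :
  exists B, forall n, (Z.abs n <= Z.of_nat N)%Z -> f n <= B.
Proof.
  induction N as [|N [B IH]].
  - exists (f 0%Z). intros n Hn. replace n with 0%Z by lia. lra.
  - exists (Rmax B (Rmax (f (Z.of_nat (S N))) (f (- Z.of_nat (S N))%Z))). intros n Hn.
    destruct (Z_le_gt_dec (Z.abs n) (Z.of_nat N)) as [H|H].
    + eapply Rle_trans; [apply IH, H|apply Rmax_l].
    + eapply Rle_trans; [|apply Rmax_r].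
      destruct (Z_le_gt_dec 0 n).
      * replace n with (Z.of_nat (S N)) by lia. apply Rmax_l.
      * replace n with (- Z.of_nat (S N))%Z by lia. apply Rmax_r.
Qed.

Lemma inv_shift_bound (x : C) : (forall n : Z, x + IZR n <> 0)%C ->
  exists B, 0 <= B /\ forall n : Z, / Cmod (x + IZR n) <= B.
Proof.
  intros Hx. destruct (INR_unbounded (Cmod x + 1)) as [N HN].
  destruct (finite_bound (fun n => / Cmod (x + IZR n)) N) as [B HB].
  exists (Rmax B 1). split; [pose proof (Rmax_r B 1); lra|]. intros n.
  destruct (Z_le_gt_dec (Z.abs n) (Z.of_nat N)) as [H|H].
  - eapply Rle_trans; [apply HB, H|apply Rmax_l].
  - eapply Rle_trans; [|apply Rmax_r]. rewrite <- Rinv_1. apply Rinv_le_contravar; [lra|].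
    assert (INR N <= Rabs (IZR n)).
    { rewrite INR_IZR_INZ, <- abs_IZR. apply IZR_le. lia. }
    assert (Ht := Cmod_triangle (x + IZR n) (- x)).
    replace (x + IZR n + - x)%C with (RtoC (IZR n)) in Ht by ring.
    rewrite Cmod_opp, Cmod_R in Ht. lra.
Qed.

Lemma sign_nonneg (n : Z) : (0 <= n)%Z -> sign (IZR n + 1 / 2) = 1.
Proof. intros H. apply sign_eq_1. apply IZR_le in H. lra. Qed.

Lemma sign_negative (n : Z) : (n < 0)%Z -> sign (IZR n + 1 / 2) = -1.
Proof.
  intros H. apply sign_eq_m1. assert (n <= -1)%Z as H' by lia. apply IZR_le in H'. lra.
Qed.

(** If sign (n + 1/2) differs from the sign of n + c, then |n + c| <= |c|; on this bounded range the
    trivial estimate, enlarged by D = exp (PI sg^2 c^2), is enough. Elsewhere E is close to the sign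
    up to a Gaussian error. *)
Lemma sign_E_bound (c sg : R) : 0 < sg ->
  exists K, 0 <= K /\ forall n : Z,
    Rabs (sign (IZR n + 1 / 2) - E ((IZR n + c) * sg)) <= K * exp (- (PI * sg ^ 2 * (IZR n + c) ^ 2)).
Proof.
  intros Hs. pose proof PI_RGT_0 as HPI.
  destruct (E_limit_bound 1 E_limit_1) as [K0 HK0].
  assert (Hp0 : 0 <= K0).
  { specialize (HK0 0 (Rle_refl 0)). replace (- PI * 0 ^ 2) with 0 in HK0 by ring. rewrite exp_0 in HK0.
    pose proof (Rabs_pos (E 0 - 1)); lra. }
  assert (HE : forall X, 0 <= X -> Rabs (E X - 1) <= K0).
  { intros X HX. specialize (HK0 X HX).
    assert (exp (- PI * X ^ 2) <= 1) by (apply exp_le_1; pose proof (pow2_ge_0 X); nra).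
    nra. }
  set (D := exp (PI * sg ^ 2 * c ^ 2)).
  assert (HD : 1 <= D).
  { unfold D. rewrite <- exp_0 at 1. apply exp_le. pose proof (pow2_ge_0 (sg * c)). nra. }
  assert (Main : forall X, (X < 0 -> X ^ 2 <= sg ^ 2 * c ^ 2) ->
     Rabs (1 - E X) <= (2 + K0) * D * exp (- (PI * X ^ 2))).
  { intros X HX. destruct (Rle_dec 0 X) as [H0|H0].
    - rewrite Rabs_minus_sym. eapply Rle_trans; [apply HK0, H0|].
      replace (- PI * X ^ 2) with (- (PI * X ^ 2)) by ring.
      apply Rmult_le_compat_r; [left; apply exp_pos|]. nra.
    - assert (Hb : Rabs (1 - E X) <= 2 + K0).
      { replace (1 - E X) with ((E (- X) - 1) + 2) by (rewrite E_odd; ring).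
        eapply Rle_trans; [apply Rabs_triang|]. rewrite (Rabs_pos_eq 2) by lra.
        specialize (HE (- X) ltac:(lra)). lra. }
      eapply Rle_trans; [exact Hb|]. rewrite Rmult_assoc. rewrite <- (Rmult_1_r (2 + K0)) at 1.
      apply Rmult_le_compat_l; [lra|]. unfold D. rewrite <- exp_plus, <- exp_0.
      apply exp_le. specialize (HX ltac:(lra)). nra. }
  exists ((2 + K0) * D). split; [nra|]. intros n.
  set (X := (IZR n + c) * sg).
  replace (PI * sg ^ 2 * (IZR n + c) ^ 2) with (PI * X ^ 2) by (unfold X; ring).
  destruct (Z_le_gt_dec 0 n) as [Hn|Hn].
  - rewrite sign_nonneg by exact Hn. apply Main. intros HX.
    apply IZR_le in Hn. assert (IZR n + c < 0) by (unfold X in HX; nra).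
    unfold X. rewrite Rpow_mult_distr, Rmult_comm. apply Rmult_le_compat_l; [apply pow2_ge_0|]. nra.
  - rewrite sign_negative by lia.
    replace (-1 - E X) with (- (1 - E (- X))) by (rewrite E_odd; ring). rewrite Rabs_Ropp.
    replace (PI * X ^ 2) with (PI * (- X) ^ 2) by ring. apply Main. intros HX.
    assert (IZR n <= 0) by (apply (IZR_le n 0); lia).
    assert (0 < IZR n + c) by (unfold X in HX; nra).
    replace ((- X) ^ 2) with (sg ^ 2 * (IZR n + c) ^ 2) by (unfold X; ring).
    apply Rmult_le_compat_l; [apply pow2_ge_0|]. nra.
Qed.

Open Scope C_scope.

Lemma exp_decay_of_exp (f : Z -> C) (K : R) :
  (forall n, Cmod (f n) <= K * exp (- (1 * Rabs (IZR n))))%R -> exp_decay f.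
Proof. intros H. exists K. intros n. unfold expn. rewrite <- (Rmult_1_l (Rabs _)). apply H. Qed.

Lemma ZSeries_single (f : Z -> C) : (forall n, n <> 0%Z -> f n = 0) -> ZSeries f = f 0%Z.
Proof.
  intros H. apply ZSeries_unique.
  - exists (Cmod (f 0%Z)). intros n. destruct (Z.eq_dec n 0) as [->|Hn].
    + unfold expn. rewrite Rabs_R0, Ropp_0, exp_0. lra.
    + rewrite H, Cmod_0 by exact Hn. apply Rmult_le_pos; [apply Cmod_ge_0|left; apply expn_pos].
  - assert (Hz : forall M, zsum f (S M) = f 0%Z).
    { induction M as [|M IH].
      - cbn [zsum]. rewrite (H (- Z.of_nat 1)%Z) by lia. simpl Z.of_nat. ring.
      - change (zsum f (S (S M))) with (zsum f (S M) + (f (Z.of_nat (S M)) + f (- Z.of_nat (S (S M)))%Z)).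
        rewrite IH, (H (Z.of_nat (S M))), (H (- Z.of_nat (S (S M)))%Z) by lia. ring. }
    exists (Cmod (f 0%Z)). intros [|M].
    + cbn [zsum]. replace (0 - f 0%Z) with (- f 0%Z) by ring.
      rewrite Cmod_opp. simpl. rewrite Ropp_0, exp_0. lra.
    + rewrite Hz. replace (f 0%Z - f 0%Z) with (RtoC 0) by ring. rewrite Cmod_0.
      apply Rmult_le_pos; [apply Cmod_ge_0|left; apply exp_pos].
Qed.

(** * Derivatives of complex functions of a real variable *)

Definition CDer (f : R -> C) (t : R) (d : C) : Prop :=
  is_derive (fun t => Re (f t)) t (Re d) /\ is_derive (fun t => Im (f t)) t (Im d).

Lemma CDer_ext f g t d : (forall t, f t = g t) -> CDer f t d -> CDer g t d.
Proof.
  intros H [H1 H2]; split; eapply is_derive_ext; try eassumption; intros; simpl; rewrite H; reflexivity.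
Qed.

Lemma CDer_const c t : CDer (fun _ => c) t 0.
Proof. split; apply (is_derive_const (K := R_AbsRing) (V := R_NormedModule)). Qed.

Lemma CDer_plus f g t df dg : CDer f t df -> CDer g t dg -> CDer (fun t => f t + g t) t (df + dg).
Proof.
  intros [H1 H2] [H3 H4]; split.
  - apply (is_derive_plus (K := R_AbsRing) (V := R_NormedModule) _ _ _ _ _ H1 H3).
  - apply (is_derive_plus (K := R_AbsRing) (V := R_NormedModule) _ _ _ _ _ H2 H4).
Qed.

Lemma CDer_scal c f t df : CDer f t df -> CDer (fun t => c * f t) t (c * df).
Proof.
  intros [H1 H2].
  assert (S1 := fun k => is_derive_scal _ t k _ H1). assert (S2 := fun k => is_derive_scal _ t k _ H2).
  split.
  - apply (is_derive_minus (K := R_AbsRing) (V := R_NormedModule) _ _ _ _ _ (S1 (Re c)) (S2 (Im c))).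
  - apply (is_derive_plus (K := R_AbsRing) (V := R_NormedModule) _ _ _ _ _ (S2 (Re c)) (S1 (Im c))).
Qed.

Lemma CDer_zsum (f : Z -> R -> C) (d : Z -> C) t M :
  (forall n, CDer (f n) t (d n)) -> CDer (fun t => zsum (fun n => f n t) M) t (zsum d M).
Proof.
  intros H. induction M as [|M IH]; cbn [zsum].
  - apply CDer_const.
  - apply CDer_plus; [exact IH|]. apply CDer_plus; apply H.
Qed.

Lemma CDer_RtoC (f : R -> R) t d : is_derive f t d -> CDer (fun t => RtoC (f t)) t (RtoC d).
Proof.
  intros H. split; [exact H|]. apply (is_derive_const (K := R_AbsRing) (V := R_NormedModule) 0%R).
Qed.

Lemma CDer_Cexp (a b : C) t : CDer (fun t => Cexp (a + RtoC t * b)) t (b * Cexp (a + RtoC t * b)).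
Proof.
  destruct a as [a1 a2], b as [b1 b2].
  apply (CDer_ext (fun t => (exp (a1 + t * b1) * cos (a2 + t * b2), exp (a1 + t * b1) * sin (a2 + t * b2))%R)).
  { intros u. unfold Cexp; simpl. do 2 f_equal; f_equal; ring. }
  unfold Cexp. split; simpl.
  all: replace (a1 + (t * b1 - 0 * b2))%R with (a1 + t * b1)%R by ring.
  all: replace (a2 + (t * b2 + 0 * b1))%R with (a2 + t * b2)%R by ring.
  all: auto_derive; [auto|ring].
Qed.

(** Real and imaginary parts are estimated separately, whence the factor 2. *)
Lemma CDer_MVT (f df : R -> C) a b B : (a <= b)%R ->
  (forall t, (a <= t <= b)%R -> CDer f t (df t)) ->
  (forall t, (a <= t <= b)%R -> (Cmod (df t) <= B)%R) ->
  (Cmod (f b - f a) <= 2 * B * (b - a))%R.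
Proof.
  intros Hab Hd HB.
  eapply Rle_trans; [apply Cmod_le_Re_Im|].
  unfold Cminus. rewrite Re_plus, Im_plus, Re_opp, Im_opp.
  assert (H1 := MVT_abs (fun t => Re (f t)) (fun t => Re (df t)) a b B Hab
    (fun t Ht => proj1 (Hd t Ht)) (fun t Ht => Rle_trans _ _ _ (re_le_Cmod _) (HB t Ht))).
  assert (H2 := MVT_abs (fun t => Im (f t)) (fun t => Im (df t)) a b B Hab
    (fun t Ht => proj2 (Hd t Ht)) (fun t Ht => Rle_trans _ _ _ (im_le_Cmod _) (HB t Ht))).
  simpl in H1, H2. unfold Rminus in *. lra.
Qed.

Lemma Cmod_wave (x : C) (r : Z) :
  (Cmod (Cexp (- (2 * PI * Ci * IZR r * x))) <= exp (2 * PI * Rabs (Im x) * Rabs (IZR r)))%R.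
Proof.
  rewrite Cmod_Cexp. apply exp_le.
  replace (Re (- (2 * PI * Ci * IZR r * x))) with (2 * PI * (IZR r * Im x))%R
    by (destruct x; simpl; ring).
  rewrite (Rmult_assoc (2 * PI)). apply Rmult_le_compat_l; [pose proof PI_RGT_0; lra|].
  eapply Rle_trans; [apply Rle_abs|]. rewrite Rabs_mult. lra.
Qed.

(** Uniformity in t is needed because the derivative in c is bounded over all of [c, c + 1]. *)
Lemma theta_freq_dom (sg B : R) (x : C) : (0 < sg)%R ->
  exists K, forall t, (Rabs t <= B)%R -> forall n, (Cmod (theta_freq sg t x n) <= K * expn n)%R.
Proof.
  intros Hs. pose proof PI_RGT_0 as HPI.
  (* The surplus 2 PI |Im x| in the rate cancels the growth of the wave. *)
  destruct (gauss_lin_dom (PI * sg ^ 2) (1 + 2 * PI * Rabs (Im x)) B) as [K [HK0 HK]].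
  { apply Rmult_lt_0_compat; [lra|apply pow_lt; lra]. }
  { pose proof (Rabs_pos (Im x)). nra. }
  exists (sg * K)%R. intros t Ht n. unfold theta_freq. rewrite Cmod_mult, Cmod_R, Rabs_mult.
  rewrite (Rabs_pos_eq sg), (Rabs_pos_eq (exp _)), !Rmult_assoc by (try (left; apply exp_pos); lra).
  apply Rmult_le_compat_l; [lra|].
  apply Rle_trans with (K * exp (- ((1 + 2 * PI * Rabs (Im x)) * Rabs (IZR n))) * exp (2 * PI * Rabs (Im x) * Rabs (IZR n)))%R.
  - apply Rmult_le_compat; [left; apply exp_pos|apply Cmod_ge_0| |].
    + eapply Rle_trans; [|apply (HK t Ht n)]. right. f_equal. ring.
    + apply Cmod_wave.
  - rewrite Rmult_assoc, <- exp_plus. unfold expn. right. do 2 f_equal. ring.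
Qed.

Lemma theta_pos_dom (sg B : R) (x : C) : (0 < sg)%R ->
  exists K, (0 <= K)%R /\ forall t, (Rabs t <= B)%R -> forall n, (Cmod (theta_pos sg t x n) <= K * expn n)%R.
Proof.
  intros Hs. pose proof PI_RGT_0 as HPI.
  destruct (gauss_lin_dom (PI / sg ^ 2) 1 (Rabs (Re x))) as [K [HK0 HK]].
  { apply Rdiv_lt_0_compat; [lra|apply pow_lt; lra]. }
  { lra. }
  exists (exp (2 * PI * B * Rabs (Im x) + PI / sg ^ 2 * Im x ^ 2) * K)%R. split.
  { apply Rmult_le_pos; [left; apply exp_pos|exact HK0]. }
  intros t Ht n. unfold theta_pos. rewrite Cmod_Cexp.
  specialize (HK (Re x) (Rle_refl _) n). rewrite Rmult_1_l in HK. fold (expn n) in HK.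
  rewrite Rmult_assoc.
  apply Rle_trans with (exp (2 * PI * B * Rabs (Im x) + PI / sg ^ 2 * Im x ^ 2) * exp (- (PI / sg ^ 2 * (IZR n + Re x) ^ 2)))%R.
  - rewrite <- exp_plus. apply exp_le.
    match goal with |- (Re ?z <= _)%R => replace (Re z) with
      (- (2 * PI * (t * Im x)) + PI / sg ^ 2 * Im x ^ 2 + - (PI / sg ^ 2 * (IZR n + Re x) ^ 2))%R end.
    2:{ destruct x; simpl; ring. }
    assert (- (t * Im x) <= B * Rabs (Im x))%R.
    { eapply Rle_trans; [apply Rle_abs|]. rewrite Rabs_Ropp, Rabs_mult.
      apply Rmult_le_compat_r; [apply Rabs_pos|exact Ht]. }
    assert (2 * PI * - (t * Im x) <= 2 * PI * (B * Rabs (Im x)))%R by (apply Rmult_le_compat_l; lra).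
    lra.
  - apply Rmult_le_compat_l; [left; apply exp_pos|exact HK].
Qed.

Definition sign_E_term (sg c : R) (x : C) (r : Z) : C :=
  RtoC (sign (IZR r + 1 / 2) - E ((IZR r + c) * sg)) * Cexp (- (2 * PI * Ci * IZR r * x)).

Lemma sign_E_dom (sg c be : R) (x : C) : (0 < sg)%R -> (0 <= be)%R ->
  exists K, (0 <= K)%R /\ forall n, (Cmod (sign_E_term sg c x n) <= K * exp (- (be * Rabs (IZR n))))%R.
Proof.
  intros Hs Hbe. pose proof PI_RGT_0 as HPI.
  destruct (sign_E_bound c sg Hs) as [K1 [HK1 H1]].
  destruct (gauss_lin_dom (PI * sg ^ 2) (be + 2 * PI * Rabs (Im x)) (Rabs c)) as [K [HK0 HK]].
  { apply Rmult_lt_0_compat; [lra|apply pow_lt; lra]. }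
  { pose proof (Rabs_pos (Im x)). nra. }
  exists (K1 * K)%R. split; [nra|]. intros n. unfold sign_E_term. rewrite Cmod_mult, Cmod_R.
  apply Rle_trans with (K1 * (K * exp (- ((be + 2 * PI * Rabs (Im x)) * Rabs (IZR n)))) * exp (2 * PI * Rabs (Im x) * Rabs (IZR n)))%R.
  - apply Rmult_le_compat; [apply Rabs_pos|apply Cmod_ge_0| |apply Cmod_wave].
    eapply Rle_trans; [apply H1|]. apply Rmult_le_compat_l; [exact HK1|]. apply (HK c (Rle_refl _)).
  - rewrite !Rmult_assoc, <- exp_plus. right. do 3 f_equal. ring.
Qed.

Lemma sign_E_exp_decay (sg c : R) (x : C) : (0 < sg)%R -> exp_decay (sign_E_term sg c x).
Proof. intros Hs. destruct (sign_E_dom sg c 1 x Hs) as [K [_ HK]]; [lra|]. exact (exp_decay_of_exp _ K HK). Qed.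

Lemma theta_pos_div_exp_decay (sg c : R) (x : C) : (0 < sg)%R -> (forall n : Z, x + IZR n <> 0) ->
  exp_decay (fun n => theta_pos sg c x n / (x + IZR n)).
Proof.
  intros Hs Hx. destruct (theta_pos_dom sg (Rabs c) x Hs) as [K [HK0 HK]].
  destruct (inv_shift_bound x Hx) as [B [HB0 HB]].
  exists (K * B)%R. intros n. rewrite Cmod_div by apply Hx. unfold Rdiv.
  apply Rle_trans with (K * expn n * B)%R; [|right; ring].
  apply Rmult_le_compat; [apply Cmod_ge_0| |apply HK; lra|apply HB].
  left; apply Rinv_0_lt_compat, Cmod_gt_0, Hx.
Qed.

Lemma Cexp_period_neq (x : C) : Cexp (2 * PI * Ci * x) <> 1 -> forall n : Z, x + IZR n <> 0.
Proof.
  intros H n E0. apply H.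
  replace (2 * PI * Ci * x) with (2 * PI * Ci * (x + IZR n) + 2 * PI * Ci * IZR (- n)).
  - rewrite E0, Cexp_period, Cmult_0_r. apply Cexp_0.
  - rewrite opp_IZR, RtoC_opp. ring.
Qed.

(* Both sides H satisfy H(c+1) = X H(c) with X = exp(2 pi i x), so for X <> 1 they agree as soon as
   their increments from c to c+1 do; differentiating in c, this is theta inversion. *)
Lemma appell_kernel (sg c : R) (x : C) : (0 < sg)%R -> Cexp (2 * PI * Ci * x) <> 1 ->
  / (1 - Cexp (2 * PI * Ci * x)) - 1 + / 2 * ZSeries (sign_E_term sg c x)
  = Ci / (2 * PI) * ZSeries (fun n => theta_pos sg c x n / (x + IZR n)).
Proof.
  intros Hs HX. pose proof (Cexp_period_neq x HX) as Hxn.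
  set (X := Cexp (2 * PI * Ci * x)) in *.
  assert (HX1 : X - 1 <> 0) by (intros H0; apply HX, Ceq_minus, H0).
  assert (HPI : RtoC PI <> 0) by (intros H0; apply RtoC_inj in H0; pose proof PI_RGT_0; lra).
  set (w := fun r : Z => Cexp (- (2 * PI * Ci * IZR r * x))).
  assert (Hw : forall r, X * w (r + 1)%Z = w r).
  { intros r. unfold X, w. rewrite <- Cexp_plus, plus_IZR, RtoC_plus. f_equal. ring. }
  assert (Gc := sign_E_exp_decay sg c x Hs). assert (Gc1 := sign_E_exp_decay sg (c + 1) x Hs).
  assert (Tc := theta_pos_div_exp_decay sg c x Hs Hxn). assert (Tc1 := theta_pos_div_exp_decay sg (c + 1) x Hs Hxn).
  set (A := ZSeries (sign_E_term sg c x)).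
  set (A1 := ZSeries (sign_E_term sg (c + 1) x)).
  set (F := ZSeries (fun n => theta_pos sg c x n / (x + IZR n))).
  set (F1 := ZSeries (fun n => theta_pos sg (c + 1) x n / (x + IZR n))).
  (* Replacing r by r + 1 turns c into c + 1, except that the sign jumps by 2 at r = -1, where the
     wave equals X. *)
  assert (EA : X * A = A1 + 2 * X).
  { unfold A. rewrite <- (ZSeries_succ (sign_E_term sg c x) Gc), <- ZSeries_scal by (apply exp_decay_shift, Gc).
    pose (jump := fun r : Z => RtoC (sign (IZR (r + 1) + 1 / 2) - sign (IZR r + 1 / 2)) * w r).
    assert (J0 : forall r, r <> (-1)%Z -> jump r = 0).
    { intros r Hr. unfold jump. destruct (Z_le_gt_dec 0 r).
      - rewrite !sign_nonneg by lia. replace (1 - 1)%R with 0%R by ring. ring.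
      - rewrite !sign_negative by lia. replace (-1 - -1)%R with 0%R by ring. ring. }
    assert (J1 : jump (-1)%Z = 2 * X).
    { unfold jump. rewrite sign_nonneg, sign_negative by lia.
      replace (1 - -1)%R with 2%R by ring. f_equal. unfold w, X. f_equal. ring. }
    assert (Gj : exp_decay (fun n => jump (n + -1)%Z)).
    { exists (Cmod (2 * X)). intros n. destruct (Z.eq_dec n 0) as [->|Hn].
      - simpl Z.add. rewrite J1. unfold expn. rewrite Rabs_R0, Ropp_0, exp_0. lra.
      - rewrite J0, Cmod_0 by lia. apply Rmult_le_pos; [apply Cmod_ge_0|left; apply expn_pos]. }
    assert (Gj' : exp_decay jump).
    { apply exp_decay_ext with (fun n => jump (n + 1 + -1)%Z); [intros; f_equal; lia|].
      apply (exp_decay_shift 1 (fun n => jump (n + -1)%Z)), Gj. }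
    rewrite (ZSeries_ext _ (fun r => sign_E_term sg (c + 1) x r + jump r)).
    - rewrite ZSeries_plus by assumption. f_equal.
      rewrite <- (ZSeries_shift (-1) jump Gj'), ZSeries_single; [exact J1|]. intros n Hn. apply J0. lia.
    - intros r. unfold sign_E_term, jump. fold (w r). fold (w (r + 1)%Z). rewrite <- (Hw r), plus_IZR.
      replace (IZR r + 1 + c)%R with (IZR r + (c + 1))%R by ring.
      rewrite !RtoC_minus. ring. }
  assert (EF : X * F = F1).
  { unfold F, F1. rewrite <- ZSeries_scal by exact Tc. apply ZSeries_ext. intros n.
    replace (theta_pos sg (c + 1) x n) with (X * theta_pos sg c x n); [field; apply Hxn|].
    unfold X, theta_pos. rewrite <- (Cexp_period _ n), <- Cexp_plus. f_equal. rewrite RtoC_plus. ring. }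
  assert (Inc : / 2 * (A - A1) + Ci / (2 * PI) * (F1 - F) = 0).
  { assert (Rc : (forall t, c <= t <= c + 1 -> Rabs t <= Rabs c + 1)%R).
    { intros t Ht. replace t with (c + (t - c))%R by ring.
      eapply Rle_trans; [apply Rabs_triang|]. rewrite (Rabs_pos_eq (t - c)); lra. }
    destruct (theta_freq_dom sg (Rabs c + 1) x Hs) as [K1 H1].
    destruct (theta_pos_dom sg (Rabs c + 1) x Hs) as [K2 [_ H2]].
    (* Up to sign, the n-th summand of the part of left side minus right side that depends on c; its
       derivative is [theta_freq] - [theta_pos]. *)
    pose (f := fun n t => / 2 * w n * RtoC (E ((IZR n + t) * sg))
       + Ci / (2 * PI) / (x + IZR n) * theta_pos sg t x n).
    assert (Df : forall n t, CDer (f n) t (theta_freq sg t x n - theta_pos sg t x n)).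
    { intros n t. unfold f.
      replace (theta_freq sg t x n - theta_pos sg t x n) with
        (/ 2 * w n * RtoC (sg * (2 * exp (- PI * ((IZR n + t) * sg) ^ 2)))
         + Ci / (2 * PI) / (x + IZR n) * (2 * PI * Ci * (x + IZR n) * theta_pos sg t x n)).
      - apply CDer_plus; apply CDer_scal.
        + apply (CDer_RtoC (fun t => E ((IZR n + t) * sg))).
          apply (is_derive_comp (K := R_AbsRing) (V := R_NormedModule) E (fun t => (IZR n + t) * sg)%R); [apply E_derive|].
          auto_derive; [auto|simpl; ring].
        + unfold theta_pos.
          apply (CDer_ext (fun t => Cexp (- (RtoC (PI / sg ^ 2) * ((x + IZR n) * (x + IZR n))) + RtoC t * (2 * PI * Ci * (x + IZR n))))).
          { intros; f_equal; ring. }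
          replace (2 * PI * Ci * t * (x + IZR n) - RtoC (PI / sg ^ 2) * ((x + IZR n) * (x + IZR n)))
            with (- (RtoC (PI / sg ^ 2) * ((x + IZR n) * (x + IZR n))) + RtoC t * (2 * PI * Ci * (x + IZR n))) by ring.
          apply CDer_Cexp.
      - unfold theta_freq. fold (w n).
        replace (- PI * ((IZR n + t) * sg) ^ 2)%R with (- (PI * ((IZR n + t) * sg) ^ 2))%R by ring.
        rewrite !RtoC_mult.
        replace (Ci / (2 * PI) / (x + IZR n) * (2 * PI * Ci * (x + IZR n) * theta_pos sg t x n))
          with (Ci * Ci * theta_pos sg t x n) by (field; split; first [exact HPI|apply Hxn]).
        replace (Ci * Ci) with (- (1)) by (apply C_ext; simpl; ring). field. }
    (* By theta inversion both partial sums have the same limit, so their difference is as small as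
       the two tails. *)
    assert (Bd : forall M t, (c <= t <= c + 1)%R ->
       (Cmod (zsum (fun n => theta_freq sg t x n - theta_pos sg t x n)%C M) <= (8 * K1 + 8 * K2) * exp (- INR M))%R).
    { intros M t Ht. specialize (H1 t (Rc t Ht)). specialize (H2 t (Rc t Ht)).
      rewrite (zsum_ext _ (fun n => theta_freq sg t x n + (- (1)) * theta_pos sg t x n)) by (intros; ring).
      rewrite zsum_plus, zsum_scal.
      assert (D1 := ZSeries_dom _ _ H1 M). assert (D2 := ZSeries_dom _ _ H2 M).
      rewrite (theta_inversion sg t x Hs) in D1.
      set (Z0 := ZSeries (theta_pos sg t x)) in *.
      replace (_ + _) with ((zsum (theta_freq sg t x) M - Z0) - (zsum (theta_pos sg t x) M - Z0)) by ring.
      rewrite Rmult_plus_distr_r.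
      eapply Rle_trans; [apply Cmod_triangle|]. rewrite Cmod_opp. lra. }
    assert (Inc1 : forall M, (Cmod (zsum (fun n => f n (c + 1)%R - f n c)%C M) <= 2 * (8 * K1 + 8 * K2) * exp (- INR M))%R).
    { intros M.
      rewrite (zsum_ext _ (fun n => f n (c + 1)%R + (- (1)) * f n c)) by (intros; ring).
      rewrite zsum_plus, zsum_scal.
      replace (_ + _) with (zsum (fun n => f n (c + 1)%R) M - zsum (fun n => f n c) M) by ring.
      eapply Rle_trans.
      - apply (CDer_MVT (fun t => zsum (fun n => f n t) M)
          (fun t => zsum (fun n => theta_freq sg t x n - theta_pos sg t x n) M) c (c + 1)%R
          ((8 * K1 + 8 * K2) * exp (- INR M))%R); [lra| |apply Bd].
        intros t _. apply CDer_zsum. intros n. apply Df.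
      - right; ring. }
    assert (Hf : forall n, f n (c + 1)%R - f n c = / 2 * (sign_E_term sg c x n - sign_E_term sg (c + 1) x n)
       + Ci / (2 * PI) * (theta_pos sg (c + 1) x n / (x + IZR n) - theta_pos sg c x n / (x + IZR n))).
    { intros n. unfold f, sign_E_term. fold (w n). rewrite !RtoC_minus. field. split; first [exact HPI|apply Hxn]. }
    assert (Gd : forall g h, exp_decay g -> exp_decay h -> exp_decay (fun n => g n - h n)).
    { intros g h Hg Hh. apply exp_decay_ext with (fun n => g n + (- (1)) * h n); [intros; ring|].
      apply exp_decay_plus; [exact Hg|apply exp_decay_scal, Hh]. }
    apply (is_zsum_unique (fun n => f n (c + 1)%R - f n c)).
    - unfold A, A1, F, F1. rewrite <- (ZSeries_minus _ _ Gc Gc1), <- (ZSeries_minus _ _ Tc1 Tc).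
      rewrite <- !ZSeries_scal by (apply Gd; assumption).
      rewrite <- ZSeries_plus by (apply exp_decay_scal, Gd; assumption).
      rewrite <- (ZSeries_ext _ _ Hf). apply ZSeries_correct.
      apply (exp_decay_ext _ _ (fun n => eq_sym (Hf n))).
      apply exp_decay_plus; apply exp_decay_scal, Gd; assumption.
    - exists (2 * (8 * K1 + 8 * K2))%R. intros M.
      replace (_ - 0) with (zsum (fun n => f n (c + 1)%R - f n c) M) by ring. apply Inc1. }
  assert (EA1 : A1 = X * A - 2 * X) by (rewrite EA; ring).
  rewrite EA1, <- EF in Inc.
  (* Division by X - 1 leaves -A/2 + X/(X - 1) + i/(2 PI) F = 0, which is the claim since X/(1 - X)
     = 1/(1 - X) - 1. *)
  apply (f_equal (fun z => z / (X - 1))) in Inc.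
  assert (HX2 : 1 - X <> 0) by (intros H0; apply HX1; replace (X - 1) with (- (1 - X)) by ring; rewrite H0; ring).
  apply Ceq_minus. transitivity (- (0 / (X - 1))); [|field; exact HX1].
  rewrite <- Inc. field. auto.
Qed.

(** * The lattice sum *)

Open Scope C_scope.

Definition lat_pt (tau u v : C) (j n : Z) : C := v - u + IZR j * tau + IZR n.

(* The exponent obtained from [theta_pos] by taking x = v - u + j tau, sg = sqrt (Im tau / k),
   c = 2 k Im v / Im tau and multiplying by the j-th Gaussian factor of phi. *)
Definition lat_exp (k : nat) (tau u v : C) (j n : Z) : C :=
  2 * PI * Ci * INR k * (IZR j * IZR j * tau) - 4 * PI * Ci * INR k * (IZR j * u)
  + 4 * PI * Ci * INR k * (Im v / Im tau)%R * lat_pt tau u v j n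
  - (PI * INR k / Im tau)%R * (lat_pt tau u v j n * lat_pt tau u v j n).

Definition lat_term (k : nat) (tau u v : C) (j n : Z) : C :=
  Cexp (lat_exp k tau u v j n) / lat_pt tau u v j n.

Definition lat_sum (k : nat) (tau u v : C) : C :=
  ZSeries (fun j => ZSeries (lat_term k tau u v j)).

Definition lat_free (tau u v : C) : Prop := forall j n : Z, lat_pt tau u v j n <> 0.

(** Rows with |j| large lie at distance at least 1 from the real axis; the finitely many others are
    handled one by one. *)
Lemma inv_lattice_bound (tau w : C) : (0 < Im tau)%R ->
  (forall j n : Z, w + IZR j * tau + IZR n <> 0) ->
  exists B, (0 <= B)%R /\ forall j n : Z, (/ Cmod (w + IZR j * tau + IZR n) <= B)%R.
Proof.
  intros Hy H.
  assert (Fin : forall N : nat, exists B, forall j n : Z, (Z.abs j <= Z.of_nat N)%Z ->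
     (/ Cmod (w + IZR j * tau + IZR n) <= B)%R).
  { induction N as [|N [B IH]].
    - destruct (inv_shift_bound (w + IZR 0 * tau) (H 0%Z)) as [B [_ HB]]. exists B. intros j n Hj.
      replace j with 0%Z by lia. apply HB.
    - destruct (inv_shift_bound (w + IZR (Z.of_nat (S N)) * tau) (H _)) as [B1 [_ H1]].
      destruct (inv_shift_bound (w + IZR (- Z.of_nat (S N)) * tau) (H _)) as [B2 [_ H2]].
      exists (Rmax B (Rmax B1 B2)). intros j n Hj.
      destruct (Z_le_gt_dec (Z.abs j) (Z.of_nat N)) as [Hl|Hl].
      + eapply Rle_trans; [apply IH, Hl|apply Rmax_l].
      + eapply Rle_trans; [|apply Rmax_r]. destruct (Z_le_gt_dec 0 j).
        * replace j with (Z.of_nat (S N)) by lia. eapply Rle_trans; [apply H1|apply Rmax_l].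
        * replace j with (- Z.of_nat (S N))%Z by lia. eapply Rle_trans; [apply H2|apply Rmax_r]. }
  destruct (INR_unbounded ((Rabs (Im w) + 1) / Im tau)) as [N HN].
  destruct (Fin N) as [B HB].
  exists (Rmax B 1). split; [pose proof (Rmax_r B 1); lra|]. intros j n.
  destruct (Z_le_gt_dec (Z.abs j) (Z.of_nat N)) as [Hj|Hj].
  - eapply Rle_trans; [apply HB, Hj|apply Rmax_l].
  - eapply Rle_trans; [|apply Rmax_r]. rewrite <- Rinv_1. apply Rinv_le_contravar; [lra|].
    eapply Rle_trans; [|apply im_le_Cmod].
    replace (Im (w + IZR j * tau + IZR n)) with (Im w + IZR j * Im tau)%R
      by (destruct w, tau; simpl; ring).
    assert (Hj' : (INR N <= Rabs (IZR j))%R).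
    { rewrite INR_IZR_INZ, <- abs_IZR. apply IZR_le. lia. }
    assert (Ht := Rabs_triang (Im w + IZR j * Im tau) (- Im w)).
    replace (Im w + IZR j * Im tau + - Im w)%R with (IZR j * Im tau)%R in Ht by ring.
    rewrite Rabs_Ropp, Rabs_mult, (Rabs_pos_eq (Im tau)) in Ht by lra.
    apply (Rmult_lt_compat_r (Im tau)) in HN; [|exact Hy].
    unfold Rdiv in HN. rewrite Rmult_assoc, Rinv_l, Rmult_1_r in HN by lra.
    assert (INR N * Im tau <= Rabs (IZR j) * Im tau)%R by (apply Rmult_le_compat_r; lra). lra.
Qed.

(** Write y = Im tau. In the real part of the exponent, -2 PI k y j^2 from the weight is only half
    compensated by the +PI k y j^2 hidden in -PI k z^2 / y. Besides linear and constant terms, what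
    remains is negative definite in j and n + j Re tau + Re w. *)
Lemma lat_term_exp_decay2 k tau u v : (0 < k)%nat -> (0 < Im tau)%R -> lat_free tau u v ->
  exp_decay2 (lat_term k tau u v).
Proof.
  intros Hk Hy Hf. pose proof PI_RGT_0 as HPI. assert (Hkr := lt_0_INR k Hk).
  destruct (inv_lattice_bound tau (v - u) Hy Hf) as [B [HB0 HB]].
  set (a := (Im v / Im tau)%R). set (w := v - u).
  set (l := (PI * INR k * (4 * Im u - 4 * a * Im tau + 2 * Im w))%R).
  set (c0 := (PI * INR k * (Im w ^ 2 / Im tau - 4 * a * Im w))%R).
  assert (Hal : (0 < PI * INR k)%R) by nra.
  assert (Hal2 : (0 < PI * INR k / Im tau)%R) by (apply Rdiv_lt_0_compat; lra).
  assert (Hexp : forall j n, Re (lat_exp k tau u v j n)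
     = (c0 + l * IZR j + - (PI * INR k * Im tau * IZR j ^ 2) + - (PI * INR k / Im tau * (IZR n + (IZR j * Re tau + Re w)) ^ 2))%R).
  { intros j n. unfold c0, l, a, w, lat_exp, lat_pt. destruct tau as [t1 y], u as [u1 u2], v as [v1 v2].
    cbn [Im Re fst snd] in *. simpl. field. lra. }
  set (D := exp (1 ^ 2 / (4 * (PI * INR k / Im tau)))).
  (* This rate pays for the linear term l j, for the shift j Re tau in the second Gaussian, and for
     [expn j]. *)
  set (be := (1 + Rabs (Re tau) + Rabs l)%R).
  set (D2 := exp (be ^ 2 / (4 * (PI * INR k * Im tau)))).
  exists (exp c0 * D2 * D * exp (Rabs (Re w)) * B)%R. intros j n.
  unfold lat_term. rewrite Cmod_div, Cmod_Cexp by apply Hf. unfold Rdiv at 1.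
  apply Rle_trans with (exp (Re (lat_exp k tau u v j n)) * B)%R.
  { apply Rmult_le_compat_l; [left; apply exp_pos|apply HB]. }
  rewrite Hexp, !exp_plus.
  assert (G1 := gauss_dom (PI * INR k / Im tau) 1 (IZR n + (IZR j * Re tau + Re w)) Hal2). fold D in G1.
  assert (G2 := gauss_dom (PI * INR k * Im tau) be (IZR j) ltac:(nra)). fold D2 in G2.
  assert (G3 : (exp (l * IZR j) <= exp (Rabs l * Rabs (IZR j)))%R).
  { apply exp_le. rewrite <- Rabs_mult. apply Rle_abs. }
  assert (G4 : (exp (- (1 * Rabs (IZR n + (IZR j * Re tau + Re w))))
     <= exp (Rabs (Re w)) * exp (Rabs (Re tau) * Rabs (IZR j)) * expn n)%R).
  { unfold expn. rewrite <- !exp_plus. apply exp_le.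
    assert (Ht := Rabs_triang (IZR n + (IZR j * Re tau + Re w)) (- (IZR j * Re tau + Re w))).
    assert (Ht2 := Rabs_triang (IZR j * Re tau) (Re w)).
    replace (IZR n + (IZR j * Re tau + Re w) + - (IZR j * Re tau + Re w))%R with (IZR n) in Ht by ring.
    rewrite Rabs_Ropp in Ht. rewrite Rabs_mult in Ht2. lra. }
  apply Rle_trans with (exp c0 * exp (Rabs l * Rabs (IZR j)) * (D2 * exp (- (be * Rabs (IZR j))))
     * (D * (exp (Rabs (Re w)) * exp (Rabs (Re tau) * Rabs (IZR j)) * expn n)) * B)%R.
  - apply Rmult_le_compat_r; [exact HB0|].
    apply Rmult_le_compat; [|left; apply exp_pos| |].
    + left. repeat apply Rmult_lt_0_compat; apply exp_pos.
    + apply Rmult_le_compat; [|left; apply exp_pos| |exact G2].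
      * left. repeat apply Rmult_lt_0_compat; apply exp_pos.
      * apply Rmult_le_compat_l; [left; apply exp_pos|exact G3].
    + eapply Rle_trans; [exact G1|]. apply Rmult_le_compat_l; [left; apply exp_pos|exact G4].
  - assert (Ej : expn j = (exp (Rabs l * Rabs (IZR j)) * exp (- (be * Rabs (IZR j))) * exp (Rabs (Re tau) * Rabs (IZR j)))%R).
    { unfold expn, be. rewrite <- !exp_plus. f_equal. ring. }
    rewrite Ej. right. ring.
Qed.

Definition lat_weight (k : nat) (tau u : C) (j : Z) : C :=
  Cexp (2 * PI * Ci * INR k * (IZR j * IZR j * tau) - 4 * PI * Ci * INR k * (IZR j * u)).

Lemma lat_row k tau u v j : (0 < k)%nat -> (0 < Im tau)%R ->
  Cexp (2 * PI * Ci * (v - u + IZR j * tau)) <> 1 ->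
  lat_weight k tau u j * (/ (1 - Cexp (2 * PI * Ci * (v - u + IZR j * tau))) - 1
    + / 2 * ZSeries (sign_E_term (sqrt (Im tau / INR k)) (2 * INR k * (Im v / Im tau)) (v - u + IZR j * tau)))
  = Ci / (2 * PI) * ZSeries (lat_term k tau u v j).
Proof.
  intros Hk Hy HX. assert (Hkr := lt_0_INR k Hk).
  assert (Hq : (0 < Im tau / INR k)%R) by (apply Rdiv_lt_0_compat; assumption).
  assert (Hs := sqrt_lt_R0 _ Hq).
  rewrite appell_kernel by assumption.
  assert (G := theta_pos_div_exp_decay (sqrt (Im tau / INR k)) (2 * INR k * (Im v / Im tau))
    (v - u + IZR j * tau) Hs (Cexp_period_neq _ HX)).
  rewrite (ZSeries_ext (lat_term k tau u v j) (fun n => lat_weight k tau u j *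
    (theta_pos (sqrt (Im tau / INR k)) (2 * INR k * (Im v / Im tau)) (v - u + IZR j * tau) n / (v - u + IZR j * tau + IZR n)))).
  - rewrite ZSeries_scal by exact G. ring.
  - intros n. unfold lat_term, Cdiv. fold (lat_pt tau u v j n). rewrite Cmult_assoc. f_equal.
    unfold lat_weight, theta_pos. rewrite <- Cexp_plus. f_equal.
    rewrite pow2_sqrt by lra. unfold lat_exp. fold (lat_pt tau u v j n).
    replace (PI / (Im tau / INR k))%R with (PI * INR k / Im tau)%R by (field; lra).
    rewrite !(RtoC_mult _ (Im v / Im tau)), !(RtoC_mult 2). ring.
Qed.

(** * Products of R and Theta *)

Definition R_term (k : nat) (tau v : C) (r : Z) : C :=
  RtoC (sign (IZR r + 1 / 2) - E ((IZR r + 2 * INR k * (Im v / Im tau)) * sqrt (Im tau / INR k)))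
  * Cexp (- (PI * Ci * IZR r ^ 2 / (2 * INR k)) * tau - 2 * PI * Ci * IZR r * v).

Definition Theta_term (k : nat) (tau u : C) (s : Z) : C :=
  Cexp (PI * Ci * IZR s ^ 2 / (2 * INR k) * tau + 2 * PI * Ci * IZR s * u).

Lemma Rfun_R_term k j tau v :
  Rfun k j tau v = ZSeries (fun N => R_term k tau v (j + 2 * Z.of_nat k * N)).
Proof. reflexivity. Qed.

(** With s = 2kn the sum over n in Z + j/(2k) runs over the integers s = j modulo 2k, the same
    indexing as in [Rfun]. *)
Lemma Theta_Theta_term k j tau u : (0 < k)%nat ->
  Theta j k tau (2 * u) = ZSeries (fun N => Theta_term k tau u (j + 2 * Z.of_nat k * N)).
Proof.
  intros Hk. assert (Hkr := lt_0_INR k Hk).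
  unfold Theta. apply ZSeries_ext. intros N. unfold qpow, e2pi, Theta_term. rewrite <- Cexp_plus. f_equal.
  rewrite plus_IZR, mult_IZR, mult_IZR, <- INR_IZR_INZ.
  assert (HkC : RtoC (INR k) <> 0) by (intros H0; apply RtoC_inj in H0; lra).
  replace (IZR N + IZR j / (2 * INR k))%R with ((IZR j + 2 * INR k * IZR N) * / (2 * INR k))%R by (field; lra).
  set (s := (IZR j + 2 * INR k * IZR N)%R).
  rewrite !RtoC_mult, RtoC_pow, RtoC_mult, RtoC_inv, RtoC_mult by lra. field. exact HkC.
Qed.

(** The reflection s -> -s trades -j for -u, so antisymmetrisation in j becomes antisymmetrisation
    in u. *)
Lemma Theta_opp k j tau u : (0 < k)%nat -> exp_decay (fun N => Theta_term k tau (- u) (j + 2 * Z.of_nat k * N)) ->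
  Theta (- j) k tau (2 * u) = Theta j k tau (2 * - u).
Proof.
  intros Hk G. rewrite !Theta_Theta_term by exact Hk.
  rewrite <- (ZSeries_flip _ G). apply ZSeries_ext. intros N. unfold Theta_term. f_equal.
  replace (j + 2 * Z.of_nat k * - N)%Z with (- (- j + 2 * Z.of_nat k * N))%Z by ring.
  rewrite opp_IZR, RtoC_opp. unfold Cdiv. ring.
Qed.

(** With s = r - 2kj one has (s^2 - r^2)/(2k) = 2k j^2 - 2jr: the squares of r cancel, leaving the
    weight of row j and a wave linear in r at x = v - u + j tau. *)
Lemma R_Theta_term k tau u v r j : (0 < k)%nat ->
  R_term k tau v r * Theta_term k tau u (r - 2 * Z.of_nat k * j)
  = lat_weight k tau u j * sign_E_term (sqrt (Im tau / INR k)) (2 * INR k * (Im v / Im tau)) (v - u + IZR j * tau) r.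
Proof.
  intros Hk. assert (Hkr := lt_0_INR k Hk).
  assert (HkC : RtoC (INR k) <> 0) by (intros H0; apply RtoC_inj in H0; lra).
  unfold R_term, Theta_term, lat_weight, sign_E_term.
  rewrite (Cmult_comm (Cexp _) (_ * _)), <- !Cmult_assoc, <- !Cexp_plus. do 2 f_equal.
  rewrite minus_IZR, mult_IZR, mult_IZR, <- INR_IZR_INZ.
  rewrite RtoC_minus, !RtoC_mult. field. exact HkC.
Qed.

(** With y = Im tau, the factor exp (PI y r^2 / (2k)) grows, but the difference of sign and E decays
    with twice this exponent around -c; completing the square leaves half of that decay. The rate 2
    leaves room to trade decay in r for decay in j. *)
Lemma R_term_dom k tau v : (0 < k)%nat -> (0 < Im tau)%R ->
  exists K, (0 <= K)%R /\ forall r, (Cmod (R_term k tau v r) <= K * exp (- (2 * Rabs (IZR r))))%R.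
Proof.
  intros Hk Hy. assert (Hkr := lt_0_INR k Hk). pose proof PI_RGT_0 as HPI.
  assert (Hq : (0 < Im tau / INR k)%R) by (apply Rdiv_lt_0_compat; assumption).
  set (c := (2 * INR k * (Im v / Im tau))%R).
  destruct (sign_E_bound c _ (sqrt_lt_R0 _ Hq)) as [K1 [HK1 H1]].
  destruct (gauss_lin_dom (PI * Im tau / (2 * INR k)) 2 (Rabs c)) as [K2 [HK2 H2]].
  { apply Rdiv_lt_0_compat; nra. } { lra. }
  exists (K1 * K2)%R. split; [nra|]. intros r.
  unfold R_term. fold c. rewrite Cmod_mult, Cmod_R, Cmod_Cexp.
  apply Rle_trans with (K1 * exp (- (PI * sqrt (Im tau / INR k) ^ 2 * (IZR r + c) ^ 2))
    * exp (Re (- (PI * Ci * IZR r ^ 2 / (2 * INR k)) * tau - 2 * PI * Ci * IZR r * v)))%R.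
  - apply Rmult_le_compat_r; [left; apply exp_pos|apply H1].
  - rewrite !Rmult_assoc. apply Rmult_le_compat_l; [exact HK1|]. rewrite <- exp_plus.
    eapply Rle_trans; [|apply (H2 c (Rle_refl _) r)]. apply exp_le.
    rewrite <- Rmult_assoc, pow2_sqrt by lra.
    replace (- (PI * Ci * IZR r ^ 2 / (2 * INR k)) * tau - 2 * PI * Ci * IZR r * v)
      with (Ci * (RtoC (- (PI * IZR r ^ 2 / (2 * INR k))) * tau - RtoC (2 * PI * IZR r) * v)).
    2:{ rewrite RtoC_opp, RtoC_div, !RtoC_mult, RtoC_pow by lra.
        assert (HkC : RtoC (INR k) <> 0) by (intros H0; apply RtoC_inj in H0; lra). field. exact HkC. }
    replace (Re (Ci * (RtoC (- (PI * IZR r ^ 2 / (2 * INR k))) * tau - RtoC (2 * PI * IZR r) * v)))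
      with (PI * IZR r ^ 2 / (2 * INR k) * Im tau + 2 * PI * IZR r * Im v)%R
      by (destruct tau, v; simpl; ring).
    apply Rle_trans with (- (PI * Im tau / (2 * INR k) * (IZR r + c) ^ 2) - 2 * PI * INR k * (Im v) ^ 2 / Im tau)%R.
    + right. unfold c. field. lra.
    + assert (0 <= 2 * PI * INR k * Im v ^ 2 / Im tau)%R; [|lra].
      apply Rmult_le_pos; [|left; apply Rinv_0_lt_compat; exact Hy].
      apply Rmult_le_pos; [nra|apply pow2_ge_0].
Qed.

Lemma Theta_term_dom k tau u : (0 < k)%nat -> (0 < Im tau)%R ->
  exists K, (0 <= K)%R /\ forall r, (Cmod (Theta_term k tau u r) <= K * exp (- (1 * Rabs (IZR r))))%R.
Proof.
  intros Hk Hy. assert (Hkr := lt_0_INR k Hk). pose proof PI_RGT_0 as HPI.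
  set (c := (2 * INR k * Im u / Im tau)%R).
  destruct (gauss_lin_dom (PI * Im tau / (2 * INR k)) 1 (Rabs c)) as [K2 [HK2 H2]].
  { apply Rdiv_lt_0_compat; nra. } { lra. }
  exists (exp (2 * PI * INR k * Im u ^ 2 / Im tau) * K2)%R. split.
  { apply Rmult_le_pos; [left; apply exp_pos|exact HK2]. }
  intros r. unfold Theta_term. rewrite Cmod_Cexp, Rmult_assoc.
  apply Rle_trans with (exp (2 * PI * INR k * Im u ^ 2 / Im tau) * exp (- (PI * Im tau / (2 * INR k) * (IZR r + c) ^ 2)))%R.
  - rewrite <- exp_plus. right. f_equal.
    replace (PI * Ci * IZR r ^ 2 / (2 * INR k) * tau + 2 * PI * Ci * IZR r * u)
      with (Ci * (RtoC (PI * IZR r ^ 2 / (2 * INR k)) * tau + RtoC (2 * PI * IZR r) * u)).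
    2:{ rewrite RtoC_div, !RtoC_mult, RtoC_pow by lra.
        assert (HkC : RtoC (INR k) <> 0) by (intros H0; apply RtoC_inj in H0; lra). field. exact HkC. }
    replace (Re (Ci * (RtoC (PI * IZR r ^ 2 / (2 * INR k)) * tau + RtoC (2 * PI * IZR r) * u)))
      with (- (PI * IZR r ^ 2 / (2 * INR k)) * Im tau - 2 * PI * IZR r * Im u)%R
      by (destruct tau, u; simpl; ring).
    unfold c. field. lra.
  - apply Rmult_le_compat_l; [left; apply exp_pos|]. apply (H2 c (Rle_refl _)).
Qed.

Lemma Theta_term_exp_decay k tau u : (0 < k)%nat -> (0 < Im tau)%R -> exp_decay (Theta_term k tau u).
Proof. intros Hk Hy. destruct (Theta_term_dom k tau u Hk Hy) as [K [_ HK]]. exact (exp_decay_of_exp _ K HK). Qed.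

Lemma R_term_exp_decay k tau v : (0 < k)%nat -> (0 < Im tau)%R -> exp_decay (R_term k tau v).
Proof.
  intros Hk Hy. destruct (R_term_dom k tau v Hk Hy) as [K [HK0 HK]]. exists K. intros n.
  eapply Rle_trans; [apply HK|]. apply Rmult_le_compat_l; [exact HK0|].
  apply exp_le. pose proof (Rabs_pos (IZR n)). lra.
Qed.

Lemma R_Theta_exp_decay2 k tau u v : (0 < k)%nat -> (0 < Im tau)%R ->
  exp_decay2 (fun r j => R_term k tau v r * Theta_term k tau u (r - 2 * Z.of_nat k * j)).
Proof.
  intros Hk Hy. destruct (R_term_dom k tau v Hk Hy) as [K1 [HK1 H1]].
  destruct (Theta_term_dom k tau u Hk Hy) as [K2 [HK2 H2]].
  exists (K1 * K2)%R. intros r j. rewrite Cmod_mult.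
  apply Rle_trans with (K1 * exp (- (2 * Rabs (IZR r))) * (K2 * exp (- (1 * Rabs (IZR (r - 2 * Z.of_nat k * j))))))%R.
  - apply Rmult_le_compat; [apply Cmod_ge_0|apply Cmod_ge_0|apply H1|apply H2].
  - replace (K1 * exp (- (2 * Rabs (IZR r))) * (K2 * exp (- (1 * Rabs (IZR (r - 2 * Z.of_nat k * j))))))%R
      with (K1 * K2 * (exp (- (2 * Rabs (IZR r))) * exp (- (1 * Rabs (IZR (r - 2 * Z.of_nat k * j))))))%R by ring.
    rewrite (Rmult_assoc _ (expn r)). apply Rmult_le_compat_l; [nra|]. unfold expn. rewrite <- !exp_plus. apply exp_le.
    rewrite <- !abs_IZR.
    (* From 2k |j| <= |r| + |r - 2kj|; the second copy of |r| is provided by the rate 2 in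
       [R_term_dom]. *)
    assert (Z.abs r + Z.abs j <= 2 * Z.abs r + Z.abs (r - 2 * Z.of_nat k * j))%Z as Hz by nia.
    apply IZR_le in Hz. rewrite !plus_IZR, mult_IZR in Hz. lra.
Qed.

Lemma sum_n_csum (f : nat -> C) n : sum_n f n = csum f (S n).
Proof.
  induction n as [|n IH].
  - rewrite sum_O. symmetry. apply Cplus_0_l.
  - rewrite sum_Sn, IH. reflexivity.
Qed.

Lemma csum_scal c a M : csum (fun n => c * a n) M = c * csum a M.
Proof. induction M as [|M IH]; simpl; [ring|rewrite IH; ring]. Qed.

(* The pairs (r, s) with r = s modulo 2k are parametrised by r and j through s = r - 2kj. *)
Lemma sum_Rfun_Theta k tau u v : (0 < k)%nat -> (0 < Im tau)%R ->
  csum (fun l => Rfun k (Z.of_nat l) tau v * Theta (Z.of_nat l) k tau (2 * u)) (2 * k)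
  = ZSeries (fun j => lat_weight k tau u j *
      ZSeries (sign_E_term (sqrt (Im tau / INR k)) (2 * INR k * (Im v / Im tau)) (v - u + IZR j * tau))).
Proof.
  intros Hk Hy.
  assert (Hq : (0 < Im tau / INR k)%R) by (apply Rdiv_lt_0_compat; [assumption|apply lt_0_INR; exact Hk]).
  assert (Hs := sqrt_lt_R0 _ Hq).
  assert (G2 := R_Theta_exp_decay2 k tau u v Hk Hy).
  pose (g := fun r => ZSeries (fun j => R_term k tau v r * Theta_term k tau u (r - 2 * Z.of_nat k * j))).
  assert (Gg : exp_decay g) by (apply (exp_decay2_ZSeries _ G2)).
  transitivity (ZSeries g).
  - rewrite <- (ZSeries_regroup g (2 * k)) by (assumption || lia). apply csum_ext. intros l _.
    rewrite Rfun_R_term, Cmult_comm, <- ZSeries_scal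
      by (apply (exp_decay_dilate (2 * Z.of_nat k) (Z.of_nat l)); [lia|apply R_term_exp_decay; assumption]).
    apply ZSeries_ext. intros N.
    replace (Z.of_nat (2 * k)) with (2 * Z.of_nat k)%Z by lia.
    rewrite Cmult_comm. unfold g.
    assert (GT := Theta_term_exp_decay k tau u Hk Hy).
    assert (G : exp_decay (fun j => Theta_term k tau u (Z.of_nat l + 2 * Z.of_nat k * N - 2 * Z.of_nat k * j))).
    { apply exp_decay_ext with (fun j => Theta_term k tau u (Z.of_nat l + 2 * Z.of_nat k * N + 2 * Z.of_nat k * - j)).
      { intros; f_equal; ring. }
      apply (exp_decay_flip (fun j => Theta_term k tau u (Z.of_nat l + 2 * Z.of_nat k * N + 2 * Z.of_nat k * j))).
      apply exp_decay_dilate; [lia|exact GT]. }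
    rewrite ZSeries_scal by exact G. f_equal.
    rewrite Theta_Theta_term by exact Hk.
    (* In the class r = l + 2kN, shifting j by N and a reflection identify r - 2kj with l + 2kj,
       independent of N. *)
    rewrite <- (ZSeries_shift N _ G), <- ZSeries_flip.
    + apply ZSeries_ext. intros j. f_equal. ring.
    + apply exp_decay_dilate; [lia|exact GT].
  - unfold g. rewrite (ZSeries_Fubini _ G2). apply ZSeries_ext. intros j.
    rewrite <- ZSeries_scal by (apply sign_E_exp_decay; exact Hs).
    apply ZSeries_ext. intros r. apply R_Theta_term, Hk.
Qed.

(** * The lattice form of the completed function *)

Open Scope C_scope.

Lemma lat_weight_exp_decay k tau u : (0 < k)%nat -> (0 < Im tau)%R -> exp_decay (lat_weight k tau u).
Proof.
  intros Hk Hy. assert (Hkr := lt_0_INR k Hk). pose proof PI_RGT_0 as HPI.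
  set (c := (- (Im u / Im tau))%R).
  destruct (gauss_lin_dom (2 * PI * INR k * Im tau) 1 (Rabs c)) as [K [HK0 HK]]; [|lra|].
  { assert (0 < PI * INR k)%R by nra. assert (0 < PI * INR k * Im tau)%R by nra. lra. }
  apply (exp_decay_of_exp _ (exp (2 * PI * INR k * Im u ^ 2 / Im tau) * K)). intros j.
  unfold lat_weight. rewrite Cmod_Cexp, Rmult_assoc.
  apply Rle_trans with (exp (2 * PI * INR k * Im u ^ 2 / Im tau) * exp (- (2 * PI * INR k * Im tau * (IZR j + c) ^ 2)))%R.
  - rewrite <- exp_plus. right. f_equal. unfold c. destruct tau as [t y], u as [u1 u2].
    cbn [Im snd] in *. simpl. field. lra.
  - apply Rmult_le_compat_l; [left; apply exp_pos|]. apply (HK c (Rle_refl _)).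
Qed.

Lemma lat_weight_flip k tau u : (0 < k)%nat -> (0 < Im tau)%R ->
  ZSeries (lat_weight k tau (- u)) = ZSeries (lat_weight k tau u).
Proof.
  intros Hk Hy. rewrite <- (ZSeries_flip (lat_weight k tau u)) by (apply lat_weight_exp_decay; assumption).
  apply ZSeries_ext. intros j. unfold lat_weight. f_equal. rewrite opp_IZR, RtoC_opp. ring.
Qed.

Lemma lat_free_of_neq tau u v :
  (forall j : Z, Cexp (2 * PI * Ci * (v - u + IZR j * tau)) <> 1) -> lat_free tau u v.
Proof. intros H j n. unfold lat_pt. apply Cexp_period_neq, H. Qed.

(** The second denominator of Phi is the first one with u replaced by -u, since -z2 = v + u. *)
Lemma phi_defined_neq tau u v : phi_defined tau u v ->
  (forall j : Z, Cexp (2 * PI * Ci * (v - u + IZR j * tau)) <> 1) /\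
  (forall j : Z, Cexp (2 * PI * Ci * (v - - u + IZR j * tau)) <> 1).
Proof.
  intros H. split; intros j E1; destruct (H j) as [H1 H2]; [apply H1|apply H2];
    unfold qpow, e2pi; rewrite <- Cexp_plus, <- Cmult_plus_distr_l.
  - rewrite E1. ring.
  - replace (- (- v - u) + IZR j * tau) with (v - - u + IZR j * tau) by ring. rewrite E1. ring.
Qed.

Definition appell_term (k : nat) (tau u v : C) (j : Z) : C :=
  lat_weight k tau u j / (1 - Cexp (2 * PI * Ci * (v - u + IZR j * tau))).

Definition completion_term (k : nat) (tau u v : C) (j : Z) : C :=
  lat_weight k tau u j *
  ZSeries (sign_E_term (sqrt (Im tau / INR k)) (2 * INR k * (Im v / Im tau)) (v - u + IZR j * tau)).

Lemma completion_term_exp_decay k tau u v : (0 < k)%nat -> (0 < Im tau)%R -> exp_decay (completion_term k tau u v).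
Proof.
  intros Hk Hy.
  assert (Hs : (0 < sqrt (Im tau / INR k))%R).
  { apply sqrt_lt_R0, Rdiv_lt_0_compat; [assumption|apply lt_0_INR; exact Hk]. }
  apply (exp_decay_ext (fun j => ZSeries (fun r => R_term k tau v r * Theta_term k tau u (r - 2 * Z.of_nat k * j)))).
  - intros j. unfold completion_term. rewrite <- ZSeries_scal by (apply sign_E_exp_decay; exact Hs).
    apply ZSeries_ext. intros r. apply R_Theta_term, Hk.
  - apply (exp_decay2_ZSeries _ (exp_decay2_swap _ (R_Theta_exp_decay2 k tau u v Hk Hy))).
Qed.

(** Solving the row identity for the Appell term gives its decay as well, without estimating
    denominators. The -1 of the kernel identity becomes the sum of the weights. *)
Lemma appell_term_lattice k tau u v : (0 < k)%nat -> (0 < Im tau)%R ->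
  (forall j : Z, Cexp (2 * PI * Ci * (v - u + IZR j * tau)) <> 1) ->
  exp_decay (appell_term k tau u v) /\
  ZSeries (appell_term k tau u v) + / 2 * ZSeries (completion_term k tau u v)
  = ZSeries (lat_weight k tau u) + Ci / (2 * PI) * lat_sum k tau u v.
Proof.
  intros Hk Hy H.
  assert (GW := lat_weight_exp_decay k tau u Hk Hy).
  assert (GS := completion_term_exp_decay k tau u v Hk Hy).
  assert (GL := exp_decay2_ZSeries _ (lat_term_exp_decay2 k tau u v Hk Hy (lat_free_of_neq _ _ _ H))).
  assert (Eq : forall j, lat_weight k tau u j + (Ci / (2 * PI) * ZSeries (lat_term k tau u v j)
      + (- / 2) * completion_term k tau u v j) = appell_term k tau u v j).
  { intros j. assert (R := lat_row k tau u v j Hk Hy (H j)).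
    rewrite <- R.
    unfold completion_term, appell_term, Cdiv. ring. }
  split.
  - apply (exp_decay_ext _ _ Eq). apply exp_decay_plus; [exact GW|]. apply exp_decay_plus; apply exp_decay_scal; assumption.
  - rewrite <- (ZSeries_ext _ _ Eq).
    assert (GL' := exp_decay_scal (Ci / (2 * PI)) _ GL). assert (GS' := exp_decay_scal (- / 2) _ GS).
    rewrite (ZSeries_plus _ _ GW (exp_decay_plus _ _ GL' GS')), (ZSeries_plus _ _ GL' GS'),
      (ZSeries_scal _ _ GL), (ZSeries_scal _ _ GS).
    unfold lat_sum. ring.
Qed.

(** Both phi and the correction are differences between a sum at u and the same sum at -u; the sum
    of the weights, even in u, drops out. *)
Lemma phi_tilde_lattice m tau u v t : (0 < Im tau)%R -> phi_defined tau u v ->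
  phi_tilde m tau u v t
  = e2pi (INR (m + 1) * t) * (Ci / (2 * PI)) * (lat_sum (m + 1) tau u v - lat_sum (m + 1) tau (- u) v).
Proof.
  intros Hy Hd. set (k := (m + 1)%nat). assert (Hk : (0 < k)%nat) by (unfold k; lia).
  destruct (phi_defined_neq _ _ _ Hd) as [H1 H2].
  destruct (appell_term_lattice k tau u v Hk Hy H1) as [G1 A1].
  destruct (appell_term_lattice k tau (- u) v Hk Hy H2) as [G2 A2].
  rewrite lat_weight_flip in A2 by assumption.
  assert (Ephi : phi m tau u v t = e2pi (INR k * t) *
     (ZSeries (appell_term k tau u v) - ZSeries (appell_term k tau (- u) v))).
  { unfold phi, Phi. fold k. f_equal. rewrite <- ZSeries_minus by assumption.
    apply ZSeries_ext. intros j.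
    assert (W : forall z w, z = - (2 * (IZR j * w)) ->
      e2pi (INR k * z) * qpow tau (IZR j ^ 2 * INR k) = lat_weight k tau w j).
    { intros z w ->. unfold lat_weight, qpow, e2pi. rewrite <- Cexp_plus. f_equal.
      rewrite RtoC_mult, RtoC_pow. ring. }
    assert (D : forall z w, z = w -> e2pi z * qpow tau (IZR j) = Cexp (2 * PI * Ci * (w + IZR j * tau))).
    { intros z w ->. unfold qpow, e2pi. rewrite <- Cexp_plus. f_equal. ring. }
    unfold appell_term.
    rewrite (D (v - u) (v - u) eq_refl), (D (- (- v - u)) (v - - u)) by ring.
    replace (IZR j * INR k * (v - u + (- v - u))) with (INR k * (IZR j * (v - u + (- v - u)))) by ring.
    replace (- (INR k * (IZR j * (v - u + (- v - u))))) with (INR k * (- (IZR j * (v - u + (- v - u))))) by ring.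
    rewrite (W _ u), (W _ (- u)) by ring. reflexivity. }
  assert (Eadd : phi_add m tau u v t = e2pi (INR k * t) *
     (/ 2 * ZSeries (completion_term k tau u v) - / 2 * ZSeries (completion_term k tau (- u) v))).
  { unfold phi_add. fold k. rewrite sum_n_csum.
    replace (S (2 * m + 1)) with (2 * k)%nat by (unfold k; lia).
    rewrite (csum_ext _ (fun l => Rfun k (Z.of_nat l) tau v * Theta (Z.of_nat l) k tau (2 * u)
       + (- (1)) * (Rfun k (Z.of_nat l) tau v * Theta (Z.of_nat l) k tau (2 * - u)))).
    - rewrite csum_plus, csum_scal, !sum_Rfun_Theta by assumption.
      change (ZSeries (fun j => lat_weight k tau u j * ZSeries (sign_E_term (sqrt (Im tau / INR k)) (2 * INR k * (Im v / Im tau)) (v - u + IZR j * tau))))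
        with (ZSeries (completion_term k tau u v)).
      change (ZSeries (fun j => lat_weight k tau (- u) j * ZSeries (sign_E_term (sqrt (Im tau / INR k)) (2 * INR k * (Im v / Im tau)) (v - - u + IZR j * tau))))
        with (ZSeries (completion_term k tau (- u) v)).
      field.
    - intros l _. rewrite Theta_opp; [ring|exact Hk|].
      apply exp_decay_dilate; [lia|apply Theta_term_exp_decay; assumption]. }
  unfold phi_tilde. rewrite Ephi, Eadd.
  replace (lat_sum k tau u v) with (2 * PI / Ci * (ZSeries (appell_term k tau u v) + / 2 * ZSeries (completion_term k tau u v) - ZSeries (lat_weight k tau u))).
  replace (lat_sum k tau (- u) v) with (2 * PI / Ci * (ZSeries (appell_term k tau (- u) v) + / 2 * ZSeries (completion_term k tau (- u) v) - ZSeries (lat_weight k tau u))).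
  all: assert (HPI : RtoC PI <> 0) by (intros H0; apply RtoC_inj in H0; pose proof PI_RGT_0; lra).
  - field. split; first [exact HPI|exact Ci_nz].
  - rewrite A2. field. split; first [exact HPI|exact Ci_nz].
  - rewrite A1. field. split; first [exact HPI|exact Ci_nz].
Qed.

(** * Symmetries of the lattice sum *)

Lemma lat_sum_shift k tau u v (al be : R) (p d : Z) : (0 < k)%nat -> (0 < Im tau)%R -> lat_free tau u v ->
  (2 * al = IZR p)%R -> (be - al = IZR d)%R ->
  lat_sum k tau (u + al) (v + be) = lat_sum k tau u v.
Proof.
  intros Hk Hy Hf Hp Hd.
  assert (G := lat_term_exp_decay2 k tau u v Hk Hy Hf).
  apply ZSeries_ext. intros j.
  rewrite <- (ZSeries_shift d _ (exp_decay2_row _ j G)). apply ZSeries_ext. intros n.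
  assert (Ep : lat_pt tau (u + al) (v + be) j n = lat_pt tau u v j (n + d)).
  { unfold lat_pt. rewrite plus_IZR, RtoC_plus, <- Hd, RtoC_minus. ring. }
  unfold lat_term. rewrite Ep. f_equal.
  (* The exponent changes by 4 PI i k j al up to sign, a period because 2 al = p. *)
  rewrite <- (Cexp_period _ (Z.of_nat k * j * p)). f_equal.
  unfold lat_exp. rewrite Ep. replace (Im (v + be)) with (Im v) by (rewrite Im_plus, im_RtoC; ring).
  rewrite !mult_IZR, <- INR_IZR_INZ, <- Hp, !RtoC_mult. ring.
Qed.

(** From j (tau + 1) + n = j tau + (n + j): each row is shifted along itself, and the exponent
    changes by the period 2 PI i k j^2. *)
Lemma lat_sum_tau_succ k tau u v : (0 < k)%nat -> (0 < Im tau)%R -> lat_free tau u v ->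
  lat_sum k (tau + 1) u v = lat_sum k tau u v.
Proof.
  intros Hk Hy Hf.
  assert (G := lat_term_exp_decay2 k tau u v Hk Hy Hf).
  apply ZSeries_ext. intros j.
  rewrite <- (ZSeries_shift j _ (exp_decay2_row _ j G)). apply ZSeries_ext. intros n.
  assert (Ep : lat_pt (tau + 1) u v j n = lat_pt tau u v j (n + j)).
  { unfold lat_pt. rewrite plus_IZR, RtoC_plus. ring. }
  unfold lat_term. rewrite Ep. f_equal.
  rewrite <- (Cexp_period (lat_exp k tau u v j (n + j)) (Z.of_nat k * j * j)). f_equal.
  unfold lat_exp. rewrite Ep. replace (Im (tau + 1)) with (Im tau) by (rewrite Im_plus, im_RtoC; ring).
  rewrite !mult_IZR, <- INR_IZR_INZ, !RtoC_mult. ring.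
Qed.

(** Since -v - u + j tau + n = -(v + u - j tau - n), the exponent is that of (-u, v) at (-j, -n),
    and the sign comes from the denominator. *)
Lemma lat_sum_opp_v k tau u v : (0 < k)%nat -> (0 < Im tau)%R -> lat_free tau (- u) v ->
  lat_sum k tau u (- v) = - lat_sum k tau (- u) v.
Proof.
  intros Hk Hy Hf.
  assert (G := lat_term_exp_decay2 k tau (- u) v Hk Hy Hf).
  assert (GZ := exp_decay2_ZSeries _ G).
  unfold lat_sum.
  rewrite <- (ZSeries_flip _ GZ).
  transitivity (- (1) * ZSeries (fun j => ZSeries (lat_term k tau (- u) v (- j)))); [|ring].
  rewrite <- ZSeries_scal by (exact (exp_decay_flip _ GZ)).
  apply ZSeries_ext. intros j.
  rewrite <- (ZSeries_flip _ (exp_decay2_row _ (- j) G)).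
  rewrite <- ZSeries_scal by (apply exp_decay_flip, exp_decay2_row, G).
  apply ZSeries_ext. intros n.
  assert (Ep : lat_pt tau u (- v) j n = - lat_pt tau (- u) v (- j) (- n)).
  { unfold lat_pt. rewrite !opp_IZR, !RtoC_opp. ring. }
  unfold lat_term. rewrite Ep.
  replace (lat_exp k tau u (- v) j n) with (lat_exp k tau (- u) v (- j) (- n)).
  - field. apply Hf.
  - unfold lat_exp. rewrite Ep, !opp_IZR, !RtoC_opp.
    replace (Im (- v) / Im tau)%R with (- (Im v / Im tau))%R by (rewrite Im_opp; unfold Rdiv; ring).
    rewrite RtoC_opp. ring.
Qed.

Lemma lat_sum_tau_shift k tau u v (al be : R) (p d : Z) : (0 < k)%nat -> (0 < Im tau)%R -> lat_free tau u v ->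
  (2 * be = IZR p)%R -> (be - al = IZR d)%R ->
  lat_sum k tau (u + al * tau) (v + be * tau)
  = qpow tau (INR k * (be ^ 2 - al ^ 2)) * Cexp (4 * PI * Ci * INR k * (- (al * u) + be * v)) * lat_sum k tau u v.
Proof.
  intros Hk Hy Hf Hp Hd.
  assert (G := lat_term_exp_decay2 k tau u v Hk Hy Hf).
  assert (GZ := exp_decay2_ZSeries _ G).
  unfold lat_sum. rewrite <- (ZSeries_shift d _ GZ).
  rewrite <- ZSeries_scal by (apply (exp_decay_shift d _ GZ)).
  apply ZSeries_ext. intros j. rewrite <- ZSeries_scal by (apply (exp_decay2_row _ (j + d) G)).
  apply ZSeries_ext. intros n.
  assert (Ep : lat_pt tau (u + al * tau) (v + be * tau) j n = lat_pt tau u v (j + d) n).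
  { unfold lat_pt. rewrite plus_IZR, RtoC_plus, <- Hd, RtoC_minus. ring. }
  unfold lat_term. rewrite Ep. unfold Cdiv. rewrite Cmult_assoc. f_equal.
  unfold qpow, e2pi. rewrite <- !Cexp_plus.
  (* Im v / Im tau grows by be, which contributes a factor exp (4 PI i k be z); its dependence on n
     is trivial because 2 be is an integer. *)
  rewrite <- (Cexp_period _ (- (Z.of_nat k * p * n))). f_equal.
  unfold lat_exp. rewrite Ep.
  replace (Im (v + be * tau) / Im tau)%R with (Im v / Im tau + be)%R by (rewrite Im_plus, Im_mult, re_RtoC, im_RtoC; field; lra).
  unfold lat_pt. rewrite !plus_IZR, opp_IZR, !mult_IZR, <- INR_IZR_INZ, <- Hp, <- Hd.
  rewrite RtoC_opp, !RtoC_mult, !RtoC_plus, !RtoC_minus, ?RtoC_mult, !RtoC_pow.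
  generalize (RtoC (PI * INR k / Im tau)) as X. intros X.
  generalize (RtoC (Im v / Im tau)) as Y. intros Y. ring.
Qed.

(** Division by tau carries the point of index (n, -j) for tau to the point of index (j, n) for
    -1/tau, and 1/z gains the factor tau. Rows and columns are exchanged, so this symmetry rests on
    Fubini. *)
Lemma lat_sum_inversion k tau u v : (0 < k)%nat -> (0 < Im tau)%R -> lat_free tau u v ->
  lat_sum k (- (1) / tau) (u / tau) (v / tau)
  = tau * Cexp (2 * PI * Ci * INR k * ((u * u - v * v) / tau)) * lat_sum k tau u v.
Proof.
  intros Hk Hy Hf.
  assert (Htau : tau <> 0) by (intros H0; rewrite H0 in Hy; simpl in Hy; lra).
  assert (HyC : RtoC (Im tau) <> 0) by (intros H0; apply RtoC_inj in H0; lra).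
  assert (G := lat_term_exp_decay2 k tau u v Hk Hy Hf).
  set (M := tau * Cexp (2 * PI * Ci * INR k * ((u * u - v * v) / tau))).
  assert (G' : exp_decay2 (fun j n => lat_term k tau u v n (- j))).
  { destruct G as [K HK]. exists K. intros j n. specialize (HK n (- j)%Z).
    rewrite expn_opp in HK. lra. }
  transitivity (M * ZSeries (fun j => ZSeries (fun n => lat_term k tau u v n (- j)))).
  - rewrite <- ZSeries_scal by (apply (exp_decay2_ZSeries _ G')).
    apply ZSeries_ext. intros j. rewrite <- ZSeries_scal by (apply (exp_decay2_row _ j G')).
    apply ZSeries_ext. intros n.
    set (N := (Re tau ^ 2 + Im tau ^ 2)%R).
    assert (HN : (0 < N)%R) by (unfold N; nra).
    (* |tau|^2 as tau times its conjugate, written without conjugation so that [field] applies. *)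
    assert (HNC : RtoC N = tau * (tau - 2 * Ci * Im tau)).
    { unfold N. destruct tau as [t y]. apply C_ext; simpl; ring. }
    (* In real coordinates v = a tau + b, and inversion sends (a, b) to (-b, a). *)
    set (a := (Im v / Im tau)%R). set (b := (Re v - a * Re tau)%R).
    assert (Ev : v = a * tau + b).
    { unfold a, b. destruct tau as [t y], v as [v1 v2]. cbn [Im snd] in *. apply C_ext; simpl; unfold a; simpl; field; lra. }
    assert (Ey : Im (- (1) / tau) = (Im tau / N)%R).
    { unfold N. destruct tau as [t y]. cbn [Im snd] in *. simpl. unfold N in HN; simpl in HN. field. simpl. lra. }
    assert (Ea : (Im (v / tau) / Im (- (1) / tau))%R = (- b)%R).
    { rewrite Ey. rewrite Ev at 1. unfold N in *. destruct tau as [t y]. cbn [Im Re fst snd] in *. simpl in HN |- *. field. split; lra. }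
    assert (Ek : RtoC (PI * INR k / Im (- (1) / tau)) = PI * INR k / Im tau * (tau * (tau - 2 * Ci * Im tau))).
    { rewrite Ey, <- HNC. replace (PI * INR k / (Im tau / N))%R with (PI * INR k / Im tau * N)%R by (field; lra).
      rewrite RtoC_mult, RtoC_div, RtoC_mult by lra. reflexivity. }
    assert (Ep : lat_pt (- (1) / tau) (u / tau) (v / tau) j n = lat_pt tau u v n (- j) / tau).
    { unfold lat_pt. rewrite opp_IZR, RtoC_opp. field. exact Htau. }
    unfold lat_term. rewrite Ep. unfold M.
    replace (Cexp (lat_exp k (- (1) / tau) (u / tau) (v / tau) j n))
      with (Cexp (2 * PI * Ci * INR k * ((u * u - v * v) / tau)) * Cexp (lat_exp k tau u v n (- j))).
    { field. split; [apply Hf|exact Htau]. }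
    (* The remaining discrepancy between the exponents, 4 PI i k j n up to sign, is a period. *)
    rewrite <- Cexp_plus. rewrite <- (Cexp_period _ (- (2 * Z.of_nat k * j * n))). f_equal.
    unfold lat_exp. rewrite Ep, Ea, Ek. fold a. unfold lat_pt.
    rewrite !opp_IZR, !mult_IZR, <- INR_IZR_INZ, !RtoC_opp, !RtoC_mult, RtoC_div, !RtoC_mult by lra.
    rewrite Ev at 1 2. rewrite Ev.
    generalize (RtoC (Im tau)) HyC. intros Y HY. field. split; assumption.
  - f_equal. rewrite (ZSeries_Fubini _ G'). apply ZSeries_ext. intros n.
    apply (ZSeries_flip (lat_term k tau u v n)), exp_decay2_row, G.
Qed.

(** * The transformation properties *)

Open Scope C_scope.

Lemma phi_defined_free tau u v : phi_defined tau u v -> lat_free tau u v /\ lat_free tau (- u) v.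
Proof.
  intros H. destruct (phi_defined_neq _ _ _ H) as [H1 H2]. split; apply lat_free_of_neq; assumption.
Qed.

Lemma Im_neg_inv_pos (tau : C) : (0 < Im tau)%R -> (0 < Im (- (1) / tau))%R.
Proof.
  destruct tau as [t y]. cbn [Im snd]. intros Hy.
  replace (Im (- (1) / (t, y))) with (y / (t ^ 2 + y ^ 2))%R.
  - apply Rdiv_lt_0_compat; [exact Hy|nra].
  - simpl. field. simpl. nra.
Qed.

Theorem theorem5p9 (m : nat) (tau u v t : C) (Htau : (0 < Im tau)%R) :
  (* (a) *)
  (phi_defined (- (1) / tau) (u / tau) (v / tau) -> phi_defined tau u v ->
   phi_tilde m (- (1) / tau) (u / tau) (v / tau) (t - (u * u - v * v) / tau)
   = tau * phi_tilde m tau u v t)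
  /\
  (* (b) *)
  (forall a b : R, half_integer a -> half_integer b -> integer (a + b) ->
   phi_defined tau (u + a) (v + b) -> phi_defined tau u v ->
   phi_tilde m tau (u + a) (v + b) t = phi_tilde m tau u v t)
  /\
  (* (c) *)
  ((phi_defined tau u (- v) -> phi_defined tau u v ->
    phi_tilde m tau u (- v) t = phi_tilde m tau u v t)
   /\
   (phi_defined tau (- u) v -> phi_defined tau u v ->
    phi_tilde m tau (- u) v t = - phi_tilde m tau u v t))
  /\
  (* (d) *)
  (phi_defined (tau + 1) u v -> phi_defined tau u v ->
   phi_tilde m (tau + 1) u v t = phi_tilde m tau u v t)
  /\
  (* (e) *)
  (forall a b : R, half_integer a -> half_integer b -> integer (a + b) ->
   phi_defined tau (u + a * tau) (v + b * tau) -> phi_defined tau u v ->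
   phi_tilde m tau (u + a * tau) (v + b * tau) t
   = qpow tau (INR (m + 1) * (b ^ 2 - a ^ 2))
     * Cexp (4 * PI * Ci * INR (m + 1) * (- (a * u) + b * v))
     * phi_tilde m tau u v t).
Proof.
  set (k := (m + 1)%nat). assert (Hk : (0 < k)%nat) by (unfold k; lia).
  (* The lattice is shifted by b - a in the sum at u and by b + a in the sum at -u; both are
     integers because 2a is. *)
  assert (Par : forall a b : R, half_integer a -> half_integer b -> integer (a + b) ->
     exists p r d e : Z, (2 * a = IZR p /\ 2 * b = IZR r /\ b - a = IZR d /\ b + a = IZR e)%R).
  { intros a b [p Hp] [r Hr] [e He]. exists p, r, (e - p)%Z, e. rewrite minus_IZR, <- He, Hp, Hr.
    repeat split; field. }
  assert (Hopp : forall a : R, RtoC (- a) = - RtoC a) by apply RtoC_opp.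
  split; [|split; [|split; [split|split]]].
  - intros D1 D2. destruct (phi_defined_free _ _ _ D2) as [F1 F2].
    assert (Ht0 : tau <> 0) by (intros H0; rewrite H0 in Htau; simpl in Htau; lra).
    rewrite (phi_tilde_lattice m _ _ _ _ (Im_neg_inv_pos tau Htau) D1), (phi_tilde_lattice m _ _ _ _ Htau D2).
    fold k. replace (- (u / tau)) with (- u / tau) by (field; exact Ht0).
    rewrite !lat_sum_inversion by assumption.
    (* The factor produced by inversion is even in u, hence common to both lattice sums; the change
       of t cancels its exponential. *)
    replace (- u * - u) with (u * u) by ring.
    replace (e2pi (INR k * t)) with (e2pi (INR k * (t - (u * u - v * v) / tau))
       * Cexp (2 * PI * Ci * INR k * ((u * u - v * v) / tau))).
    + ring.
    + unfold e2pi. rewrite <- Cexp_plus. f_equal. ring.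
  - intros a b Ha Hb Hab D1 D2. destruct (phi_defined_free _ _ _ D2) as [F1 F2].
    destruct (Par a b Ha Hb Hab) as (p & r & d & e & Hp & Hr & Hd & He).
    rewrite (phi_tilde_lattice m _ _ _ _ Htau D1), (phi_tilde_lattice m _ _ _ _ Htau D2).
    fold k. replace (- (u + a)) with (- u + RtoC (- a)) by (rewrite Hopp; ring).
    rewrite (lat_sum_shift k tau u v a b p d), (lat_sum_shift k tau (- u) v (- a) b (- p) e);
      try assumption; [reflexivity|rewrite opp_IZR; lra|lra].
  - intros D1 D2. destruct (phi_defined_free _ _ _ D2) as [F1 F2].
    rewrite (phi_tilde_lattice m _ _ _ _ Htau D1), (phi_tilde_lattice m _ _ _ _ Htau D2).
    fold k. rewrite !lat_sum_opp_v by (try replace (- - u) with u by ring; assumption).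
    replace (- - u) with u by ring. ring.
  - intros D1 D2.
    rewrite (phi_tilde_lattice m _ _ _ _ Htau D1), (phi_tilde_lattice m _ _ _ _ Htau D2).
    replace (- - u) with u by ring. ring.
  - intros D1 D2. destruct (phi_defined_free _ _ _ D2) as [F1 F2].
    assert (Htau1 : (0 < Im (tau + 1))%R) by (rewrite Im_plus, im_RtoC; lra).
    rewrite (phi_tilde_lattice m _ _ _ _ Htau1 D1), (phi_tilde_lattice m _ _ _ _ Htau D2).
    rewrite !lat_sum_tau_succ by assumption. reflexivity.
  - intros a b Ha Hb Hab D1 D2. destruct (phi_defined_free _ _ _ D2) as [F1 F2].
    destruct (Par a b Ha Hb Hab) as (p & r & d & e & Hp & Hr & Hd & He).
    rewrite (phi_tilde_lattice m _ _ _ _ Htau D1), (phi_tilde_lattice m _ _ _ _ Htau D2).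
    fold k. replace (- (u + a * tau)) with (- u + RtoC (- a) * tau) by (rewrite Hopp; ring).
    rewrite (lat_sum_tau_shift k tau u v a b r d), (lat_sum_tau_shift k tau (- u) v (- a) b r e);
      try assumption; [|lra].
    (* The factor is unchanged under (a, u) -> (-a, -u), hence common to both lattice sums. *)
    replace (b ^ 2 - (- a) ^ 2)%R with (b ^ 2 - a ^ 2)%R by ring.
    rewrite Hopp. replace (- (- a * - u)) with (- (a * u)) by ring. ring.
Qed.
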